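(* Let $\mu,\nu$ be compositions of $n$ and suppose $M$ is an $\mathcal{A}_\nu(F)$-module. Then $\operatorname{Res}^n_\mu\operatorname{Ind}^n_\nu M$ admits a filtration with subquotients evenly isomorphic to $$\operatorname{Ind}^\mu_{\mu\cap\pi\nu}\,{}^\pi\!\left(\operatorname{Res}^\nu_{\pi^{-1}\mu\cap\nu}M\right),$$ one for each $\pi\in D_{\mu,\nu}$. Furthermore, the subquotients can be taken in any order refining the strong Bruhat order on $D_{\mu,\nu}$. In particular, $\operatorname{Ind}^\mu_{\mu\cap\nu}\operatorname{Res}^\nu_{\mu\cap\nu}M$ appears as a submodule.
   Context: $\Bbbk$ is a commutative ring of characteristic not equal to $2$. ''Algebra'' means associative unital $\mathbb{Z}$-graded $\Bbbk$-superalgebra, ''module'' means $\mathbb{Z}$-graded left supermodule; $|a|$ is the degree and $\bar a$ the parity. An even isomorphism is an invertible module homomorphism of degree $0$ and parity $0$. $A\text{-mod}$ is the category of finitely generated $A$-modules with even degree-zero homomorphisms. Tensor products are over $\Bbbk$ with $(a_1\otimes a_2)(b_1\otimes b_2)=(-1)^{\bar a_2\bar b_1}a_1b_1\otimes a_2b_2$. $F$ is an $\mathbb{N}$-graded Frobenius superalgebra, free of finite rank over $\Bbbk$: there is a parity-preserving linear trace map $\operatorname{tr}\colon F\to\Bbbk$, homogeneous in degree, such that $f\mapsto(g\mapsto(-1)^{\bar f\bar g}\operatorname{tr}(gf))$ is an isomorphism $F\to\operatorname{Hom}_\Bbbk(F,\Bbbk)$. The Nakayama automorphism $\psi$ is defined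 by $\operatorname{tr}(fg)=(-1)^{\bar f\bar g}\operatorname{tr}(g\psi(f))$. $\delta$ is the maximum degree of elements of $F$. It is assumed that $\psi$ has finite order $\theta$, that the characteristic of $\Bbbk$ does not divide $\theta$, and that $F$ has a basis of eigenvectors of $\psi$. $B$ is a homogeneous basis of $F$ and $\{b^\vee\}$ its left dual basis: $\operatorname{tr}(b^\vee c)=\delta_{b,c}$. For $f\in F$: $f_i=1^{\otimes(i-1)}\otimes f\otimes1^{\otimes(n-i)}\in F^{\otimes n}$ and $\psi_i=\operatorname{id}^{\otimes(i-1)}\otimes\psi\otimes\operatorname{id}^{\otimes(n-i)}$. $S_n$ acts on $F^{\otimes n}$ by superpermuting factors, written ${}^\pi\mathbf{f}$: ${}^{s_i}(f_1\otimes\cdots\otimes f_n)=(-1)^{\bar f_i\bar f_{i+1}}f_1\otimes\cdots\otimes f_{i+1}\otimes f_i\otimes\cdots\otimes f_n$, with $s_i$ the transposition of $i,i+1$. The affine wreath product algebra $\mathcal{A}_n(F)$ is the free product $\Bbbk[x_1,\dots,x_n]\star F^{\otimes n}\star\Bbbk S_n$ modulo the relations: $\mathbf{f}x_i=x_i\psi_i(\mathbf{f})$; $s_ix_j=x_js_i$ ($j\ne i,i+1$); $s_ix_i=x_{i+1}s_i-t_{i,i+1}$; $\pi\mathbf{f}={}^\pi\mathbf{f}\,\pi$ ($\pi\in S_n$), where $t_{i,j}=\sum_{b\in B}b_i(b^\vee)_j$ for $i\neq j$. Gradings: $|x_i|=\delta$, $\bar x_i=0$; $f_i$ has the degree and parity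 of $f$; $\pi\in S_n$ has degree and parity $0$. For a composition $\mu=(\mu_1,\dots,\mu_r)$ of $n$, $S_\mu\cong S_{\mu_1}\times\cdots\times S_{\mu_r}$ is the corresponding Young subgroup of $S_n$, and $\mathcal{A}_\mu(F)$ is the subalgebra of $\mathcal{A}_n(F)$ generated by $F^{\otimes n}$, $\Bbbk[x_1,\dots,x_n]$ and $S_\mu$. When $\mathcal A_{\lambda}(F)\subseteq\mathcal A_{\kappa}(F)$, $\operatorname{Res}^\kappa_\lambda$ denotes restriction and $\operatorname{Ind}^\kappa_\lambda=\mathcal{A}_\kappa(F)\otimes_{\mathcal{A}_\lambda(F)}-$ induction; superscript $n$ refers to $\mathcal{A}_n(F)$. $D_{\mu,\nu}$ is the set of minimal length $(S_\mu,S_\nu)$-double coset representatives in $S_n$. For $\pi\in D_{\mu,\nu}$, $S_\mu\cap\pi S_\nu\pi^{-1}$ and $\pi^{-1}S_\mu\pi\cap S_\nu$ are Young subgroups, and the compositions $\mu\cap\pi\nu$ and $\pi^{-1}\mu\cap\nu$ are defined by $S_{\mu\cap\pi\nu}=S_\mu\cap\pi S_\nu\pi^{-1}$ and $S_{\pi^{-1}\mu\cap\nu}=\pi^{-1}S_\mu\pi\cap S_\nu$. There is an algebra isomorphism $\varphi_{\pi^{-1}}\colon\mathcal{A}_{\mu\cap\pi\nu}(F)\to\mathcal{A}_{\pi^{-1}\mu\cap\nu}(F)$ given by $\sigma\mapsto\pi^{-1}\sigma\pi$, $f_i\mapsto f_{\pi^{-1}(i)}$, $x_i\mapsto x_{\pi^{-1}(i)}$.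 For a left $\mathcal{A}_{\pi^{-1}\mu\cap\nu}(F)$-module $N$, ${}^\pi N$ is the $\mathcal{A}_{\mu\cap\pi\nu}(F)$-module with underlying space $N$ and action $a\cdot v=\varphi_{\pi^{-1}}(a)v$. *)

(* Defs.v *)
From HB Require Import structures.
From mathcomp Require Import all_boot all_order all_algebra all_fingroup.
From mathcomp Require Import boolp.

Set Implicit Arguments.
Unset Strict Implicit.
Unset Printing Implicit Defensive.

Import GRing.Theory.
Local Open Scope ring_scope.

(* [h d p] is the homogeneous part of degree d and parity p ([true] = odd);   *)
(* [is_grading h] says that V is the internal direct sum of these parts.      *)

Record is_grading (V : zmodType) (h : int -> bool -> V -> Prop) : Prop := {
  gr_zero : forall d p, h d p 0;
  gr_sub : forall d p u v, h d p u -> h d p v -> h d p (u - v);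
  gr_span : forall v, exists (s : seq (int * bool)) (c : int * bool -> V),
    (forall i, h i.1 i.2 (c i)) /\ v = \sum_(i <- s) c i;
  gr_direct : forall (s : seq (int * bool)) (c : int * bool -> V),
    uniq s -> (forall i, h i.1 i.2 (c i)) -> \sum_(i <- s) c i = 0 ->
    forall i, i \in s -> c i = 0
}.

(* A ring, resp. a module, with a designated family of homogeneous parts; no  *)
(* axiom is imposed at this stage (see [is_grading], [graded_module]).        *)
Record hring := HRing {
  hring_car :> pzRingType;
  rhom : int -> bool -> hring_car -> Prop
}.

Record hmod (R : pzRingType) := HMod {
  hmod_car :> lmodType R;
  mhom : int -> bool -> hmod_car -> Prop
}.

Definition graded_module (R : hring) (M : hmod R) : Prop :=
  is_grading (@mhom R M) /\
  (forall d p e q (a : R) (v : M),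
     rhom d p a -> mhom e q v -> mhom (d + e) (p (+) q) (a *: v)).

(* Even isomorphism: degree 0 and parity 0. *)
Definition evenly_iso (R : pzRingType) (M N : hmod R) : Prop :=
  exists f : {linear M -> N},
    bijective f /\ forall d p v, mhom d p v <-> mhom d p (f v).

(* Even embedding, i.e. even isomorphism onto a submodule. *)
Definition evenly_embeds (R : pzRingType) (M N : hmod R) : Prop :=
  exists f : {linear M -> N},
    injective f /\ forall d p v, mhom d p v <-> mhom d p (f v).

Definition res_type (R S : pzRingType) (phi : {rmorphism R -> S})
  (V : lmodType S) : Type := V.

Section Restriction.
Variables (R S : pzRingType) (phi : {rmorphism R -> S}) (V : lmodType S).
HB.instance Definition _ := GRing.Zmodule.copy (res_type phi V) V.

Definition res_scale (a : R) (v : res_type phi V) : res_type phi V :=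
  phi a *: (v : V).

Fact res_scaleA a b v : res_scale a (res_scale b v) = res_scale (a * b) v.
Proof. by rewrite /res_scale scalerA rmorphM. Qed.
Fact res_scale1 : left_id 1 res_scale.
Proof. by move=> v; rewrite /res_scale rmorph1 scale1r. Qed.
Fact res_scaleDr : right_distributive res_scale +%R.
Proof. by move=> a u v; rewrite /res_scale scalerDr. Qed.
Fact res_scaleDl v : {morph res_scale^~ v : a b / a + b}.
Proof. by move=> a b; rewrite /res_scale rmorphD scalerDl. Qed.
HB.instance Definition _ := GRing.Zmodule_isLmodule.Build R (res_type phi V)
  res_scaleA res_scale1 res_scaleDr res_scaleDl.
End Restriction.

Definition Res (R S : pzRingType) (phi : {rmorphism R -> S}) (M : hmod S) :
  hmod R := @HMod R (res_type phi M) (@mhom S M).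

(* In S (x)_R V, the list [:: (a_1, v_1); ...; (a_m, v_m)] represents the sum *)
(* of the a_i (x) v_i.                                                        *)

Section Induction.
Variables (R S : pzRingType) (phi : {rmorphism R -> S}) (V : lmodType R).

Notation fsum := (seq (S * V)).

Inductive tens_eq : fsum -> fsum -> Prop :=
| te_refl x : tens_eq x x
| te_sym x y : tens_eq x y -> tens_eq y x
| te_trans y x z : tens_eq x y -> tens_eq y z -> tens_eq x z
| te_cat x x' y y' :
    tens_eq x x' -> tens_eq y y' -> tens_eq (x ++ y) (x' ++ y')
| te_catC x y : tens_eq (x ++ y) (y ++ x)
| te_0l v : tens_eq [:: (0, v)] [::]
| te_Dl a b v : tens_eq [:: (a + b, v)] [:: (a, v); (b, v)]
| te_Dr a v w : tens_eq [:: (a, v + w)] [:: (a, v); (a, w)]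
| te_bal a r v : tens_eq [:: (a * phi r, v)] [:: (a, r *: v)].

Definition tens_eqb : rel fsum := fun x y => `[< tens_eq x y >].
Fact tens_eqb_refl : reflexive tens_eqb.
Proof. by move=> x; apply/asboolP; exact: te_refl. Qed.
Fact tens_eqb_sym : symmetric tens_eqb.
Proof. by move=> x y; apply/asboolP/asboolP; exact: te_sym. Qed.
Fact tens_eqb_trans : transitive tens_eqb.
Proof.
by move=> y x z /asboolP xy /asboolP yz; apply/asboolP; exact: te_trans xy yz.
Qed.
Canonical tens_equiv := EquivRel tens_eqb tens_eqb_refl tens_eqb_sym
  tens_eqb_trans.

Definition ind_type : Type := {eq_quot tens_equiv}%qT.
HB.instance Definition _ := Choice.on ind_type.
HB.instance Definition _ := EqQuotient.on ind_type.

Definition to_ind (x : fsum) : ind_type := (\pi_ind_type x)%qT.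

Lemma to_indP x y : to_ind x = to_ind y <-> tens_eq x y.
Proof.
by split=> [/eqmodP/asboolP //|xy]; apply/eqmodP/asboolP.
Qed.

Definition ind_repr (u : ind_type) : fsum := generic_quotient.repr u.

Lemma ind_reprK u : to_ind (ind_repr u) = u. Proof. exact: reprK. Qed.

Lemma ind_repr_eq x : tens_eq (ind_repr (to_ind x)) x.
Proof. by apply/to_indP; rewrite ind_reprK. Qed.

Definition fsum_opp (x : fsum) : fsum := [seq (- av.1, av.2) | av <- x].
Definition fsum_scale (s : S) (x : fsum) : fsum :=
  [seq (s * av.1, av.2) | av <- x].

Fact tens_eq_scale s x y :
  tens_eq x y -> tens_eq (fsum_scale s x) (fsum_scale s y).
Proof.
elim=> {x y} [x|x y _|y x z _ xy _|x x' y y' _ Hx _ Hy|x y|v|a b v|a v w|a r v].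
- exact: te_refl.
- exact: te_sym.
- exact: te_trans.
- by rewrite /fsum_scale !map_cat; exact: te_cat.
- by rewrite /fsum_scale !map_cat; exact: te_catC.
- by rewrite /= mulr0; exact: te_0l.
- by rewrite /= mulrDr; exact: te_Dl.
- exact: te_Dr.
- by rewrite /= mulrA; exact: te_bal.
Qed.

Fact fsum_oppE x : fsum_opp x = fsum_scale (-1) x.
Proof. by apply: eq_map => av; rewrite mulN1r. Qed.

Definition ind_add (u v : ind_type) := to_ind (ind_repr u ++ ind_repr v).
Definition ind_opp (u : ind_type) := to_ind (fsum_opp (ind_repr u)).
Definition ind_scale (s : S) (u : ind_type) := to_ind (fsum_scale s (ind_repr u)).

Lemma to_indD x y : to_ind (x ++ y) = ind_add (to_ind x) (to_ind y).
Proof.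
by apply/to_indP; apply: te_sym; apply: te_cat; exact: ind_repr_eq.
Qed.
Lemma to_indZ s x : to_ind (fsum_scale s x) = ind_scale s (to_ind x).
Proof.
by apply/to_indP/tens_eq_scale; apply: te_sym; exact: ind_repr_eq.
Qed.
Lemma to_indN x : to_ind (fsum_opp x) = ind_opp (to_ind x).
Proof. by rewrite fsum_oppE to_indZ /ind_opp fsum_oppE. Qed.

Lemma ind_typeP (P : ind_type -> Prop) :
  (forall x, P (to_ind x)) -> forall u, P u.
Proof. by move=> HP u; rewrite -(ind_reprK u). Qed.

Fact ind_addA : associative ind_add.
Proof.
elim/ind_typeP=> x; elim/ind_typeP=> y; elim/ind_typeP=> z.
by rewrite -!to_indD catA.
Qed.
Fact ind_addC : commutative ind_add.
Proof.
elim/ind_typeP=> x; elim/ind_typeP=> y.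
by rewrite -!to_indD; apply/to_indP; exact: te_catC.
Qed.
Fact ind_add0 : left_id (to_ind [::]) ind_add.
Proof. by elim/ind_typeP=> x; rewrite -!to_indD. Qed.
Fact ind_addN : left_inverse (to_ind [::]) ind_opp ind_add.
Proof.
elim/ind_typeP=> x; rewrite -to_indN -to_indD; apply/to_indP.
elim: x => [|[a v] x IHx] /=; first exact: te_refl.
apply: (te_trans (y := fsum_opp x ++ x ++ [:: (- a, v); (a, v)])).
  have h1 := te_catC [:: (- a, v)] (fsum_opp x ++ (a, v) :: x).
  apply: te_trans h1 _; rewrite -catA; apply: te_cat; first exact: te_refl.
  apply: te_trans (te_catC _ _) _ => /=.
  have := te_catC [:: (- a, v); (a, v)] x; exact.
rewrite catA -[X in tens_eq _ X]/([::] ++ [::] : fsum); apply: te_cat => //.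
apply: te_trans (te_sym (te_Dl _ _ _)) _; rewrite addNr; exact: te_0l.
Qed.
HB.instance Definition _ :=
  GRing.isZmodule.Build ind_type ind_addA ind_addC ind_add0 ind_addN.

Lemma ind_addE (u v : ind_type) : u + v = ind_add u v. Proof. by []. Qed.

Fact ind_scaleA a b v : ind_scale a (ind_scale b v) = ind_scale (a * b) v.
Proof.
elim/ind_typeP: v => x; rewrite -!to_indZ; congr to_ind.
by rewrite /fsum_scale -map_comp; apply: eq_map => av /=; rewrite mulrA.
Qed.
Fact ind_scale1 : left_id 1 ind_scale.
Proof.
elim/ind_typeP=> x; rewrite -!to_indZ; congr to_ind.
by elim: x => //= -[a v] x ->; rewrite mul1r.
Qed.
Fact ind_scaleDr : right_distributive ind_scale +%R.
Proof.
move=> a; elim/ind_typeP=> x; elim/ind_typeP=> y.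
by rewrite !ind_addE -to_indD -!to_indZ -to_indD /fsum_scale map_cat.
Qed.
Fact ind_scaleDl v : {morph ind_scale^~ v : a b / a + b}.
Proof.
move=> a b; elim/ind_typeP: v => x.
rewrite ind_addE -!to_indZ -to_indD; apply/to_indP.
elim: x => [|[c v] x IHx] /=; first exact: te_refl.
apply: (te_trans (y := [:: (a * c, v); (b * c, v)] ++
                       (fsum_scale a x ++ fsum_scale b x))).
  rewrite -cat1s; apply: te_cat; last exact: IHx.
  by rewrite mulrDl; exact: te_Dl.
rewrite -[X in tens_eq X _]/([:: (a * c, v)] ++
  ([:: (b * c, v)] ++ (fsum_scale a x ++ fsum_scale b x))).
rewrite -[X in tens_eq _ X]/([:: (a * c, v)] ++
  (fsum_scale a x ++ ([:: (b * c, v)] ++ fsum_scale b x))).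
apply: te_cat; first exact: te_refl.
rewrite !catA; apply: te_cat; [exact: te_catC | exact: te_refl].
Qed.
HB.instance Definition _ := GRing.Zmodule_isLmodule.Build S ind_type
  ind_scaleA ind_scale1 ind_scaleDr ind_scaleDl.

Definition pure (a : S) (v : V) : ind_type := to_ind [:: (a, v)].

End Induction.
Arguments pure {R S} phi {V} a v.

(* The homogeneous parts of an induced module are spanned by the a (x) v with *)
(* a and v homogeneous.  That their sum is direct is a property of the rings  *)
(* at hand, not part of the construction.                                     *)
Inductive ind_hom (R S : hring) (phi : {rmorphism R -> S}) (M : hmod R) :
    int -> bool -> ind_type phi M -> Prop :=
| ih_zero d p : ind_hom d p 0
| ih_sub d p u v : ind_hom d p u -> ind_hom d p v -> ind_hom d p (u - v)
| ih_pure d p e q a v : rhom d p a -> mhom e q v ->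
    ind_hom (d + e) (p (+) q) (pure phi a v).

Definition Ind (R S : hring) (phi : {rmorphism R -> S}) (M : hmod R) :
  hmod S := @HMod S (ind_type phi M) (@ind_hom R S phi M).

Record gsubmod (R : pzRingType) (M : hmod R) := GSubmod {
  sm_mem :> M -> Prop;
  sm_0 : sm_mem 0;
  sm_lin : forall a u v, sm_mem u -> sm_mem v -> sm_mem (a *: u + v);
  sm_homog : forall v, sm_mem v -> exists s : seq M,
    v = \sum_(u <- s) u /\
    forall u, u \in s -> sm_mem u /\ exists d p, mhom d p u
}.

Section Subquotient.
Variables (R : pzRingType) (M : hmod R) (N' N : gsubmod M).

Lemma sm_D (K : gsubmod M) u v : K u -> K v -> K (u + v).
Proof. by move=> Ku Kv; rewrite -[u]scale1r; exact: sm_lin. Qed.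
Lemma sm_Z (K : gsubmod M) a u : K u -> K (a *: u).
Proof. by move=> Ku; rewrite -[_ *: _]addr0; apply: (sm_lin a Ku); exact: sm_0. Qed.
Lemma sm_N (K : gsubmod M) u : K u -> K (- u).
Proof. by move=> Ku; rewrite -scaleN1r; exact: sm_Z. Qed.

Definition sub_carrier : Type := {v : M | `[< N' v >]}.
HB.instance Definition _ := SubChoice.on sub_carrier.

Lemma sub_valP (u : sub_carrier) : N' (val u).
Proof. exact/asboolP/(valP u). Qed.
Definition in_sub v (Hv : N' v) : sub_carrier := Sub v (asboolT Hv).

Definition sub_eqb : rel sub_carrier := fun u v => `[< N (val u - val v) >].
Fact sub_eqb_refl : reflexive sub_eqb.
Proof. by move=> u; apply/asboolP; rewrite subrr; exact: sm_0. Qed.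
Fact sub_eqb_sym : symmetric sub_eqb.
Proof.
by move=> u v; apply/asboolP/asboolP => Nuv; rewrite -opprB; exact: sm_N.
Qed.
Fact sub_eqb_trans : transitive sub_eqb.
Proof.
move=> v u w /asboolP Nuv /asboolP Nvw; apply/asboolP.
by rewrite -(subrKA (val v)); exact: sm_D.
Qed.
Canonical sub_equiv := EquivRel sub_eqb sub_eqb_refl sub_eqb_sym sub_eqb_trans.

(* The module N' / (N' \cap N); it is only used when N is contained in N'.    *)
Definition subquot_type : Type := {eq_quot sub_equiv}%qT.
HB.instance Definition _ := Choice.on subquot_type.
HB.instance Definition _ := EqQuotient.on subquot_type.

Definition to_sq (u : sub_carrier) : subquot_type := (\pi_subquot_type u)%qT.
Definition sq_repr (u : subquot_type) : sub_carrier := generic_quotient.repr u.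

Lemma to_sqP u v : to_sq u = to_sq v <-> N (val u - val v).
Proof. by split=> [/eqmodP/asboolP //|uv]; apply/eqmodP/asboolP. Qed.
Lemma sq_reprK u : to_sq (sq_repr u) = u. Proof. exact: reprK. Qed.
Lemma sq_repr_eq u : N (val (sq_repr (to_sq u)) - val u).
Proof. by apply/to_sqP; rewrite sq_reprK. Qed.
Lemma subquotP (P : subquot_type -> Prop) :
  (forall u, P (to_sq u)) -> forall u, P u.
Proof. by move=> HP u; rewrite -(sq_reprK u). Qed.

Definition sub_zero : sub_carrier := in_sub (sm_0 N').
Definition sub_add (u v : sub_carrier) : sub_carrier :=
  in_sub (sm_D (sub_valP u) (sub_valP v)).
Definition sub_opp (u : sub_carrier) : sub_carrier :=
  in_sub (sm_N (sub_valP u)).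
Definition sub_scale (a : R) (u : sub_carrier) : sub_carrier :=
  in_sub (sm_Z a (sub_valP u)).

Definition sq_add (u v : subquot_type) := to_sq (sub_add (sq_repr u) (sq_repr v)).
Definition sq_opp (u : subquot_type) := to_sq (sub_opp (sq_repr u)).
Definition sq_scale a (u : subquot_type) := to_sq (sub_scale a (sq_repr u)).

Lemma to_sqD u v : to_sq (sub_add u v) = sq_add (to_sq u) (to_sq v).
Proof.
apply/esym/to_sqP => /=; rewrite opprD addrACA.
by apply: sm_D; exact: sq_repr_eq.
Qed.
Lemma to_sqN u : to_sq (sub_opp u) = sq_opp (to_sq u).
Proof.
by apply/esym/to_sqP => /=; rewrite -opprD; apply: sm_N; exact: sq_repr_eq.
Qed.
Lemma to_sqZ a u : to_sq (sub_scale a u) = sq_scale a (to_sq u).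
Proof.
by apply/esym/to_sqP => /=; rewrite -scalerBr; apply: sm_Z; exact: sq_repr_eq.
Qed.

Fact sq_addA : associative sq_add.
Proof.
elim/subquotP=> u; elim/subquotP=> v; elim/subquotP=> w; rewrite -!to_sqD.
by congr to_sq; apply: val_inj; rewrite /= addrA.
Qed.
Fact sq_addC : commutative sq_add.
Proof.
elim/subquotP=> u; elim/subquotP=> v; rewrite -!to_sqD.
by congr to_sq; apply: val_inj; rewrite /= addrC.
Qed.
Fact sq_add0 : left_id (to_sq sub_zero) sq_add.
Proof.
elim/subquotP=> u; rewrite -!to_sqD.
by congr to_sq; apply: val_inj; rewrite /= add0r.
Qed.
Fact sq_addN : left_inverse (to_sq sub_zero) sq_opp sq_add.
Proof.
elim/subquotP=> u; rewrite -to_sqN -!to_sqD.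
by congr to_sq; apply: val_inj; rewrite /= addNr.
Qed.
HB.instance Definition _ :=
  GRing.isZmodule.Build subquot_type sq_addA sq_addC sq_add0 sq_addN.

Lemma sq_addE (u v : subquot_type) : u + v = sq_add u v. Proof. by []. Qed.

Fact sq_scaleA a b u : sq_scale a (sq_scale b u) = sq_scale (a * b) u.
Proof.
elim/subquotP: u => u; rewrite -!to_sqZ.
by congr to_sq; apply: val_inj; rewrite /= scalerA.
Qed.
Fact sq_scale1 : left_id 1 sq_scale.
Proof.
elim/subquotP=> u; rewrite -!to_sqZ.
by congr to_sq; apply: val_inj; rewrite /= scale1r.
Qed.
Fact sq_scaleDr : right_distributive sq_scale +%R.
Proof.
move=> a; elim/subquotP=> u; elim/subquotP=> v.
rewrite !sq_addE -to_sqD -!to_sqZ -to_sqD.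
by congr to_sq; apply: val_inj; rewrite /= scalerDr.
Qed.
Fact sq_scaleDl u : {morph sq_scale^~ u : a b / a + b}.
Proof.
move=> a b; elim/subquotP: u => u; rewrite sq_addE -!to_sqZ -to_sqD.
by congr to_sq; apply: val_inj; rewrite /= scalerDl.
Qed.
HB.instance Definition _ := GRing.Zmodule_isLmodule.Build R subquot_type
  sq_scaleA sq_scale1 sq_scaleDr sq_scaleDl.

Definition sq_hom (d : int) (p : bool) (w : subquot_type) : Prop :=
  exists2 u : sub_carrier, mhom d p (val u) & w = to_sq u.

Definition Subquot : hmod R := @HMod R subquot_type sq_hom.

End Subquotient.

Definition has_filtration (R : pzRingType) (M : hmod R) (m : nat)
    (P : nat -> hmod R -> Prop) : Prop :=
  exists N : nat -> gsubmod M,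
    [/\ forall v, N 0%N v <-> v = 0,
        forall v, N m v,
        forall i v, (i < m)%N -> N i v -> N i.+1 v
      & forall i, (i < m)%N -> P i (Subquot (N i.+1) (N i))].

(* Quotienting expressions over k and G by [alg_eq rel] gives the unital      *)
(* associative k-algebra with generators G and relations [rel].               *)

Inductive expr (k G : Type) : Type :=
| Cst of k
| Gen of G
| Add of expr k G & expr k G
| Mul of expr k G & expr k G.
Arguments Cst {k G} c.
Arguments Gen {k G} g.

Inductive alg_eq (k : comPzRingType) (G : Type)
    (rel : expr k G -> expr k G -> Prop) : expr k G -> expr k G -> Prop :=
| ae_rel x y : rel x y -> alg_eq rel x y
| ae_refl x : alg_eq rel x x
| ae_sym x y : alg_eq rel x y -> alg_eq rel y x
| ae_trans y x z : alg_eq rel x y -> alg_eq rel y z -> alg_eq rel x z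
| ae_add x x' y y' : alg_eq rel x x' -> alg_eq rel y y' ->
    alg_eq rel (Add x y) (Add x' y')
| ae_mul x x' y y' : alg_eq rel x x' -> alg_eq rel y y' ->
    alg_eq rel (Mul x y) (Mul x' y')
| ae_addA x y z : alg_eq rel (Add x (Add y z)) (Add (Add x y) z)
| ae_addC x y : alg_eq rel (Add x y) (Add y x)
| ae_add0 x : alg_eq rel (Add (Cst 0) x) x
| ae_addN x : alg_eq rel (Add (Mul (Cst (-1)) x) x) (Cst 0)
| ae_mulA x y z : alg_eq rel (Mul x (Mul y z)) (Mul (Mul x y) z)
| ae_mul1l x : alg_eq rel (Mul (Cst 1) x) x
| ae_mul1r x : alg_eq rel (Mul x (Cst 1)) x
| ae_mulDl x y z : alg_eq rel (Mul (Add x y) z) (Add (Mul x z) (Mul y z))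
| ae_mulDr x y z : alg_eq rel (Mul x (Add y z)) (Add (Mul x y) (Mul x z))
| ae_cstD c d : alg_eq rel (Cst (c + d)) (Add (Cst c) (Cst d))
| ae_cstM c d : alg_eq rel (Cst (c * d)) (Mul (Cst c) (Cst d))
| ae_cstC c x : alg_eq rel (Mul (Cst c) x) (Mul x (Cst c)).

HB.instance Definition _ (k G : Type) := gen_eqMixin (expr k G).
HB.instance Definition _ (k G : Type) := gen_choiceMixin (expr k G).

Section Presented.
Variables (k : comPzRingType) (G : Type) (rel : expr k G -> expr k G -> Prop).

Definition alg_eqb (x y : expr k G) : bool := `[< alg_eq rel x y >].
Fact alg_eqb_refl : reflexive alg_eqb.
Proof. by move=> x; apply/asboolP; exact: ae_refl. Qed.
Fact alg_eqb_sym : symmetric alg_eqb.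
Proof. by move=> x y; apply/asboolP/asboolP; exact: ae_sym. Qed.
Fact alg_eqb_trans : transitive alg_eqb.
Proof.
by move=> y x z /asboolP xy /asboolP yz; apply/asboolP; exact: ae_trans xy yz.
Qed.
Canonical alg_equiv := EquivRel alg_eqb alg_eqb_refl alg_eqb_sym alg_eqb_trans.

Definition palg : Type := {eq_quot alg_equiv}%qT.
HB.instance Definition _ := Choice.on palg.
HB.instance Definition _ := EqQuotient.on palg.

Definition to_palg (x : expr k G) : palg := (\pi_palg x)%qT.
Definition palg_repr (a : palg) : expr k G := generic_quotient.repr a.

Lemma to_palgP x y : to_palg x = to_palg y <-> alg_eq rel x y.
Proof. by split=> [/eqmodP/asboolP //|xy]; apply/eqmodP/asboolP. Qed.
Lemma palg_reprK a : to_palg (palg_repr a) = a. Proof. exact: reprK. Qed.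
Lemma palg_repr_eq x : alg_eq rel (palg_repr (to_palg x)) x.
Proof. by apply/to_palgP; rewrite palg_reprK. Qed.
Lemma palgP (P : palg -> Prop) : (forall x, P (to_palg x)) -> forall a, P a.
Proof. by move=> HP a; rewrite -(palg_reprK a). Qed.

Definition palg_add (a b : palg) := to_palg (Add (palg_repr a) (palg_repr b)).
Definition palg_mul (a b : palg) := to_palg (Mul (palg_repr a) (palg_repr b)).
Definition palg_opp (a : palg) := to_palg (Mul (Cst (-1)) (palg_repr a)).

Lemma to_palgD' x y : to_palg (Add x y) = palg_add (to_palg x) (to_palg y).
Proof. by apply/to_palgP/ae_sym/ae_add; exact: palg_repr_eq. Qed.
Lemma to_palgM' x y : to_palg (Mul x y) = palg_mul (to_palg x) (to_palg y).
Proof. by apply/to_palgP/ae_sym/ae_mul; exact: palg_repr_eq. Qed.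
Lemma palg_oppE a : palg_opp a = palg_mul (to_palg (Cst (-1))) a.
Proof. by rewrite -[in RHS](palg_reprK a) -to_palgM'. Qed.

Fact palg_addA : associative palg_add.
Proof.
elim/palgP=> x; elim/palgP=> y; elim/palgP=> z; rewrite -!to_palgD'.
by apply/to_palgP; exact: ae_addA.
Qed.
Fact palg_addC : commutative palg_add.
Proof.
elim/palgP=> x; elim/palgP=> y; rewrite -!to_palgD'.
by apply/to_palgP; exact: ae_addC.
Qed.
Fact palg_add0 : left_id (to_palg (Cst 0)) palg_add.
Proof.
by elim/palgP=> x; rewrite -!to_palgD'; apply/to_palgP; exact: ae_add0.
Qed.
Fact palg_addN : left_inverse (to_palg (Cst 0)) palg_opp palg_add.
Proof.
elim/palgP=> x; rewrite palg_oppE -to_palgM' -!to_palgD'.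
by apply/to_palgP; exact: ae_addN.
Qed.
HB.instance Definition _ :=
  GRing.isZmodule.Build palg palg_addA palg_addC palg_add0 palg_addN.

Lemma to_palgD x y : to_palg (Add x y) = to_palg x + to_palg y.
Proof. exact: to_palgD'. Qed.

Fact palg_mulA : associative palg_mul.
Proof.
elim/palgP=> x; elim/palgP=> y; elim/palgP=> z; rewrite -!to_palgM'.
by apply/to_palgP; exact: ae_mulA.
Qed.
Fact palg_mul1l : left_id (to_palg (Cst 1)) palg_mul.
Proof.
by elim/palgP=> x; rewrite -!to_palgM'; apply/to_palgP; exact: ae_mul1l.
Qed.
Fact palg_mul1r : right_id (to_palg (Cst 1)) palg_mul.
Proof.
by elim/palgP=> x; rewrite -!to_palgM'; apply/to_palgP; exact: ae_mul1r.
Qed.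
Fact palg_mulDl : left_distributive palg_mul +%R.
Proof.
elim/palgP=> x; elim/palgP=> y; elim/palgP=> z.
rewrite -to_palgD -!to_palgM' -to_palgD.
by apply/to_palgP; exact: ae_mulDl.
Qed.
Fact palg_mulDr : right_distributive palg_mul +%R.
Proof.
elim/palgP=> x; elim/palgP=> y; elim/palgP=> z.
rewrite -to_palgD -!to_palgM' -to_palgD.
by apply/to_palgP; exact: ae_mulDr.
Qed.
HB.instance Definition _ := GRing.Zmodule_isPzRing.Build palg
  palg_mulA palg_mul1l palg_mul1r palg_mulDl palg_mulDr.

Lemma to_palgM x y : to_palg (Mul x y) = to_palg x * to_palg y.
Proof. exact: to_palgM'. Qed.

Definition palg_cst (c : k) : palg := to_palg (Cst c).

Fact palg_cst_is_zmod_morphism : zmod_morphism palg_cst.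
Proof.
move=> c d; apply: (addIr (palg_cst d)); rewrite subrK /palg_cst -to_palgD.
by apply/to_palgP/ae_sym; rewrite -{1}(subrK d c); exact: ae_cstD.
Qed.
Fact palg_cst_is_monoid_morphism : monoid_morphism palg_cst.
Proof.
split=> // c d; rewrite /palg_cst -to_palgM.
by apply/to_palgP; exact: ae_cstM.
Qed.
HB.instance Definition _ :=
  GRing.isZmodMorphism.Build k palg palg_cst palg_cst_is_zmod_morphism.
HB.instance Definition _ :=
  GRing.isMonoidMorphism.Build k palg palg_cst palg_cst_is_monoid_morphism.

Lemma palg_cstC c a : palg_cst c * a = a * palg_cst c.
Proof.
elim/palgP: a => x; rewrite /palg_cst -!to_palgM.
by apply/to_palgP; exact: ae_cstC.
Qed.

(* Universal property: assigning images to the generators compatibly with the *)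
(* relations is well defined on the quotient.                                 *)
Section Eval.
Variables (S : pzRingType) (eta : {rmorphism k -> S}) (g : G -> S).
Hypothesis eta_central : forall c s, eta c * s = s * eta c.

Fixpoint eval (x : expr k G) : S :=
  match x with
  | Cst c => eta c
  | Gen a => g a
  | Add x y => eval x + eval y
  | Mul x y => eval x * eval y
  end.

Lemma alg_eq_eval : (forall x y, rel x y -> eval x = eval y) ->
  forall x y, alg_eq rel x y -> eval x = eval y.
Proof.
move=> Hrel x y; elim=> {x y} //=.
- by move=> y x z _ -> _ ->.
- by move=> x x' y y' _ -> _ ->.
- by move=> x x' y y' _ -> _ ->.
- by move=> x y z; rewrite addrA.
- by move=> x y; rewrite addrC.
- by move=> x; rewrite rmorph0 add0r.
- by move=> x; rewrite rmorphN1 mulN1r addNr rmorph0.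
- by move=> x y z; rewrite mulrA.
- by move=> x; rewrite rmorph1 mul1r.
- by move=> x; rewrite rmorph1 mulr1.
- by move=> x y z; rewrite mulrDl.
- by move=> x y z; rewrite mulrDr.
- by move=> c d; rewrite rmorphD.
- by move=> c d; rewrite rmorphM.
Qed.
End Eval.

Definition palg_gen (g : G) : palg := to_palg (Gen g).

Inductive palg_span (X : palg -> Prop) : palg -> Prop :=
| ps_gen a : X a -> palg_span X a
| ps_cst c : palg_span X (palg_cst c)
| ps_sub a b : palg_span X a -> palg_span X b -> palg_span X (a - b)
| ps_mul a b : palg_span X a -> palg_span X b -> palg_span X (a * b).

End Presented.

Record frobData (k : comNzRingType) := FrobData {
  fcar :> algType k;
  fhom : int -> bool -> fcar -> Prop;   (* homogeneous parts *)
  ftr : {scalar fcar};                  (* trace *)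
  fnak : {linear fcar -> fcar};         (* Nakayama automorphism psi *)
  fdeg : nat;                           (* maximal degree delta *)
  fbas : finType;                       (* index set of the basis B *)
  fb : fbas -> fcar;                    (* the basis B *)
  fbv : fbas -> fcar                    (* the left dual basis b^vee *)
}.

Definition is_basis (k : comNzRingType) (V : lmodType k) (I : finType)
    (v : I -> V) : Prop :=
  forall u, exists! c : {ffun I -> k}, u = \sum_i c i *: v i.

Record is_frobenius (k : comNzRingType) (F : frobData k) : Prop := {
  fr_grading : is_grading (@fhom k F);
  fr_scale : forall d p c (f : F), fhom d p f -> fhom d p (c *: f);
  fr_one : fhom 0 false (1 : F);
  fr_mul : forall d p e q (f g : F),
    fhom d p f -> fhom e q g -> fhom (d + e) (p (+) q) (f * g);
  fr_nonneg : forall d p (f : F), fhom d p f -> f <> 0 -> (0 <= d)%R;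
  fr_top : exists p (f : F), fhom (fdeg F)%:Z p f /\ f <> 0;
  fr_max : forall d p (f : F),
    fhom d p f -> f <> 0 -> (d <= (fdeg F)%:Z)%R;
  fr_tr_even : forall d (f : F), fhom d true f -> ftr F f = 0;
  fr_tr_homog : exists e, forall d p (f : F),
    fhom d p f -> d <> e -> ftr F f = 0;
  (* f |-> (g |-> (-1)^(fg) tr (g f)) is an isomorphism F -> Hom_k(F, k) *)
  fr_frobenius : exists Phi : F -> {scalar F},
    [/\ forall c f f' g, Phi (c *: f + f') g = c * Phi f g + Phi f' g,
        forall d p e q (f g : F), fhom d p f -> fhom e q g ->
          Phi f g = (-1) ^+ (p && q) * ftr F (g * f)
      & forall l : {scalar F}, exists! f, forall g, Phi f g = l g];
  fr_nakayama : forall d p e q (f g : F), fhom d p f -> fhom e q g ->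
    ftr F (f * g) = (-1) ^+ (p && q) * ftr F (g * fnak F f);
  fr_basis : is_basis (@fb k F);
  fr_basis_homog : forall b, exists d p, fhom d p (fb (f := F) b);
  fr_dual : forall b c, ftr F (fbv (f := F) b * fb c) = (b == c)%:R
}.

Definition has_order (T : Type) (g : T -> T) (m : nat) : Prop :=
  [/\ (0 < m)%N, iter m g =1 id
    & forall l, (0 < l < m)%N -> ~ (iter l g =1 id)].

Definition has_eigenbasis (k : comNzRingType) (V : lmodType k)
    (g : V -> V) : Prop :=
  exists (I : finType) (v : I -> V) (lambda : I -> k),
    is_basis v /\ forall i, g (v i) = lambda i *: v i.

Definition has_char (k : comNzRingType) (c : nat) : Prop :=
  forall m : nat, (m%:R = 0 :> k) <-> (c %| m)%N.

(* MathComp's product in 'S_n is (s * t) i = t (s i), so the product st of    *)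
(* the usual convention (first t, then s) is written (t * s)%g below.         *)

Section Permutations.
Variable n : nat.
Implicit Types (s t pi u w : 'S_n) (mu nu : seq nat).

(* The Coxeter length of s, as its number of inversions. *)
Definition perm_length s : nat :=
  #|[set ij : 'I_n * 'I_n | (ij.1 < ij.2)%N && (s ij.2 < s ij.1)%N]|.

(* The strong Bruhat order is generated by u < (i j) u for the transpositions *)
(* (i j) that increase the length.                                            *)
Definition bruhat_step : rel 'S_n := fun u w =>
  [exists i, exists j, w == (tperm i j * u)%g]
  && (perm_length u < perm_length w)%N.
Definition bruhat : rel 'S_n := connect bruhat_step.

Definition composition mu : bool := all (leq 1) mu && (sumn mu == n).

(* Permutations preserving the consecutive blocks of sizes mu_1, mu_2, ...    *)
Definition young mu : {set 'S_n} :=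
  [set s : 'S_n | [forall i : 'I_n, reshape_index mu (s i) == reshape_index mu i]].

Definition min_dcoset mu nu : {set 'S_n} :=
  [set pi : 'S_n | [forall s in young mu, forall t in young nu,
               perm_length pi <= perm_length (t * pi * s)%g]%N].

(* S_mu \cap pi S_nu pi^-1 and pi^-1 S_mu pi \cap S_nu; recall that            *)
(* A :^ x = x^-1 * A * x for the reversed product.                            *)
Definition young_capl mu nu pi : {set 'S_n} :=
  young mu :&: (young nu :^ pi)%g.
Definition young_capr mu nu pi : {set 'S_n} :=
  (young mu :^ pi^-1)%g :&: young nu.

End Permutations.

Section Wreath.
Variables (k : comNzRingType) (F : frobData k) (n : nat).

(* Generators: x_i, pure tensors f_1 (x) ... (x) f_n, and permutations.       *)
Inductive aw_gen : Type :=
| GX of 'I_n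
| GT of {ffun 'I_n -> F}
| GP of 'S_n.

Local Notation awexpr := (expr k aw_gen).
Definition eX i : awexpr := Gen (GX i).
Definition eT f : awexpr := Gen (GT f).
Definition eP s : awexpr := Gen (GP s).

Definition set_slot (f : {ffun 'I_n -> F}) (i : 'I_n) (u : F) :
  {ffun 'I_n -> F} := [ffun j => if j == i then u else f j].

(* f_i = 1 (x) ... (x) f (x) ... (x) 1 *)
Definition slot (i : 'I_n) (f : F) : {ffun 'I_n -> F} :=
  set_slot [ffun=> 1] i f.

Definition phomog (d : 'I_n -> int) (p : 'I_n -> bool)
    (f : {ffun 'I_n -> F}) : Prop := forall i, fhom (d i) (p i) (f i).

(* Signs of the product of two pure tensors of parities p and q, and of the   *)
(* superpermutation by s of a pure tensor of parities p.                      *)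
Definition mul_sign (p q : 'I_n -> bool) : k :=
  \prod_(i < n) \prod_(j < n | (j < i)%N) (-1) ^+ (p i && q j).
Definition perm_sign (s : 'S_n) (p : 'I_n -> bool) : k :=
  \prod_(i < n) \prod_(j < n | (i < j)%N && (s j < s i)%N)
    (-1) ^+ (p i && p j).
Definition perm_tensor (s : 'S_n) (f : {ffun 'I_n -> F}) :
  {ffun 'I_n -> F} := [ffun i => f ((s^-1)%g i)].

(* t_{i,j} = \sum_b b_i (b^vee)_j *)
Definition et (i j : 'I_n) : awexpr :=
  foldr (@Add k aw_gen) (Cst 0)
    [seq Mul (eT (slot i (fb b))) (eT (slot j (fbv b))) | b <- enum (fbas F)].

Inductive aw_rel : awexpr -> awexpr -> Prop :=
(* k[x_1, ..., x_n] *)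
| r_xx i j : aw_rel (Mul (eX i) (eX j)) (Mul (eX j) (eX i))
(* the superalgebra F^{(x) n} *)
| r_tlin i f c u v :
    aw_rel (eT (set_slot f i (c *: u + v)))
           (Add (Mul (Cst c) (eT (set_slot f i u))) (eT (set_slot f i v)))
| r_t1 : aw_rel (eT [ffun=> 1]) (Cst 1)
| r_tt f g d p e q : phomog d p f -> phomog e q g ->
    aw_rel (Mul (eT f) (eT g))
           (Mul (Cst (mul_sign p q)) (eT [ffun i => f i * g i]))
(* the group algebra k S_n *)
| r_p1 : aw_rel (eP 1%g) (Cst 1)
| r_pp s t : aw_rel (Mul (eP s) (eP t)) (eP (t * s)%g)
(* the relations between the three factors *)
| r_tx f i :
    aw_rel (Mul (eT f) (eX i)) (Mul (eX i) (eT (set_slot f i (fnak F (f i)))))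
| r_sx (i i' j : 'I_n) : i' = i.+1 :> nat -> j != i -> j != i' ->
    aw_rel (Mul (eP (tperm i i')) (eX j)) (Mul (eX j) (eP (tperm i i')))
| r_sx_skein (i i' : 'I_n) : i' = i.+1 :> nat ->
    aw_rel (Mul (eP (tperm i i')) (eX i))
           (Add (Mul (eX i') (eP (tperm i i'))) (Mul (Cst (-1)) (et i i')))
| r_pt s f d p : phomog d p f ->
    aw_rel (Mul (eP s) (eT f))
           (Mul (Mul (Cst (perm_sign s p)) (eT (perm_tensor s f))) (eP s)).

Definition aw : Type := palg aw_rel.
HB.instance Definition _ := GRing.PzRing.on aw.

Definition aw_cst (c : k) : aw := palg_cst aw_rel c.
Definition aw_x (i : 'I_n) : aw := palg_gen aw_rel (GX i).
Definition aw_ten (f : {ffun 'I_n -> F}) : aw := palg_gen aw_rel (GT f).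
Definition aw_perm (s : 'S_n) : aw := palg_gen aw_rel (GP s).

(* The relations are homogeneous, so the degrees and parities of the          *)
(* generators determine the grading: its parts are the spans of the products  *)
(* of homogeneous generators.                                                 *)
Inductive aw_hom : int -> bool -> aw -> Prop :=
| ah_zero d p : aw_hom d p 0
| ah_sub d p a b : aw_hom d p a -> aw_hom d p b -> aw_hom d p (a - b)
| ah_mul d p e q a b : aw_hom d p a -> aw_hom e q b ->
    aw_hom (d + e) (p (+) q) (a * b)
| ah_cst c : aw_hom 0 false (aw_cst c)
| ah_x i : aw_hom (fdeg F)%:Z false (aw_x i)
| ah_ten d p i f : fhom d p f -> aw_hom d p (aw_ten (slot i f))
| ah_perm s : aw_hom 0 false (aw_perm s).

Definition AW : hring := @HRing aw aw_hom.

(* The subalgebra generated by F^{(x) n}, k[x_1, ..., x_n] and H; A_lambda(F) *)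
(* is the case H = S_lambda (it depends on lambda only through S_lambda).     *)
Inductive aw_sub_gen (H : {set 'S_n}) : aw -> Prop :=
| sg_ten f : aw_sub_gen H (aw_ten f)
| sg_x i : aw_sub_gen H (aw_x i)
| sg_perm s : s \in H -> aw_sub_gen H (aw_perm s).

Section Sub.
Variable H : {set 'S_n}.

Definition aw_sub_pred : {pred aw} :=
  fun a => `[< palg_span (aw_sub_gen H) a >].

Lemma aw_subP a : reflect (palg_span (aw_sub_gen H) a) (a \in aw_sub_pred).
Proof. exact: asboolP. Qed.

Fact aw_sub_subring : subring_closed aw_sub_pred.
Proof.
split.
- apply/aw_subP; have -> : 1 = palg_cst aw_rel 1 by rewrite rmorph1.
  exact: ps_cst.
- by move=> a b /aw_subP Ha /aw_subP Hb; apply/aw_subP/ps_sub.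
- by move=> a b /aw_subP Ha /aw_subP Hb; apply/aw_subP/ps_mul.
Qed.
HB.instance Definition _ :=
  GRing.isSubringClosed.Build aw aw_sub_pred aw_sub_subring.

Definition aw_sub : Type := {a : aw | a \in aw_sub_pred}.
HB.instance Definition _ := SubChoice.on aw_sub.
HB.instance Definition _ := GRing.SubChoice_isSubPzRing.Build aw aw_sub_pred aw_sub
  aw_sub_subring.

Definition AWsub : hring :=
  @HRing aw_sub (fun d p a => aw_hom d p (val a)).

End Sub.

Definition aw_val (H : {set 'S_n}) : {rmorphism AWsub H -> AW} :=
  [the {rmorphism AWsub H -> AW} of (val : aw_sub H -> aw)].

Lemma aw_sub_mono (H K : {set 'S_n}) : H \subset K ->
  {subset aw_sub_pred H <= aw_sub_pred K}.
Proof.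
move=> /subsetP sHK a /aw_subP Ha; apply/aw_subP.
elim: Ha => {a} [a []|c|a b _ + _|a b _ + _]; last 2 first.
- exact: ps_sub.
- exact: ps_mul.
- by move=> f; apply/ps_gen/sg_ten.
- by move=> i; apply/ps_gen/sg_x.
- by move=> s /sHK Ks; apply/ps_gen/sg_perm.
- exact: ps_cst.
Qed.

Section Incl.
Variables (H K : {set 'S_n}) (sHK : H \subset K).
Definition aw_incl_fun (a : aw_sub H) : aw_sub K :=
  Sub (val a) (aw_sub_mono sHK (valP a)).
Fact aw_incl_is_zmod_morphism : zmod_morphism aw_incl_fun.
Proof.
by move=> a b; apply: val_inj; rewrite [RHS]raddfB; exact: (raddfB (val : aw_sub H -> aw)).
Qed.
Fact aw_incl_is_monoid_morphism : monoid_morphism aw_incl_fun.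
Proof.
split=> [|a b]; apply: val_inj; first by [].
by rewrite [RHS](rmorphM (val : aw_sub K -> aw));
  exact: (rmorphM (val : aw_sub H -> aw)).
Qed.
HB.instance Definition _ := GRing.isZmodMorphism.Build _ _ aw_incl_fun
  aw_incl_is_zmod_morphism.
HB.instance Definition _ := GRing.isMonoidMorphism.Build _ _ aw_incl_fun
  aw_incl_is_monoid_morphism.
Definition aw_incl : {rmorphism AWsub H -> AWsub K} := aw_incl_fun.
End Incl.

End Wreath.
Arguments aw_val {k F n H}.
Arguments aw_cst {k} F n c.
Arguments aw_x {k} F {n} i.
Arguments aw_perm {k} F {n} s.

Section Mackey.
Variables (k : comNzRingType) (F : frobData k) (n : nat) (mu nu : seq nat).

(* The isomorphism phi_{pi^-1}; it is determined by its values on generators. *)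
Definition is_twist (pi : 'S_n)
    (phi : {rmorphism AWsub F (young_capl mu nu pi) ->
                      AWsub F (young_capr mu nu pi)}) : Prop :=
  forall a,
    [/\ forall c, aw_val a = aw_cst F n c -> aw_val (phi a) = aw_cst F n c,
        forall s, s \in young_capl mu nu pi -> aw_val a = aw_perm F s ->
          aw_val (phi a) = aw_perm F (pi * s * pi^-1)%g,
        forall i f, aw_val a = aw_ten (slot i f) ->
          aw_val (phi a) = aw_ten (slot ((pi^-1)%g i) f)
      & forall i, aw_val a = aw_x F i -> aw_val (phi a) = aw_x F ((pi^-1)%g i)].

Definition incl_capl (pi : 'S_n) :
    {rmorphism AWsub F (young_capl mu nu pi) -> AWsub F (young n mu)} :=
  aw_incl F (subsetIl (young n mu) (young n nu :^ pi)%g).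

Definition incl_capr (pi : 'S_n) :
    {rmorphism AWsub F (young_capr mu nu pi) -> AWsub F (young n nu)} :=
  aw_incl F (subsetIr (young n mu :^ pi^-1)%g (young n nu)).

Variable M : hmod (AWsub F (young n nu)).

Definition Res_Ind : hmod (AWsub F (young n mu)) :=
  Res (aw_val (H := young n mu)) (Ind (aw_val (H := young n nu)) M).

Definition mackey_piece (pi : 'S_n) phi : hmod (AWsub F (young n mu)) :=
  Ind (incl_capl pi) (Res phi (Res (incl_capr pi) M)).

(* The filtration of Res Ind M whose successive subquotients, from the        *)
(* bottom up, are indexed by the entries of [s].                              *)
Definition mackey_filtration (s : seq 'S_n) : Prop :=
  has_filtration Res_Ind (size s) (fun i X =>
    exists2 phi, @is_twist (nth 1%g s i) phi &
      evenly_iso X (mackey_piece phi)).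

Definition enumerates_dcosets (s : seq 'S_n) : Prop :=
  uniq s /\ s =i min_dcoset n mu nu.

Definition refines_bruhat (s : seq 'S_n) : Prop :=
  forall u w, u \in s -> w \in s -> bruhat u w -> (index u s <= index w s)%N.

End Mackey.

(* Main.v *)
Require Import Defs.
From HB Require Import structures.
From mathcomp Require Import all_boot all_order all_algebra all_fingroup.
From mathcomp Require Import boolp zify.

Set Implicit Arguments.
Unset Strict Implicit.
Unset Printing Implicit Defensive.

Import GRing.Theory.
Local Open Scope ring_scope.

(** Write A for A_n(F), P for the subalgebra generated by the tensors and by
  the x_i, and A_K for the subalgebra of a Young subgroup S_K. Products of
  permutations below are written in the usual order, the right factor acting
  first; the group law on permutations in the code is the opposite one.

  The theorem rests on a basis theorem relative to P: A is the direct sum of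
  the w P, for w in S_n ([aw_coef_expand] and the lemmas on [aw_coef]). It
  follows that A_K is the sum of the w P with w in S_K, that A is the direct
  sum of the w A_K over left cosets, and that every element of the module
  induced from an A_K-module M has unique coordinates: it is a sum of
  w (x) m_w over coset representatives ([ind_coord], [ind_coord_expand]).

  To prove the basis theorem, A is made to act on the functions from S_n to
  A, which stand for formal sums of the w g(w) with coefficients on the right.
  Tensors act through their conjugates and permutations by translation; x_i
  acts by the straightening formula for x_i w. Since the coefficients lie in A
  itself, the relations that do not involve the x_i hold at once, and the
  others reduce to exchange rules with the elements t_{i,j} ([conj_ten_t],
  [opP_X]). That the x_i commute ([opX_comm]) is clear at the longest
  permutation, where no correction term occurs, and simple transpositions
  carry commutators to commutators. All the identities for t_{i,j} follow
  from the Frobenius form.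

  Straightening x_i w produces x_{w^{-1}(i)} behind w and permutations (i j) w
  shorter than w. Hence w (x) M, for w in a union of (S_mu, S_nu)-double
  cosets that is closed downwards in the Bruhat order, span a submodule over
  A_mu ([dcosets_submod]). Adding the double cosets one at a time, in an order
  refining the Bruhat order, gives the filtration. Here one needs that the
  projection of a permutation to the minimal element of its double coset is
  monotone; with the uniqueness of this element, it follows from the lifting
  property ([bruhat_dcoset]).

  In the layer of pi, moving an element a of A_{mu cap pi nu} past pi gives
  a pi = pi phi(a) up to lower double cosets. This determines phi(a), so it
  defines the twisting isomorphism ([twist]), and it shows that
  a (x) m |-> a pi (x) m is well defined on the induced module in the
  statement ([piece_map]). This map is bijective because representatives of
  S_mu modulo S_{mu cap pi nu}, multiplied by pi, represent distinct cosets of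
  S_nu and exhaust those in the double coset; comparing coordinates also shows
  that it respects and reflects homogeneity ([piece_iso]). For the trivial
  permutation there is nothing below, and a (x) m |-> a (x) m embeds the
  corresponding piece ([embeds_identity_piece]). *)

(** * Lengths, parabolic subgroups and the Bruhat order *)

Section Length.
Variable n : nat.
Implicit Types (u v w s t : 'S_n) (i j p q : 'I_n).

Definition inversions u : {set 'I_n * 'I_n} :=
  [set ij : 'I_n * 'I_n | (ij.1 < ij.2)%N && (u ij.2 < u ij.1)%N].

(** Applied with a transposition t of two positions, this sends the
  inversions of u injectively to inversions of the longer permutation: a
  pair is transported by t, unless t would reverse it. *)
Definition carry_pair (t : 'S_n) (ij : 'I_n * 'I_n) :=
  if (t ij.1 < t ij.2)%N then (t ij.1, t ij.2) else ij.

Lemma ord_neq i j : i != j -> i != j :> nat.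
Proof. by []. Qed.

(** Exchanging two values that are in increasing order creates the inversion
  (i, j), which [carry_pair] never hits, so the number of inversions
  strictly grows. *)
Lemma length_tperm_lt u i j : (i < j)%N -> (u i < u j)%N ->
  (perm_length u < perm_length (tperm i j * u)%g)%N.
Proof.
move=> ij uij; rewrite /perm_length -!/(inversions _).
set t := tperm i j; set w := (t * u)%g.
have ijw : (i, j) \in inversions w.
  by rewrite inE /= ij !permM tpermL tpermR.
rewrite (cardsD1 (i, j) (inversions w)) ijw add1n ltnS.
have inj : {in inversions u &, injective (carry_pair t)}.
  move=> [p q] [p' q']; rewrite !inE /carry_pair /=.
  move=> /andP [pq _] /andP [pq' _].
  case: ifP => H1; case: ifP => H2 [e1 e2].
  - by rewrite (perm_inj e1) (perm_inj e2).
  - by move: H2; rewrite -e1 -e2 !tpermK pq.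
  - by move: H1; rewrite e1 e2 !tpermK pq'.
  - by rewrite e1 e2.
rewrite -(card_in_imset inj); apply/subset_leq_card/subsetP => y /imsetP [[p q]].
rewrite !inE /carry_pair /= => /andP [pq uqp] ->.
case: ifP => /= H.
  rewrite xpair_eqE /w !permM !tpermK uqp H /= ?andbT.
  apply/negP => /andP [/eqP e1 /eqP e2].
  have ep : p = j by rewrite -[p](tpermK i j) e1 tpermL.
  have eq : q = i by rewrite -[q](tpermK i j) e2 tpermR.
  by move: pq; rewrite ep eq; lia.
rewrite pq ?andbT /=; rewrite /w !permM; move: H; rewrite /t.
case: (tpermP i j p) => [ep|ep|/eqP p1 /eqP p2];
  case: (tpermP i j q) => [eq|eq|/eqP q1 /eqP q2]; rewrite ?ep ?eq in pq uqp *;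
  rewrite xpair_eqE ?eqxx /=; try lia.
Qed.

Lemma length_tperm u i j : (i < j)%N ->
  (perm_length u < perm_length (tperm i j * u)%g)%N = (u i < u j)%N.
Proof.
move=> ij; apply/idP/idP; last exact: length_tperm_lt.
case: (ltngtP (u i) (u j)) => // [H|/val_inj /perm_inj eij]; last first.
  by move: ij; rewrite eij ltnn.
have := @length_tperm_lt (tperm i j * u)%g i j ij.
by rewrite !permM tpermL tpermR mulgA tperm2 mul1g => /(_ H); lia.
Qed.

Lemma tpermMr u i j : (u * tperm i j = tperm (u^-1 i) (u^-1 j) * u)%g.
Proof. by rewrite -tpermJ conjgE invgK mulgA mulgKV. Qed.

Lemma length_mul_tperm u i j : (i < j)%N ->
  (perm_length u < perm_length (u * tperm i j)%g)%N = (u^-1%g i < u^-1%g j)%N.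
Proof.
move=> ij; rewrite tpermMr.
case: (ltngtP (u^-1%g i) (u^-1%g j)) => [H|H|/val_inj /perm_inj eij].
- by rewrite length_tperm // !permKV.
- by rewrite tpermC length_tperm // !permKV; lia.
- by move: ij; rewrite eij ltnn.
Qed.

Lemma length_tperm_neq u i j : i != j ->
  perm_length u != perm_length (tperm i j * u)%g.
Proof.
wlog ij : i j / (i < j)%N.
  move=> H nij; have := ord_neq nij; case: (ltngtP i j) => // ij _; first exact: H.
  by rewrite tpermC; apply: H; rewrite // eq_sym.
move=> _; case: (ltngtP (u i) (u j)) => [H|H|/val_inj /perm_inj eij].
- by have := length_tperm u ij; rewrite H; lia.
- have := @length_tperm_lt (tperm i j * u)%g i j ij.
  by rewrite !permM tpermL tpermR mulgA tperm2 mul1g => /(_ H); lia.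
- by move: ij; rewrite eij ltnn.
Qed.

Definition simple s := [exists i : 'I_n, exists j : 'I_n,
  (j == i.+1 :> nat) && (s == tperm i j)].

Lemma simpleP s : reflect (exists i j : 'I_n, j = i.+1 :> nat /\ s = tperm i j)
  (simple s).
Proof.
apply: (iffP existsP) => [[i /existsP [j /andP [/eqP e /eqP ->]]]|].
  by exists i, j.
by move=> [i [j [e ->]]]; exists i; apply/existsP; exists j; rewrite e !eqxx.
Qed.

Lemma simple_invol s : simple s -> (s * s = 1)%g.
Proof. by case/simpleP => i [j [_ ->]]; rewrite tperm2. Qed.

(** An increasing permutation satisfies i <= u i for every i; the sums of
  both sides agree, so equality holds throughout. *)
Lemma no_descent_id u :
  (forall i j, j = i.+1 :> nat -> (u i < u j)%N) -> u = 1%g.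
Proof.
move=> H.
have le : forall i : 'I_n, (i <= u i)%N.
  move=> i; have [m] := ubnP (i : nat); elim: m i => // m IH i im.
  case: (posnP i) => [->//|i0].
  have hi' : (i.-1 < n)%N by have := ltn_ord i; lia.
  have := IH (Ordinal hi') ltac:(rewrite /=; lia).
  by have /= := H (Ordinal hi') i ltac:(rewrite /=; lia); lia.
have e : (\sum_(i < n) i = \sum_(i < n) u i)%N.
  by rewrite (reindex_inj (@perm_inj _ u)).
have := @leqif_sum _ predT (fun i => val i == val (u i)) (fun i : 'I_n => val i)
  (fun i => val (u i)) (fun i _ => leqif_eq (le i)).
case=> _; rewrite e eqxx => /esym /forallP h; apply/permP => i.
by rewrite perm1; apply/val_inj/esym/eqP/(implyP (h i)).
Qed.

End Length.

Section Parabolic.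
Variable n : nat.
Implicit Types (u v w s t h k : 'S_n) (H K : {group 'S_n}).

(** For a subgroup this property characterizes the standard parabolic
  subgroups. It is taken as the definition because straightening x_i w
  produces exactly the permutations obtained from w by removing an
  inversion. *)
Definition inversion_closed (K : {set 'S_n}) := forall h (i j : 'I_n),
  h \in K -> (i < j)%N -> (h j < h i)%N -> tperm i j \in K.

(** Parabolic subgroups are generated by their simple transpositions: an
  element other than 1 has a descent, the corresponding simple transposition
  lies in the subgroup, and multiplying by it shortens the element. *)
Lemma parabolic_ind K (P : 'S_n -> Prop) : inversion_closed K -> P 1%g ->
  (forall s h, simple s -> s \in K -> h \in K -> P h -> P (s * h)%g) ->
  forall h, h \in K -> P h.
Proof.
move=> Kinv P1 PM h; have [m] := ubnP (perm_length h).
elim: m h => // m IH h hm hK.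
case: (pselect (forall i j : 'I_n, j = i.+1 :> nat -> (h i < h j)%N)) => [|nd].
  by move=> /no_descent_id ->.
have [i [j [e hji]]] : exists i j : 'I_n, j = i.+1 :> nat /\ (h j < h i)%N.
  apply: contrapT => H; apply: nd => i j e; rewrite ltnNge; apply/negP => hji.
  apply: H; exists i, j; split => //; rewrite ltn_neqAle hji andbT.
  by apply/negP => /eqP /val_inj /perm_inj eji; move: e; rewrite eji; lia.
have ij : (i < j)%N by lia.
have sK := Kinv _ _ _ hK ij hji.
rewrite -[h]mul1g -(tperm2 i j) -mulgA; apply: PM => //.
- by apply/simpleP; exists i, j.
- by rewrite groupM.
apply: IH; last by rewrite groupM.
have := @length_tperm_lt _ (tperm i j * h)%g i j ij.
rewrite !permM tpermL tpermR mulgA tperm2 mul1g => /(_ hji) lt; exact: leq_trans lt _.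
Qed.

Lemma parabolic_ind_r K (P : 'S_n -> Prop) : inversion_closed K -> P 1%g ->
  (forall s h, simple s -> s \in K -> h \in K -> P h -> P (h * s)%g) ->
  forall h, h \in K -> P h.
Proof.
move=> Kinv P1 PM h hK; rewrite -[h]invgK; move: h^-1%g (groupVr hK).
apply: (parabolic_ind Kinv) => [|s h' ss sK h'K Ph]; first by rewrite invg1.
rewrite invMg; have -> : (s^-1 = s)%g.
  by apply/eqP; rewrite eq_invg_mul simple_invol.
by apply: PM; rewrite ?groupV.
Qed.

End Parabolic.

Section Bruhat.
Variable n : nat.
Implicit Types (u v w s t h k : 'S_n) (H K : {group 'S_n}).

(** By the inversion criterion for the length, a Bruhat step is the exchange
  of two values that are in increasing order. *)
Lemma bruhat_stepP u w : reflect
  (exists i j : 'I_n, [/\ (i < j)%N, (u i < u j)%N & w = (tperm i j * u)%g])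
  (bruhat_step u w).
Proof.
apply: (iffP andP) => [[/existsP [i /existsP [j /eqP ->]] lt]|]; last first.
  move=> [i [j [ij uij ->]]]; split; last exact: length_tperm_lt.
  by apply/existsP; exists i; apply/existsP; exists j.
case: (ltngtP i j) => [ij|ij|/val_inj eij].
- by exists i, j; split=> //; rewrite -length_tperm.
- by exists j, i; rewrite tpermC; split=> //; rewrite -length_tperm // tpermC.
- by move: lt; rewrite eij tperm1 mul1g ltnn.
Qed.

Lemma bruhat_trans : transitive (@bruhat n).
Proof. exact: connect_trans. Qed.

Lemma bruhat_refl u : bruhat u u. Proof. exact: connect0. Qed.

Lemma bruhat_length u w : bruhat u w ->
  u = w \/ (perm_length u < perm_length w)%N.
Proof.
case/connectP => p; elim: p u => [|v p IH] u /=; first by move=> _ ->; left.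
case/andP => /andP [_ uv] /IH H /H [<-|vw]; right; lia.
Qed.

Lemma bruhat_anti u w : bruhat u w -> bruhat w u -> u = w.
Proof. by move=> /bruhat_length [//|H1] /bruhat_length [//|H2]; lia. Qed.

(** An adjacent transposition preserves the order of every pair of points
  but the one that it exchanges. All the lifting statements rest on this. *)
Lemma tperm_adjacent (i j a b : 'I_n) : j = i.+1 :> nat -> (a < b)%N ->
  tperm i j = tperm a b \/ (tperm i j a < tperm i j b)%N.
Proof.
move=> e ab.
case: (tpermP i j a) => [ea|ea|/eqP a1 /eqP a2];
  case: (tpermP i j b) => [eb|eb|/eqP b1 /eqP b2]; subst; try (right; lia).
- by left.
- by right; have := ord_neq b2; lia.
- by right; have := ord_neq a1; lia.
Qed.

Lemma bruhat_step_simple s u w : simple s -> bruhat_step u w ->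
  w = (s * u)%g \/ bruhat_step (s * u)%g (s * w)%g.
Proof.
case/simpleP => i [j [e ->]] /bruhat_stepP [a [b [ab uab ->]]].
case: (tperm_adjacent e ab) => [->|lt]; first by left.
right; apply/bruhat_stepP; exists (tperm i j a), (tperm i j b).
rewrite !permM !tpermK; split => //.
by rewrite -tpermJ conjgE tpermV -!mulgA (mulgA (tperm i j) (tperm i j)) tperm2 mul1g.
Qed.

Lemma bruhat_step_simple_r s u w : simple s -> bruhat_step u w ->
  w = (u * s)%g \/ bruhat_step (u * s)%g (w * s)%g.
Proof.
case/simpleP => i [j [e ->]] /bruhat_stepP [a [b [ab uab ->]]].
case: (tperm_adjacent e uab) => [->|lt].
  by left; rewrite tpermMr !permK.
by right; apply/bruhat_stepP; exists a, b; rewrite !permM mulgA.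
Qed.

(** The lifting property, in a form that serves for multiplication by a
  simple transposition on either side: along a chain from u to w,
  multiplication by s either carries each step to a step or collapses it, so
  that u <= s w or s u <= s w; in the second case u < s u <= s w. *)
Lemma bruhat_lift (f : 'S_n -> 'S_n) u w :
  (forall x y, bruhat_step x y -> y = f x \/ bruhat_step (f x) (f y)) ->
  involutive f ->
  (perm_length u < perm_length (f u))%N -> bruhat_step u (f u) ->
  bruhat u w -> bruhat u (f w).
Proof.
move=> fstep fK lu uf uw.
suff [//|H] : bruhat u (f w) \/ bruhat (f u) (f w).
  by apply: bruhat_trans H; exact: connect1.
move: uw => /connectP [p]; elim/last_ind: p w => [|p y IH] w /=.
  by move=> _ ->; right; exact: bruhat_refl.
rewrite rcons_path last_rcons => /andP [pth st] ->.
have {IH} IH := IH _ pth erefl.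
case: (fstep _ _ st) => [->|st'].
  by left; rewrite fK; apply/connectP; exists p.
by case: IH => IH; [left|right]; apply: bruhat_trans IH _; exact: connect1.
Qed.

(** Being minimal for the multiplications by simple transpositions; a priori
  this is weaker than being minimal in the whole double coset. *)
Definition descent_free (H K : {set 'S_n}) u :=
  (forall s, s \in K -> simple s -> (perm_length u < perm_length (s * u)%g)%N) /\
  (forall s, s \in H -> simple s -> (perm_length u < perm_length (u * s)%g)%N).

(** By the lifting property, the Bruhat upper set of an element u without
  descents is stable under simple transpositions of both subgroups, hence is
  a union of double cosets. This one fact yields the minimality of u, its
  uniqueness in its double coset, and the monotonicity of the projection to
  representatives. *)
Lemma bruhat_dcoset H K u w k h : inversion_closed H -> inversion_closed K ->
  descent_free H K u -> k \in K -> h \in H ->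
  bruhat u w -> bruhat u (k * w * h)%g.
Proof.
move=> Hinv Kinv [uK uH] kK hH uw.
suff /(_ k kK w uw) : forall k, k \in K -> forall w, bruhat u w -> bruhat u (k * w)%g.
  move: (k * w)%g; move: h hH; apply: (parabolic_ind Hinv) => [|s h ss sH hH IH] x ux.
    by rewrite mulg1.
  rewrite mulgA; apply: IH.
  apply: (@bruhat_lift (fun x => x * s)%g) => //.
  - by move=> ? ?; apply: bruhat_step_simple_r.
  - by move=> y /=; rewrite -mulgA simple_invol // mulg1.
  - exact: uH.
  - rewrite /bruhat_step uH // andbT; case/simpleP: ss => i [j [_ ->]].
    rewrite tpermMr; apply/existsP; exists (u^-1 i)%g; apply/existsP.
    by exists (u^-1 j)%g.
apply: (parabolic_ind Kinv) => [|s h' ss sK h'K IH] x ux; first by rewrite mul1g.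
rewrite -mulgA; apply: (@bruhat_lift (fun x => s * x)%g) => //; last exact: IH.
- by move=> ? ?; apply: bruhat_step_simple.
- by move=> y /=; rewrite mulgA simple_invol // mul1g.
- exact: uK.
- rewrite /bruhat_step uK // andbT; case/simpleP: ss => i [j [_ ->]].
  by apply/existsP; exists i; apply/existsP; exists j.
Qed.

End Bruhat.

(** * Minimal double coset representatives *)

Section DoubleCosets.
Variables (n : nat) (mu nu : seq nat).
Implicit Types (u v w s t h k : 'S_n).

Lemma reshape_index_leq (sh : seq nat) (i j : nat) : (i <= j)%N ->
  (reshape_index sh i <= reshape_index sh j)%N.
Proof.
rewrite /reshape_index.
have H : forall a b, (a <= b)%N ->
  (find (pred1 0%N) (scanl subn a sh) <= find (pred1 0%N) (scanl subn b sh))%N.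
  elim: sh => [|m sh IH] a b ab //=.
  case: ifP => // a0; case: ifP => [/eqP b0|b0] /=; last by rewrite ltnS IH // leq_sub2r.
  by move: a0 => /eqP; lia.
by move=> ij; apply: H.
Qed.

Fact young_group_set sh : group_set (young n sh).
Proof.
apply/group_setP; split=> [|s t]; first by rewrite inE; apply/forallP => i; rewrite perm1.
rewrite !inE => /forallP Hs /forallP Ht; apply/forallP => i.
by rewrite permM (eqP (Ht _)).
Qed.
Canonical young_group sh := Group (young_group_set sh).

(** If a permutation preserves the blocks and inverts i < j, then i and j
  are in the same block since the index of the block is nondecreasing. *)
Lemma young_inversion_closed sh : inversion_closed (young n sh).
Proof.
move=> h i j; rewrite !inE => /forallP Hh ij hij.
have e : reshape_index sh i = reshape_index sh j.
  apply/eqP; rewrite eqn_leq reshape_index_leq ?(ltnW ij) //=.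
  by rewrite -(eqP (Hh j)) -(eqP (Hh i)) reshape_index_leq // ltnW.
by apply/forallP => l; case: tpermP => [->|->|//]; rewrite e.
Qed.

Notation H := (young n mu).
Notation K := (young n nu).

Lemma min_dcosetP u : u \in min_dcoset n mu nu <->
  (forall k h, k \in K -> h \in H -> perm_length u <= perm_length (k * u * h)%g)%N.
Proof.
rewrite inE; split => [/forall_inP D k h kK hH|D].
  exact: (forall_inP (D h hH)).
by apply/forall_inP => h hH; apply/forall_inP => k kK; apply: D.
Qed.

Lemma min_dcoset_descent_free u : u \in min_dcoset n mu nu -> descent_free H K u.
Proof.
move/min_dcosetP => D; split => s sG /simpleP [i [j [e es]]].
  have := D s 1%g sG (group1 _); rewrite mulg1.
  have nij : i != j by apply/negP => /eqP eij; move: e; rewrite eij; lia.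
  by rewrite ltn_neqAle => ->; rewrite es length_tperm_neq.
have := D 1%g s (group1 _) sG; rewrite mul1g es tpermMr.
have nij : (u^-1 i != u^-1 j)%g.
  by apply/negP => /eqP /perm_inj eij; move: e; rewrite eij; lia.
by rewrite ltn_neqAle => ->; rewrite length_tperm_neq.
Qed.

Lemma dcoset_rep_exists w : exists v, v \in min_dcoset n mu nu /\
  exists k h, [/\ k \in K, h \in H & w = (k * v * h)%g].
Proof.
pose P (kh : 'S_n * 'S_n) := (kh.1 \in K) && (kh.2 \in H).
have P1 : P (1%g, 1%g) by rewrite /P !group1.
case: (@arg_minnP _ (1%g, 1%g) P
  (fun kh => perm_length (kh.1 * w * kh.2)%g) P1) => -[k h] /andP [/= kK hH] min.
exists (k * w * h)%g; split.
  apply/min_dcosetP => k' h' kK' hH'.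
  have := min (k' * k, h * h')%g; rewrite /P /= !groupM // => /(_ isT).
  by rewrite !mulgA.
by exists k^-1%g, h^-1%g; rewrite !groupV; split=> //; rewrite !mulgA mulVg mul1g mulgK.
Qed.

Definition dcoset_rep w : 'S_n := sval (cid (dcoset_rep_exists w)).

Lemma dcoset_rep_min w : dcoset_rep w \in min_dcoset n mu nu.
Proof. by rewrite /dcoset_rep; case: cid => v []. Qed.

Lemma dcoset_repP w : exists k h, [/\ k \in K, h \in H & w = (k * dcoset_rep w * h)%g].
Proof. by rewrite /dcoset_rep; case: cid => v []. Qed.

Lemma dcoset_rep_bruhat u w : u \in min_dcoset n mu nu -> bruhat u w ->
  bruhat u (dcoset_rep w).
Proof.
move=> uD uw; have [k [h [kK hH e]]] := dcoset_repP w.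
have -> : dcoset_rep w = (k^-1 * w * h^-1)%g.
  by rewrite {2}e !mulgA mulVg mul1g mulgK.
apply: (@bruhat_dcoset n (young_group mu) (young_group nu)) => //;
  rewrite ?groupV //; try exact: young_inversion_closed.
exact: min_dcoset_descent_free.
Qed.

Lemma dcoset_rep_le w : bruhat (dcoset_rep w) w.
Proof.
have [k [h [kK hH e]]] := dcoset_repP w; rewrite {2}e.
apply: (@bruhat_dcoset n (young_group mu) (young_group nu)) => //;
  try exact: young_inversion_closed; last exact: bruhat_refl.
exact/min_dcoset_descent_free/dcoset_rep_min.
Qed.

(** Two minimal elements of one double coset are below each other in the
  Bruhat order, hence equal. *)
Lemma dcoset_repE u k h : u \in min_dcoset n mu nu -> k \in K -> h \in H ->
  dcoset_rep (k * u * h)%g = u.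
Proof.
move=> uD kK hH; apply/esym/bruhat_anti.
  apply: dcoset_rep_bruhat => //.
  apply: (@bruhat_dcoset n (young_group mu) (young_group nu)) => //;
    try exact: young_inversion_closed; last exact: bruhat_refl.
  exact: min_dcoset_descent_free.
have := dcoset_rep_le (k * u * h)%g; set v := dcoset_rep _ => vu.
have -> : u = (k^-1 * (k * u * h) * h^-1)%g.
  by rewrite !mulgA mulVg mul1g mulgK.
apply: (@bruhat_dcoset n (young_group mu) (young_group nu)) => //;
  rewrite ?groupV //; try exact: young_inversion_closed.
exact/min_dcoset_descent_free/dcoset_rep_min.
Qed.

Lemma dcoset_rep_id u : u \in min_dcoset n mu nu -> dcoset_rep u = u.
Proof.
by move=> uD; have := dcoset_repE uD (group1 _) (group1 _); rewrite mul1g mulg1.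
Qed.

Lemma dcoset_rep_mul w k h : k \in K -> h \in H ->
  dcoset_rep (k * w * h)%g = dcoset_rep w.
Proof.
move=> kK hH; have [k' [h' [kK' hH' e]]] := dcoset_repP w.
rewrite [in LHS]e; have -> : (k * (k' * dcoset_rep w * h') * h =
  (k * k') * dcoset_rep w * (h' * h))%g by rewrite !mulgA.
by rewrite dcoset_repE ?groupM ?dcoset_rep_min.
Qed.

(** The permutations that appear when straightening x_i w lie in double
  cosets that are not higher than that of w; this makes the filtration
  stable. *)
Lemma dcoset_rep_tperm w i j :
  (perm_length (w * tperm i j)%g < perm_length w)%N ->
  bruhat (dcoset_rep (w * tperm i j)%g) (dcoset_rep w).
Proof.
move=> lt; apply: dcoset_rep_bruhat; first exact: dcoset_rep_min.
apply: bruhat_trans (dcoset_rep_le _) _; apply/connect1; rewrite /bruhat_step lt andbT.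
apply/existsP; exists (w^-1 i)%g; apply/existsP; exists (w^-1 j)%g.
by rewrite tpermMr mulgA tperm2 mul1g.
Qed.

End DoubleCosets.

(** * Graded Frobenius algebras *)

Section Grading.
Variables (V : zmodType) (h : int -> bool -> V -> Prop).
Hypothesis Hh : is_grading h.

Lemma gr_opp d p v : h d p v -> h d p (- v).
Proof. by move=> hv; rewrite -sub0r; apply: gr_sub => //; apply: gr_zero. Qed.

Lemma gr_add d p u v : h d p u -> h d p v -> h d p (u + v).
Proof. by move=> hu hv; rewrite -[v]opprK; apply: gr_sub => //; apply: gr_opp. Qed.

Lemma gr_sum d p (I : Type) (s : seq I) (P : pred I) (f : I -> V) :
  (forall i, P i -> h d p (f i)) -> h d p (\sum_(i <- s | P i) f i).
Proof.
move=> H; elim/big_ind: _ => //; first exact: gr_zero.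
by move=> u v; apply: gr_add.
Qed.

(** Additive statements need only be checked on homogeneous elements; this
  is how the sign rules, which only make sense for these, are used
  throughout. *)
Lemma grading_ind (P : V -> Prop) : (forall d p v, h d p v -> P v) ->
  (forall u v, P u -> P v -> P (u + v)) -> forall v, P v.
Proof.
move=> Phom Padd v; have [s [c [hc ->]]] := gr_span Hh v.
elim/big_ind: _ => // [|i _]; first by apply: (Phom 0 false); apply: gr_zero.
exact: (Phom i.1 i.2).
Qed.

End Grading.

Section Frobenius.
Variables (k : comNzRingType) (F : frobData k).
Hypothesis HF : is_frobenius F.
Implicit Types (u v f g : F) (b c : fbas F).
Notation tr := (ftr F).
Notation psi := (fnak F).
Notation delta := ((fdeg F)%:Z).

Let Hgr := fr_grading HF.

Lemma fhom_ind (P : F -> Prop) : (forall d p v, fhom d p v -> P v) ->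
  (forall u v, P u -> P v -> P (u + v)) -> forall v, P v.
Proof. exact: grading_ind. Qed.

Lemma tr_odd d e p q f g : fhom d p f -> fhom e q g -> p != q -> tr (f * g) = 0.
Proof.
move=> hf hg npq; apply: (fr_tr_even HF (d := d + e)).
have -> : true = p (+) q by case: p q npq {hf hg} => [] [].
exact: fr_mul.
Qed.

(** The sign can be absorbed by changing the sign of the odd component. *)
Lemma tr_homog_sym f : exists f', forall e q g, fhom e q g ->
  tr (g * f') = (-1) ^+ q * tr (g * f).
Proof.
elim/fhom_ind: f => [d p f hf|f1 f2 [f1' H1] [f2' H2]]; last first.
  by exists (f1' + f2') => e q g hg; rewrite !mulrDr !linearD /= mulrDr (H1 _ _ _ hg) (H2 _ _ _ hg).
exists ((-1) ^+ p *: f) => e q g hg; rewrite -scalerAr linearZ /=.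
have [->//|npq] := eqVneq p q.
by rewrite (tr_odd hg hf) ?mulr0 // eq_sym.
Qed.

(** The sign of the Frobenius form depends on g alone, because tr (g f)
  vanishes unless f and g have the same parity. *)
Lemma trace_form : exists Phi : F -> {scalar F},
  [/\ forall g, Phi 0 g = 0,
      forall e q g, fhom e q g -> forall f, Phi f g = (-1) ^+ q * tr (g * f)
    & forall l : {scalar F}, exists! f, forall g, Phi f g = l g].
Proof.
have [Phi [lin hom uniq]] := fr_frobenius HF; exists Phi; split=> // [g|e q g hg].
  have := lin 1 0 0 g; rewrite scale1r add0r mul1r => e.
  by apply: (addIr (Phi 0 g)); rewrite -e add0r.
elim/fhom_ind => [d p f hf|f f' Hf Hf']; last first.
  by rewrite -[f in LHS]scale1r lin mul1r Hf Hf' mulrDr linearD /= mulrDr.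
rewrite (hom _ _ _ _ _ _ hf hg); have [->|npq] := eqVneq p q; first by rewrite andbb.
by rewrite (tr_odd hg hf) ?mulr0 // eq_sym.
Qed.

Lemma trace_represents (l : {scalar F}) : exists f, forall g, tr (g * f) = l g.
Proof.
have [Phi [_ PhiE /(_ l) [f [Hf _]]]] := trace_form.
have [f' Hf'] := tr_homog_sym f; exists f'.
elim/fhom_ind => [e q g hg|g1 g2 H1 H2]; last first.
  by rewrite mulrDl !linearD /= H1 H2.
by rewrite (Hf' _ _ _ hg) -Hf (PhiE _ _ _ hg).
Qed.

Lemma trace_nondeg_r f : (forall g, tr (g * f) = 0) -> f = 0.
Proof.
move=> H; have [Phi [Phi0 PhiE /(_ (Phi f)) [x [Hx Ux]]]] := trace_form.
rewrite -(Ux f) // (Ux 0) //; elim/fhom_ind => [e q g hg|g1 g2 H1 H2].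
  by rewrite Phi0 (PhiE _ _ _ hg) H mulr0.
by rewrite !linearD /= H1 H2.
Qed.

Definition trace_mul v g : k := tr (v * g).
Fact trace_mul_is_scalar v : scalar (trace_mul v).
Proof. by move=> a x y; rewrite /trace_mul mulrDr -scalerAr linearP. Qed.
HB.instance Definition _ v :=
  GRing.isLinear.Build k F k *%R (trace_mul v) (trace_mul_is_scalar v).

Lemma fb_expansion u : u = \sum_b tr (fbv b * u) *: fb b.
Proof.
have [c [Hc _]] := fr_basis HF u.
have E b : tr (fbv b * u) = c b.
  rewrite Hc mulr_sumr linear_sum (bigD1 b) //= -scalerAr linearZ /= (fr_dual HF).
  rewrite eqxx mulr1 big1 ?addr0 // => b' nb.
  by rewrite -scalerAr linearZ /= (fr_dual HF) eq_sym (negbTE nb) mulr0.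
by rewrite {1}Hc; apply: eq_bigr => b _; rewrite E.
Qed.

(** Nondegeneracy on the other side: the coordinate functionals of the basis
  are of the form tr (_ f), so they all vanish on u. *)
Lemma trace_nondeg_l u : (forall b, tr (u * fb b) = 0) -> u = 0.
Proof.
move=> H; rewrite (fb_expansion u) big1 // => b _.
have [f Hf] := trace_represents (trace_mul (fbv b) : {scalar F}).
rewrite [tr _](_ : _ = trace_mul (fbv b) u) // -Hf (fb_expansion f) mulr_sumr.
rewrite linear_sum big1 ?scale0r // => c _.
by rewrite -scalerAr linearZ /= H mulr0.
Qed.

Lemma fbv_expansion u : u = \sum_b tr (u * fb b) *: fbv b.
Proof.
apply/eqP; rewrite -subr_eq0; apply/eqP/trace_nondeg_l => c.
rewrite mulrBl linearB /= mulr_suml linear_sum (bigD1 c) //=.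
rewrite -scalerAl linearZ /= (fr_dual HF) eqxx mulr1 big1 ?addr0 ?subrr // => b nb.
by rewrite -scalerAl linearZ /= (fr_dual HF) (negbTE nb) mulr0.
Qed.

(** The trace has degree - delta: pairing an element of top degree
  nontrivially with g forces g to have degree 0, since the degrees are
  nonnegative. *)
Lemma trace_degree d p f : fhom d p f -> tr f <> 0 -> d = delta /\ p = false.
Proof.
move=> hf nz; have [e He] := fr_tr_homog HF.
have deg d' p' f' : fhom d' p' f' -> tr f' <> 0 -> d' = e.
  by move=> hf' nz'; apply: contrapT => ne; exact: nz' (He _ _ _ hf' ne).
split; last first.
  by case: p hf => // hf; case: nz; apply: (fr_tr_even HF hf).
have [p0 [f0 [h0 n0]]] := fr_top HF.
have [g [d' [q [hg ng]]]] : exists g d' q, fhom d' q g /\ tr (g * f0) <> 0.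
  apply: contrapT => H; apply: n0; apply: trace_nondeg_r.
  elim/fhom_ind => [d' q g hg|g1 g2 H1 H2]; last by rewrite mulrDl linearD /= H1 H2 addr0.
  by apply: contrapT => ng; apply: H; exists g, d', q.
have hgf := fr_mul HF hg h0.
have gfn : g * f0 <> 0 by move=> e0; apply: ng; rewrite e0 linear0.
have gn : g <> 0 by move=> e0; apply: gfn; rewrite e0 mul0r.
have := fr_max HF hgf gfn; have := fr_nonneg HF hg gn.
rewrite (deg _ _ _ hf nz) -(deg _ _ _ hgf ng); lia.
Qed.

Definition bdeg b : int := sval (cid (fr_basis_homog HF b)).
Definition bpar b : bool := sval (cid (svalP (cid (fr_basis_homog HF b)))).
Lemma fb_hom b : fhom (bdeg b) (bpar b) (fb b).
Proof. exact: (svalP (cid (svalP (cid (fr_basis_homog HF b))))). Qed.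

(** The component of the dual vector in the expected degree and parity has
  the same traces against the basis as the whole vector, so nondegeneracy
  identifies the two. *)
Lemma fbv_hom b : fhom (delta - bdeg b) (bpar b) (fbv b).
Proof.
have [s [c [hc E]]] := gr_span Hgr (fbv b).
suff -> : fbv b = \sum_(i <- s | (i.1 == delta - bdeg b) && (i.2 == bpar b)) c i.
  by apply: (gr_sum Hgr) => i /andP [/eqP <- /eqP <-].
apply/eqP; rewrite -subr_eq0; apply/eqP/trace_nondeg_l => b'.
rewrite mulrBl linearB /=; apply/eqP; rewrite subr_eq0; apply/eqP.
have vanish i : ~~ ((i.1 == delta - bdeg b') && (i.2 == bpar b')) ->
    tr (c i * fb b') = 0.
  move=> ni; apply: contrapT => nz.
  have [e1 e2] := trace_degree (fr_mul HF (hc i) (fb_hom b')) nz.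
  move: ni; rewrite negb_and => /orP [/eqP|]; first by case; rewrite -e1 addrK.
  by move: e2; case: (i.2); case: (bpar b').
have [e|ne] := eqVneq (bdeg b, bpar b) (bdeg b', bpar b').
  case: e => -> ->; rewrite E !mulr_suml !linear_sum [RHS]big_mkcond /=.
  by apply: eq_bigr => i _; case: ifPn => // /vanish.
rewrite (fr_dual HF) [b == b'](_ : _ = false); last first.
  by apply/eqP => eb; move: ne; rewrite eb eqxx.
rewrite mulr_suml linear_sum big1 //= => i /andP [/eqP e1 /eqP e2]; apply: vanish.
move: ne; rewrite xpair_eqE e1 e2; apply: contraNN => /andP [/eqP /addrI /oppr_inj -> ->].
by rewrite eqxx.
Qed.

Lemma psi1 : psi 1 = 1.
Proof.
apply/eqP; rewrite -subr_eq0; apply/eqP/trace_nondeg_r.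
elim/fhom_ind => [e q g hg|g1 g2 H1 H2]; last by rewrite mulrDl linearD /= H1 H2 addr0.
have := fr_nakayama HF (fr_one HF) hg; rewrite mul1r /= mul1r mulrBr mulr1 linearB /= => ->.
by rewrite subrr.
Qed.

Lemma trace_psi d p u b : fhom d p u ->
  tr (fbv b * psi u) = (-1) ^+ p * tr (u * fbv b).
Proof.
move=> hu; have := fr_nakayama HF hu (fbv_hom b).
have [e|ne] := eqVneq p (bpar b).
  by rewrite -e andbb => ->; rewrite mulrA -expr2 sqrr_sign mul1r.
rewrite (tr_odd hu (fbv_hom b) ne) mulr0 => H.
by rewrite -[LHS]mul1r -(sqrr_sign k (p && bpar b)) expr2 -mulrA -H mulr0.
Qed.

(** The coefficients of psi u are traces tr (u b^vee) up to sign, which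
  vanish unless b has the degree and parity of u. *)
Lemma psi_hom d p u : fhom d p u -> fhom d p (psi u).
Proof.
move=> hu; rewrite (fb_expansion (psi u)); apply: (gr_sum Hgr) => b _.
rewrite (trace_psi b hu).
have [z|nz] := pselect (tr (u * fbv b) = 0).
  by rewrite z mulr0 scale0r; apply: (gr_zero Hgr).
have [e1 e2] := trace_degree (fr_mul HF hu (fbv_hom b)) nz.
have -> : d = bdeg b by lia.
have -> : p = bpar b by move: e2; case: p {hu}; case: (bpar b).
exact/(fr_scale HF)/fb_hom.
Qed.

Lemma psi_fbv b : psi (fbv b) = \sum_c ((-1) ^+ bpar c * tr (fbv b * fbv c)) *: fb c.
Proof.
rewrite (fb_expansion (psi _)); apply: eq_bigr => c _; congr (_ *: _).
rewrite (trace_psi c (fbv_hom b)).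
have [->//|ne] := eqVneq (bpar b) (bpar c).
by rewrite (tr_odd (fbv_hom b) (fbv_hom c) ne) !mulr0.
Qed.

End Frobenius.

(** * Relations between tensors, polynomials and permutations *)

Section Relations.
Variables (k : comNzRingType) (F : frobData k) (n : nat).
Hypothesis HF : is_frobenius F.
Implicit Types (u v : F) (b c : fbas F) (x y z : k) (i j a l : 'I_n) (s w : 'S_n)
  (f g : {ffun 'I_n -> F}).
Notation A := (aw F n).
Notation tr := (ftr F).
Notation psi := (fnak F).
Notation X := (@aw_x k F n).
Notation T := (@aw_ten k F n).
Notation P := (@aw_perm k F n).
Notation C := (aw_cst F n).

(** The class in A of a formal expression, typed in A so that ring
  operations can be rewritten. *)
Definition expr_class (x : expr k (aw_gen F n)) : A := to_palg (@aw_rel k F n) x.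

Lemma expr_class_rel (x y : expr k (aw_gen F n)) : aw_rel x y -> expr_class x = expr_class y.
Proof. by move=> xy; apply/to_palgP/ae_rel. Qed.
Lemma expr_classM (x y : expr k (aw_gen F n)) : expr_class (Mul x y) = expr_class x * expr_class y.
Proof. exact: to_palgM. Qed.
Lemma expr_classD (x y : expr k (aw_gen F n)) : expr_class (Add x y) = expr_class x + expr_class y.
Proof. exact: to_palgD. Qed.

Lemma aw_cstC x (a : A) : C x * a = a * C x.
Proof. exact: palg_cstC. Qed.
Lemma aw_cstD x y : C (x + y) = C x + C y.
Proof. exact: (rmorphD (@palg_cst k _ (@aw_rel k F n))). Qed.
Lemma aw_cstM x y : C (x * y) = C x * C y.
Proof. exact: (rmorphM (@palg_cst k _ (@aw_rel k F n))). Qed.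
Lemma aw_cst1 : C 1 = 1.
Proof. exact: (rmorph1 (@palg_cst k _ (@aw_rel k F n))). Qed.
Lemma aw_cst0 : C 0 = 0.
Proof. exact: (rmorph0 (@palg_cst k _ (@aw_rel k F n))). Qed.
Lemma aw_cstN1 : C (-1) = -1.
Proof. exact: (rmorphN1 (@palg_cst k _ (@aw_rel k F n))). Qed.

Lemma aw_xC i j : X i * X j = X j * X i.
Proof. by have := expr_class_rel (r_xx F i j); rewrite !expr_classM. Qed.

Lemma aw_ten_linear f i x u v : T (set_slot f i (x *: u + v)) =
  C x * T (set_slot f i u) + T (set_slot f i v).
Proof.
by have := expr_class_rel (r_tlin i f x u v); rewrite expr_classD expr_classM.
Qed.

Lemma aw_ten1 : T [ffun=> 1] = 1.
Proof. by rewrite -aw_cst1; exact: (expr_class_rel (r_t1 F n)). Qed.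

Lemma aw_tenM f g d p e q : phomog d p f -> phomog e q g ->
  T f * T g = C (mul_sign k p q) * T [ffun i => f i * g i].
Proof.
by move=> hf hg; have := expr_class_rel (r_tt hf hg); rewrite !expr_classM.
Qed.

Lemma aw_perm1 : P 1%g = 1.
Proof. by rewrite -aw_cst1; exact: (expr_class_rel (r_p1 F n)). Qed.

Lemma aw_permM s w : P s * P w = P (w * s)%g.
Proof. by have := expr_class_rel (r_pp F s w); rewrite !expr_classM. Qed.

Lemma aw_permV s : P s * P s^-1%g = 1.
Proof. by rewrite aw_permM mulVg aw_perm1. Qed.
Lemma aw_permVl s : P s^-1%g * P s = 1.
Proof. by rewrite aw_permM mulgV aw_perm1. Qed.

Lemma aw_ten_x f i : T f * X i = X i * T (set_slot f i (psi (f i))).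
Proof. by have := expr_class_rel (r_tx f i); rewrite !expr_classM. Qed.

Lemma aw_perm_ten s f d p : phomog d p f ->
  P s * T f = C (perm_sign k s p) * T (perm_tensor s f) * P s.
Proof. by move=> hf; have := expr_class_rel (r_pt s hf); rewrite !expr_classM. Qed.

Lemma aw_ten_slotD f i u v :
  T (set_slot f i (u + v)) = T (set_slot f i u) + T (set_slot f i v).
Proof. by rewrite -[u in LHS]scale1r aw_ten_linear aw_cst1 mul1r. Qed.

Definition aw_slot i u : A := T (slot i u).

Lemma aw_slotD i u v : aw_slot i (u + v) = aw_slot i u + aw_slot i v.
Proof. exact: aw_ten_slotD. Qed.

Lemma aw_slot0 i : aw_slot i 0 = 0.
Proof. by apply: (addIr (aw_slot i 0)); rewrite -aw_slotD !add0r. Qed.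

Lemma aw_slotZ i x u : aw_slot i (x *: u) = C x * aw_slot i u.
Proof. by rewrite -[x *: u]addr0 /aw_slot aw_ten_linear -/(aw_slot i 0) aw_slot0 addr0. Qed.

Lemma aw_slot_sum i (I : finType) (G : I -> F) :
  aw_slot i (\sum_x G x) = \sum_x aw_slot i (G x).
Proof. by apply: (big_morph _ (aw_slotD i) (aw_slot0 i)). Qed.

Lemma slot_phomog i d p u : fhom d p u ->
  phomog (fun j => if j == i then d else 0) (fun j => (j == i) && p) (slot i u).
Proof.
by move=> hu j; rewrite !ffunE; case: eqP => //= _; exact: (fr_one HF).
Qed.

Lemma mul_sign_slots i j (p q : bool) :
  mul_sign k (fun l => (l == i) && p) (fun l => (l == j) && q) =
  (-1) ^+ ((j < i)%N && (p && q)).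
Proof.
rewrite /mul_sign (bigD1 i) //= [X in _ * X]big1 ?mulr1; last first.
  by move=> a /negbTE ->; rewrite big1.
have [ji|ij] /= := boolP (j < i)%N; last first.
  rewrite big1 // => a ai; rewrite eqxx /=; case: eqP => [ea|_]; last by rewrite andbF.
  by move: ij; rewrite -ea ai.
rewrite (bigD1 j) //= !eqxx /= big1 ?mulr1 // => a /andP [_ /negbTE ->].
by rewrite andbF.
Qed.

Lemma aw_slotM i u v : aw_slot i u * aw_slot i v = aw_slot i (u * v).
Proof.
elim/(fhom_ind HF): u => [d p u hu|u u' IH IH']; last first.
  by rewrite aw_slotD mulrDl IH IH' mulrDl aw_slotD.
elim/(fhom_ind HF): v => [e q v hv|v v' IH IH']; last first.
  by rewrite aw_slotD mulrDr IH IH' mulrDr aw_slotD.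
rewrite /aw_slot (aw_tenM (slot_phomog i hu) (slot_phomog i hv)).
rewrite mul_sign_slots ltnn expr0 aw_cst1 mul1r; congr T.
by apply/ffunP => j; rewrite !ffunE; case: eqP; rewrite ?mul1r.
Qed.

Lemma aw_slotC i j d p e q u v : i != j -> fhom d p u -> fhom e q v ->
  aw_slot i u * aw_slot j v = C ((-1) ^+ (p && q)) * (aw_slot j v * aw_slot i u).
Proof.
move=> nij hu hv; rewrite /aw_slot.
rewrite (aw_tenM (slot_phomog i hu) (slot_phomog j hv)).
rewrite (aw_tenM (slot_phomog j hv) (slot_phomog i hu)) !mul_sign_slots mulrA -aw_cstM.
rewrite [q && p]andbC; congr (C _ * T _); last first.
  apply/ffunP => l; rewrite !ffunE.
  case: (eqVneq l i) => [->|]; first by rewrite (negbTE nij) mulr1 mul1r.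
  by case: (eqVneq l j) => [->|]; rewrite ?mul1r ?mulr1.
case: (ltngtP i j) => //= [ij|ij|/val_inj eij].
- by rewrite expr0 -expr2 sqrr_sign.
- by rewrite mulr1.
- by move: nij; rewrite eij eqxx.
Qed.

Lemma aw_perm_slot s i u : P s * aw_slot i u = aw_slot (s i) u * P s.
Proof.
elim/(fhom_ind HF): u => [d p u hu|u v Hu Hv]; last first.
  by rewrite !aw_slotD mulrDr mulrDl Hu Hv.
rewrite /aw_slot (aw_perm_ten s (slot_phomog i hu)).
have -> : perm_sign k s (fun j => (j == i) && p) = 1.
  rewrite /perm_sign big1 // => a _; rewrite big1 // => c /andP [ac _].
  case: (eqVneq a i) => // ea; case: (eqVneq c i) => // [ec|]; last by rewrite andbF.
  by move: ac; rewrite ea ec ltnn.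
rewrite aw_cst1 mul1r; congr (T _ * _); apply/ffunP => j; rewrite !ffunE.
by rewrite (canF_eq (permKV s)).
Qed.

Lemma set_slot_slot i j u :
  set_slot (slot i u) j (psi (slot i u j)) = slot i (if i == j then psi u else u).
Proof.
apply/ffunP => l; rewrite !ffunE; case: (eqVneq l j) => [->|nlj]; last first.
  by case: (eqVneq l i) => // eli; rewrite -eli (negbTE nlj).
by rewrite eq_sym; case: eqP => // _; apply: psi1.
Qed.

Lemma aw_slot_x i j u : aw_slot i u * X j = X j * aw_slot i (if i == j then psi u else u).
Proof.
by rewrite /aw_slot aw_ten_x set_slot_slot.
Qed.

Definition slot_prod f : A := \prod_(i < n) aw_slot i (f i).

Lemma set_slot_id f i : set_slot f i (f i) = f.
Proof. by apply/ffunP => j; rewrite !ffunE; case: eqP => [->|]. Qed.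

Lemma slot_prodD f i u v : slot_prod (set_slot f i (u + v)) =
  slot_prod (set_slot f i u) + slot_prod (set_slot f i v).
Proof.
rewrite /slot_prod; have := mem_index_enum i; have := index_enum_uniq 'I_n.
move: (index_enum _) => r + /splitPr er; case: er => r1 r2.
rewrite cat_uniq /= negb_or => /and4P [_ /andP [i1 _] i2 _].
rewrite !big_cat !big_cons /= !ffunE !eqxx aw_slotD.
have E r' : i \notin r' -> forall (x : F), \prod_(j <- r') aw_slot j ((set_slot f i x) j) =
    \prod_(j <- r') aw_slot j (f j).
  move=> nir x; apply: eq_big_seq => j jr; rewrite ffunE.
  by case: eqP => // ej; move: nir; rewrite -ej jr.
by rewrite !E // mulrDl mulrDr.
Qed.

(** The product and permutation rules are given for tensors of homogeneous
  elements; multiadditive statements extend from these to all pure tensors,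
  one slot at a time. *)
Lemma multiadditive_ind (Q : {ffun 'I_n -> F} -> Prop) :
  (forall d p f, phomog d p f -> Q f) ->
  (forall f i u v, Q (set_slot f i u) -> Q (set_slot f i v) -> Q (set_slot f i (u + v))) ->
  forall f, Q f.
Proof.
move=> Qhom Qadd f.
suff H : forall m f, (forall i : 'I_n, (m <= i)%N -> exists d p, fhom d p (f i)) -> Q f.
  by apply: (H n) => i; rewrite leqNgt ltn_ord.
elim=> [|m IH] {}f Hf.
  pose d i := sval (cid (Hf i (leq0n i))).
  pose p i := sval (cid (svalP (cid (Hf i (leq0n i))))).
  apply: (Qhom d p) => i; exact: (svalP (cid (svalP (cid (Hf i (leq0n i)))))).
case: (ltnP m n) => [mn|nm]; last first.
  by apply: IH => i; have := ltn_ord i; rewrite ltnNge => /negP + mi; case; lia.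
rewrite -(set_slot_id f (Ordinal mn)); move: (f (Ordinal mn)).
elim/(fhom_ind HF) => [d p v hv|u v Hu Hv]; last exact: Qadd.
apply: IH => i mi; rewrite ffunE; case: eqP => [_|ne]; first by exists d, p.
apply: Hf; rewrite ltn_neqAle mi andbT; apply/eqP => em; apply: ne; exact: val_inj.
Qed.

Lemma prod_ord_nat (G : 'I_n -> A) :
  \prod_(i < n) G i = \prod_(0 <= i < n) oapp G 1 (insub i).
Proof. by rewrite big_mkord; apply: eq_bigr => i _; rewrite valK. Qed.

(** The factors stand in increasing order, so the sign rule contributes no
  sign when they are multiplied together. *)
Lemma aw_tenE f : T f = slot_prod f.
Proof.
elim/multiadditive_ind: f => [d p f hf|f i u v Hu Hv]; last first.
  by rewrite slot_prodD aw_ten_slotD Hu Hv.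
rewrite /slot_prod prod_ord_nat.
(* Truncations of f, padded by 1, give the partial products. *)
have H : forall m, (m <= n)%N -> T [ffun i : 'I_n => if (i < m)%N then f i else 1] =
    \prod_(0 <= i < m) oapp (fun i => aw_slot i (f i)) 1 (insub i).
  elim=> [_|m IH mn].
    by rewrite big_geq // -aw_ten1; congr T; apply/ffunP => i; rewrite !ffunE.
  rewrite big_nat_recr //= -IH ?(ltnW mn) // insubT /=.
  pose im := Ordinal mn.
  have h1 : phomog (fun i => if (i < m)%N then d i else 0) (fun i => (i < m)%N && p i)
      [ffun i : 'I_n => if (i < m)%N then f i else 1].
    by move=> i; rewrite ffunE; case: ifP => _ //=; exact: (fr_one HF).
  rewrite /aw_slot (aw_tenM h1 (slot_phomog im (hf im))).
  have -> : mul_sign k (fun i => (i < m)%N && p i) (fun i => (i == im) && p im) = 1.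
    rewrite /mul_sign big1 // => i _; rewrite big1 // => j ji.
    case: (ltnP i m) => //= im'; case: eqP => [ej|_]; last by rewrite andbF.
    by move: ji; rewrite ej /=; lia.
  rewrite aw_cst1 mul1r; congr T; apply/ffunP => i; rewrite !ffunE -val_eqE /=.
  case: (ltngtP i m) => [im'|im'|im'] /=.
  - by rewrite mulr1 ltnS ltnW.
  - by rewrite ltnS leqNgt im' /= mulr1.
  - by rewrite im' ltnSn mul1r; congr (f _); apply: val_inj.
rewrite -H //; congr T; apply/ffunP => i; by rewrite ffunE ltn_ord.
Qed.

(** Conjugation inside A replaces the signed permutation of the factors,
  whose sign is defined only for homogeneous tensors. *)
Definition conj_ten w f : A := P w^-1%g * T f * P w.

Lemma conj_tenE w f : conj_ten w f = \prod_(i < n) aw_slot ((w^-1)%g i) (f i).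
Proof.
rewrite /conj_ten aw_tenE /slot_prod.
have -> : P w^-1%g * \prod_(i < n) aw_slot i (f i) =
    \prod_(i < n) aw_slot ((w^-1)%g i) (f i) * P w^-1%g.
  elim: (index_enum _) => [|i r IH]; first by rewrite !big_nil mulr1 mul1r.
  by rewrite !big_cons mulrA aw_perm_slot -mulrA IH mulrA.
by rewrite -mulrA aw_permVl mulr1.
Qed.

Lemma conj_ten_x w f i : conj_ten w f * X ((w^-1)%g i) =
  X ((w^-1)%g i) * conj_ten w (set_slot f i (psi (f i))).
Proof.
rewrite !conj_tenE; elim: (index_enum _) => [|j r IH].
  by rewrite !big_nil mulr1 mul1r.
rewrite !big_cons -mulrA IH mulrA aw_slot_x -mulrA (inj_eq perm_inj) ffunE.
by case: eqP => [->|].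
Qed.

(** The element t_{i,j}; it is considered for all pairs of distinct indices,
  not only for consecutive ones. *)
Definition aw_t i j : A := \sum_b aw_slot i (fb b) * aw_slot j (fbv b).

Lemma expr_class_et i j : expr_class (et F i j) = aw_t i j.
Proof.
rewrite /et /aw_t -big_enum /=; elim: (enum _) => [|b r IH] /=.
  by rewrite big_nil; exact: aw_cst0.
by rewrite big_cons expr_classD expr_classM IH.
Qed.

(** Both sides are the double sum of tr (c^vee u b) c_i b^vee_j over basis
  vectors b and c. *)
Lemma aw_slot_t_left i j u : aw_slot i u * aw_t i j = aw_t i j * aw_slot j u.
Proof.
rewrite /aw_t mulr_sumr mulr_suml.
under eq_bigr => b _.
  rewrite mulrA aw_slotM (fb_expansion HF (u * fb b)) aw_slot_sum mulr_suml; over.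
under [RHS]eq_bigr => b _.
  rewrite -mulrA aw_slotM (fbv_expansion HF (fbv b * u)) aw_slot_sum mulr_sumr; over.
rewrite exchange_big; apply: eq_bigr => c _; apply: eq_bigr => b _.
by rewrite !aw_slotZ mulrA -mulrA aw_cstC -!mulrA aw_cstC !mulrA.
Qed.

(** Both sides are a double sum over b_i c^vee_j. The coefficients tr (u
  b^vee c) and tr (b^vee c psi(u)) agree up to the sign in the definition of
  psi, which compensates the signs from moving u past b_i and psi(u) past
  c^vee_j. *)
Lemma aw_slot_t_right i j u : i != j ->
  aw_slot j u * aw_t i j = aw_t i j * aw_slot i (psi u).
Proof.
move=> nij; have nji : j != i by rewrite eq_sym.
elim/(fhom_ind HF): u => [d p u hu|u v Hu Hv]; last first.
  by rewrite linearD !aw_slotD mulrDl mulrDr Hu Hv.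
rewrite /aw_t mulr_sumr mulr_suml.
under eq_bigr => b _.
  rewrite mulrA (aw_slotC nji hu (fb_hom HF b)) -2!mulrA aw_slotM.
  rewrite (fbv_expansion HF (u * fbv b)) aw_slot_sum !mulr_sumr; over.
under [RHS]eq_bigr => b _.
  rewrite -mulrA (aw_slotC nji (fbv_hom HF b) (psi_hom HF hu)).
  rewrite mulrA -aw_cstC -mulrA [aw_slot i (fb b) * _]mulrA aw_slotM.
  rewrite (fb_expansion HF (fb b * psi u)) aw_slot_sum mulr_suml mulr_sumr; over.
rewrite exchange_big; apply: eq_bigr => c _; apply: eq_bigr => b _.
rewrite !aw_slotZ -[C _ * aw_slot i _ * _]mulrA [aw_slot i _ * (C _ * _)]mulrA.
rewrite -aw_cstC -[C _ * aw_slot i _ * _]mulrA !mulrA -!aw_cstM; congr (C _ * _ * _).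
rewrite -mulrA (fr_nakayama HF hu (fr_mul HF (fbv_hom HF b) (fb_hom HF c))) !mulrA.
congr (_ * _); rewrite -signr_addb; congr ((-1) ^+ _).
by case: p {hu}; case: (bpar _ b); case: (bpar _ c).
Qed.

Lemma aw_slot_t_other i j l u : l != i -> l != j ->
  aw_slot l u * aw_t i j = aw_t i j * aw_slot l u.
Proof.
move=> nli nlj; elim/(fhom_ind HF): u => [d p u hu|u v Hu Hv]; last first.
  by rewrite !aw_slotD mulrDl mulrDr Hu Hv.
rewrite /aw_t mulr_sumr mulr_suml; apply: eq_bigr => b _.
rewrite mulrA (aw_slotC nli hu (fb_hom HF b)) -2!mulrA.
rewrite (aw_slotC nlj hu (fbv_hom HF b)) [aw_slot i _ * (C _ * _)]mulrA -aw_cstC.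
by rewrite !mulrA -aw_cstM -expr2 sqrr_sign aw_cst1 mul1r.
Qed.

(** The family of the psi(b^vee), with signs, has the b as its left dual
  basis, and t does not depend on the choice of the basis. *)
Lemma aw_t_swap i j : i != j ->
  aw_t j i = \sum_b aw_slot i (fb b) * aw_slot j (psi (fbv b)).
Proof.
move=> nij; have nji : j != i by rewrite eq_sym.
rewrite /aw_t; under eq_bigr => c _.
  rewrite (aw_slotC nji (fb_hom HF c) (fbv_hom HF c)) andbb.
  rewrite {1}(fb_expansion HF (fbv c)) aw_slot_sum mulr_suml mulr_sumr; over.
under [RHS]eq_bigr => b _.
  rewrite (psi_fbv HF b) aw_slot_sum mulr_sumr; over.
rewrite exchange_big; apply: eq_bigr => b _; apply: eq_bigr => c _.
by rewrite !aw_slotZ !mulrA -!aw_cstM -(aw_cstC _ (aw_slot i _)).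
Qed.

Lemma conj_slot w i u : conj_ten w (slot i u) = aw_slot ((w^-1)%g i) u.
Proof. by rewrite /conj_ten aw_perm_slot -mulrA aw_permVl mulr1. Qed.

Lemma aw_perm_t s i j : P s * aw_t i j = aw_t (s i) (s j) * P s.
Proof.
rewrite /aw_t mulr_suml mulr_sumr; apply: eq_bigr => b _.
by rewrite mulrA aw_perm_slot -mulrA aw_perm_slot !mulrA.
Qed.

(** The tensor f passes t_{j,i} by exchanging its factors in the slots i and
  j, with psi applied once; this is the compatibility of the correction
  terms of x_i with the relation f x_i = x_i psi_i(f). *)
Lemma conj_ten_t w f i j : i != j ->
  conj_ten w f * aw_t ((w^-1)%g j) ((w^-1)%g i) =
  aw_t ((w^-1)%g j) ((w^-1)%g i) *
    conj_ten (w * tperm i j)%g (set_slot f i (psi (f i))).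
Proof.
move=> nij; rewrite !conj_tenE; elim: (index_enum _) => [|l r IH].
  by rewrite !big_nil mulr1 mul1r.
rewrite !big_cons -mulrA IH mulrA [RHS]mulrA; congr (_ * _).
rewrite invMg permM tpermV ffunE.
have inj (x y : 'I_n) : x != y -> (w^-1)%g x != (w^-1)%g y by rewrite (inj_eq perm_inj).
case: (tpermP i j l) => [->|->|/eqP nli /eqP nlj].
- by rewrite eqxx aw_slot_t_right // inj // eq_sym.
- by rewrite eq_sym (negbTE nij) aw_slot_t_left.
- by rewrite (negbTE nli) aw_slot_t_other // inj.
Qed.

(** The correction in s x_a = x_{s(a)} s + ..., for s the transposition of i
  and i' = i + 1 and an arbitrary index a. *)
Definition skein_term i i' a : A :=
  if a == i then - aw_t i i' else if a == i' then aw_t i' i else 0.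

Lemma aw_skein i i' a : i' = i.+1 :> nat ->
  P (tperm i i') * X a = X (tperm i i' a) * P (tperm i i') + skein_term i i' a.
Proof.
move=> e; have nii : i' != i by apply/negP => /eqP eii; move: e; rewrite eii; lia.
have H : P (tperm i i') * X i = X i' * P (tperm i i') - aw_t i i'.
  have := expr_class_rel (r_sx_skein F e).
  by rewrite !(expr_classM, expr_classD) expr_class_et (aw_cstN1 : expr_class _ = _) mulN1r.
rewrite /skein_term; case: tpermP => [->|->|/eqP n1 /eqP n2].
- by rewrite eqxx H.
- have := congr1 (fun z : A => P (tperm i i') * (z * P (tperm i i'))) H.
  rewrite (negbTE nii) eqxx mulrBl mulrBr -!mulrA aw_permM tperm2 aw_perm1 mulr1.
  rewrite [P _ * (P _ * _)]mulrA aw_permM tperm2 aw_perm1 mul1r => ->.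
  rewrite [P _ * (aw_t _ _ * _)]mulrA aw_perm_t tpermL tpermR -mulrA aw_permM tperm2.
  by rewrite aw_perm1 mulr1 subrK.
- rewrite (negbTE n1) (negbTE n2) addr0.
  by have := expr_class_rel (r_sx F e n1 n2); rewrite !expr_classM.
Qed.

End Relations.

(** * The action on functions from S_n to A *)

Section Action.
Variables (k : comNzRingType) (F : frobData k) (n : nat).
Hypothesis HF : is_frobenius F.
Implicit Types (u v : F) (b c : fbas F) (x y z : k) (i j a l : 'I_n)
  (s w : 'S_n) (f : {ffun 'I_n -> F}).
Notation A := (aw F n).
Notation psi := (fnak F).
Notation X := (@aw_x k F n).
Notation T := (@aw_ten k F n).
Notation P := (@aw_perm k F n).
Notation C := (aw_cst F n).
Notation W := {ffun 'S_n -> A}.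
Implicit Types (g : W).

(** Equivalently, the transposition of the values i and j makes w longer. *)
Definition noninverted w i j :=
  (j != i) && ((i < j)%N == ((w^-1)%g i < (w^-1)%g j)%N).

Definition opC x (g : W) : W := [ffun w : 'S_n => C x * g w].
Definition opT f (g : W) : W := [ffun w : 'S_n => conj_ten w f * g w].
Definition opP s (g : W) : W := [ffun w : 'S_n => g (w * s^-1)%g].
(** Straightening gives x_i w = w x_{w^{-1}(i)} + sum of +- (i j) w
  t_{w^{-1}(i),w^{-1}(j)} over the inversions of w involving i. The formula
  is that of the action of x_i on the sum of the w g(w), with the terms
  collected according to the permutation (i j) w that they contain. *)
Definition opX i (g : W) : W := [ffun w : 'S_n => X ((w^-1)%g i) * g w +
  \sum_(j | noninverted w i j) (-1) ^+ (i < j)%N *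
    (aw_t F ((w^-1)%g j) ((w^-1)%g i) * g (w * tperm i j)%g)].
Definition op_t i j (g : W) : W :=
  [ffun w : 'S_n => aw_t F ((w^-1)%g i) ((w^-1)%g j) * g w].

Lemma opXD i : {morph opX i : g h / g + h}.
Proof.
move=> g h; apply/ffunP => w; rewrite !ffunE mulrDr addrACA; congr (_ + _).
rewrite -big_split /=; apply: eq_bigr => j _; by rewrite !ffunE -!mulrDr.
Qed.
Lemma opX0 i : opX i 0 = 0.
Proof. by apply: (addIr (opX i 0)); rewrite -opXD !add0r. Qed.
Lemma opXN i g : opX i (- g) = - opX i g.
Proof. by apply: (addIr (opX i g)); rewrite -opXD !addNr opX0. Qed.

Lemma opT_X f i g : opT f (opX i g) = opX i (opT (set_slot f i (psi (f i))) g).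
Proof.
apply/ffunP => w; rewrite !ffunE mulrDr mulrA (conj_ten_x HF) -mulrA mulr_sumr.
congr (_ + _); apply: eq_bigr => j /andP [ji _].
rewrite ffunE [LHS]mulrA (commr_sign (conj_ten w f)) -[LHS]mulrA; congr (_ * _).
by rewrite [LHS]mulrA (conj_ten_t HF) 1?eq_sym // -mulrA.
Qed.

Lemma opT_slot_X i j u g :
  opT (slot i u) (opX j g) = opX j (opT (slot i (if i == j then psi u else u)) g).
Proof.
by rewrite opT_X set_slot_slot.
Qed.

Lemma op_tE i j g : op_t i j g = \sum_b opT (slot i (fb b)) (opT (slot j (fbv b)) g).
Proof.
apply/ffunP => w; rewrite ffunE sum_ffunE mulr_suml; apply: eq_bigr => b _.
by rewrite !ffunE !(conj_slot HF) mulrA.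
Qed.

Lemma op_t_X_other i j l g : l != i -> l != j -> op_t i j (opX l g) = opX l (op_t i j g).
Proof.
move=> nli nlj; rewrite !op_tE (big_morph _ (opXD l) (opX0 l)); apply: eq_bigr => b _.
by rewrite !opT_slot_X 2![_ == l]eq_sym (negbTE nli) (negbTE nlj).
Qed.

Lemma op_t_X_right i j g : i != j -> op_t i j (opX j g) = opX j (op_t j i g).
Proof.
move=> nij; have -> : op_t j i g =
    \sum_b opT (slot i (fb b)) (opT (slot j (psi (fbv b))) g).
  apply/ffunP => w; rewrite ffunE sum_ffunE (aw_t_swap HF) ?(inj_eq perm_inj) //.
  by rewrite mulr_suml; apply: eq_bigr => b _; rewrite !ffunE !(conj_slot HF) mulrA.
rewrite op_tE (big_morph _ (opXD j) (opX0 j)); apply: eq_bigr => b _.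
by rewrite !opT_slot_X eqxx (negbTE nij).
Qed.

Definition op_skein i i' a g : W :=
  if a == i then - op_t i i' g else if a == i' then op_t i' i g else 0.

Lemma tperm_adjacent_ltn i i' a l : i' = i.+1 :> nat -> l != tperm i i' a -> l != a ->
  (tperm i i' a < tperm i i' l)%N = (a < l)%N.
Proof.
move=> e; case: tpermP => [->|->|/eqP n1 /eqP n2]; case: tpermP => [->|->|/eqP n3 /eqP n4];
  rewrite ?eqxx // => _ _.
- by have := ord_neq n3; have := ord_neq n4 => ? ?; apply/idP/idP; lia.
- by have := ord_neq n3; have := ord_neq n4 => ? ?; apply/idP/idP; lia.
- by have := ord_neq n1; have := ord_neq n2 => ? ?; apply/idP/idP; lia.
- by have := ord_neq n1; have := ord_neq n2 => ? ?; apply/idP/idP; lia.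
Qed.

(** After reindexing by s, the two sums differ only in the term of the index
  s a, where the order of a and s a is reversed by s; this term is the
  correction. *)
Lemma opP_X i i' a g : i' = i.+1 :> nat ->
  opP (tperm i i') (opX a g) =
  opX (tperm i i' a) (opP (tperm i i') g) + op_skein i i' a g.
Proof.
move=> e; apply/ffunP => w; rewrite !ffunE invMg invgK permM -addrA; congr (_ + _).
set s := tperm i i'.
have sV : (s^-1 = s)%g by rewrite tpermV.
rewrite [X in _ = X + _](reindex_inj (@perm_inj _ s)) /=.
rewrite [LHS]big_mkcond [X in _ = X + _]big_mkcond /=.
pose L j := if noninverted (w * s^-1)%g a j then (-1) ^+ (a < j)%N *
  (aw_t F ((w^-1)%g (s j)) ((w^-1)%g (s a)) * g (w * s^-1 * tperm a j)%g) else 0.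
pose R j := if noninverted w (s a) (s j) then (-1) ^+ (s a < s j)%N *
  (aw_t F ((w^-1)%g (s j)) ((w^-1)%g (s a)) * g (w * tperm (s a) (s j) * s^-1)%g) else 0.
rewrite (eq_bigr L) => [|j _]; last first.
  by rewrite /L; case: ifP => // _; rewrite !permM.
rewrite [X in _ = X + _](eq_bigr R) => [|j _]; last first.
  by rewrite /R; case: ifP => // _; rewrite ffunE.
have braid j : (w * tperm (s a) (s j) * s^-1 = w * s^-1 * tperm a j)%g.
  by rewrite -tpermJ conjgE !mulgA mulgK sV.
have LR j : j != s a -> L j = R j.
  have [-> _|ja jsa] := eqVneq j a; first by rewrite /L /R /noninverted !eqxx.
  have := tperm_adjacent_ltn e jsa ja; rewrite -/s => E.
  by rewrite /L /R /noninverted braid invMg invgK !permM E (inj_eq perm_inj).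
(* All terms but the one of index s a agree. *)
rewrite (bigD1 (s a)) //= [X in _ = X + _](bigD1 (s a)) //= (eq_bigr R) //.
rewrite [RHS]addrAC; congr (_ + _).
rewrite /op_skein /L /R /noninverted invMg invgK !permM braid tpermK.
have nii : i' != i by apply/negP => /eqP eii; move: e; rewrite eii; lia.
have nii2 : i != i' by rewrite eq_sym.
have lt1 : (i < i')%N by lia.
have lt2 : (i' < i)%N = false by lia.
have gw : g (w * s^-1 * tperm i i')%g = g w by rewrite mulgKV.
have gw' : g (w * s^-1 * tperm i' i)%g = g w by rewrite tpermC mulgKV.
have si : s i = i' by rewrite /s tpermL.
have si' : s i' = i by rewrite /s tpermR.
clear LR L R braid.
have [->|n1] := eqVneq a i.
  rewrite si (negbTE nii2) nii /= lt1 lt2 gw !ffunE /= expr1 expr0 mul1r mulN1r.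
  by case: (_ < _)%N => /=; rewrite ?add0r ?addr0 // subrr.
have [->|n2] := eqVneq a i'.
  rewrite si' (negbTE nii) nii2 /= lt1 lt2 gw' !ffunE /= expr1 expr0 mul1r mulN1r.
  by case: (_ < _)%N => /=; rewrite ?add0r ?addr0 // addNr.
have -> : s a = a by rewrite /s tpermD // eq_sym.
by rewrite eqxx /= ffunE addr0.
Qed.

(** The correction terms of s x_a x_l and s x_l x_a agree: this comes from
  t_{i,j} x_j = x_j t_{j,i}. *)
Lemma op_skein_comm i i' a l g : i' = i.+1 :> nat ->
  opX (tperm i i' a) (op_skein i i' l g) + op_skein i i' a (opX l g) =
  opX (tperm i i' l) (op_skein i i' a g) + op_skein i i' l (opX a g).
Proof.
move=> e; have nii : i' != i by apply/negP => /eqP eii; move: e; rewrite eii; lia.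
have nii2 : i != i' by rewrite eq_sym.
rewrite /op_skein; case: (tpermP i i' a) => [->|->|/eqP n1 /eqP n2];
  case: (tpermP i i' l) => [->|->|/eqP n3 /eqP n4]; rewrite ?eqxx ?(negbTE nii) //;
  rewrite ?(negbTE n1) ?(negbTE n2) ?(negbTE n3) ?(negbTE n4) ?opXN ?opX0 ?addr0 ?add0r //.
- by rewrite !op_t_X_right // subrr addNr.
- by rewrite op_t_X_other.
- by rewrite !op_t_X_right // subrr addNr.
- by rewrite op_t_X_other.
- by rewrite op_t_X_other.
- by rewrite op_t_X_other.
Qed.

Definition longest : 'S_n := perm rev_ord_inj.

(** At the longest permutation every pair is inverted, so the sum is empty. *)
Lemma opX_longest i g : opX i g longest = X ((longest^-1)%g i) * g longest.
Proof.
have longestV : (longest^-1 = longest)%g.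
  by apply/eqP; rewrite eq_invg_mul; apply/eqP/permP => j; rewrite permM !permE rev_ordK.
rewrite ffunE big_pred0 ?addr0 // => j; apply/negP => /andP [ji].
have := ord_neq ji; rewrite longestV !permE /=; have := ltn_ord i; have := ltn_ord j.
rewrite neq_ltn => jn iN /orP [lt|lt] /eqP e.
  have : (n - i.+1 < n - j.+1)%N by lia.
  by rewrite -e; lia.
by move: (lt); rewrite e; lia.
Qed.

(** The commutator is carried to a commutator by the simple transpositions,
  and it vanishes at the longest permutation because the x_i commute in A.
  Every permutation is reached from the longest one by simple
  transpositions. *)
Lemma opX_comm i j g : opX i (opX j g) = opX j (opX i g).
Proof.
apply/ffunP => w; rewrite -[w](mulKVg longest); move: (_ * w)%g => h.
have hT : h \in [set: 'S_n]%G by rewrite inE.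
move: i j g; move: h hT; apply: parabolic_ind_r => [s p q _ _ _|i j g|].
- by rewrite inE.
- by rewrite mulg1 !opX_longest mulrA aw_xC -mulrA.
move=> s h /simpleP [a [a' [e ->]]] _ _ IH i j g; rewrite mulgA.
have E (g' : W) : g' (longest * h * tperm a a')%g = opP (tperm a a') g' (longest * h)%g.
  by rewrite ffunE tpermV.
have PD : {morph opP (tperm a a') : g h / g + h}.
  by move=> g1 g2; apply/ffunP => v; rewrite !ffunE.
rewrite !E !(opP_X _ _ e) !opXD -!addrA (op_skein_comm _ _ _ e).
by rewrite ffunE IH [RHS]ffunE.
Qed.

Fixpoint act (x : expr k (aw_gen F n)) : W -> W :=
  match x with
  | Cst z => opC z
  | Gen (GX i) => opX i
  | Gen (GT f) => opT f
  | Gen (GP s) => opP s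
  | Add x y => fun g => act x g + act y g
  | Mul x y => fun g => act x (act y g)
  end.

Lemma actD (x : expr k (aw_gen F n)) : {morph act x : g h / g + h}.
Proof.
elim: x => [z|[i|f|s]|x IHx y IHy|x IHx y IHy] g h /=.
- by apply/ffunP => w; rewrite !ffunE mulrDr.
- exact: opXD.
- by apply/ffunP => w; rewrite !ffunE mulrDr.
- by apply/ffunP => w; rewrite !ffunE.
- by rewrite IHx IHy addrACA.
- by rewrite IHy IHx.
Qed.

Definition rmul (g : W) (a : A) : W := [ffun w : 'S_n => g w * a].

Lemma act_rmul (x : expr k (aw_gen F n)) g (a : A) : act x (rmul g a) = rmul (act x g) a.
Proof.
elim: x g => [z|[i|f|s]|x IHx y IHy|x IHx y IHy] g /=.
- by apply/ffunP => w; rewrite !ffunE mulrA.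
- apply/ffunP => w; rewrite !ffunE mulrDl mulrA mulr_suml; congr (_ + _).
  by apply: eq_bigr => j _; rewrite ffunE !mulrA.
- by apply/ffunP => w; rewrite !ffunE mulrA.
- by apply/ffunP => w; rewrite !ffunE.
- by rewrite IHx IHy; apply/ffunP => w; rewrite !ffunE mulrDl.
- by rewrite IHy IHx.
Qed.

Lemma opCE z g : opC z g = rmul g (C z).
Proof. by apply/ffunP => w; rewrite !ffunE aw_cstC. Qed.

Lemma act_et i j g : act (et F i j) g = op_t i j g.
Proof.
rewrite op_tE /et -big_enum /=; elim: (enum _) => [|b r IH] /=.
  by rewrite big_nil; apply/ffunP => w; rewrite !ffunE aw_cst0 mul0r.
by rewrite big_cons IH.
Qed.

(** Apart from the commutation of the x_i and their exchange with simple
  transpositions, the relations hold pointwise because the tensors act by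
  conjugates computed in A itself. *)
Lemma act_rel (x y : expr k (aw_gen F n)) : aw_rel x y -> forall g, act x g = act y g.
Proof.
case=> {x y} [i j|f i z u v||f f' d p e q hf hf'||s t|f i|i i' j e n1 n2|i i' e|s f d p hf] g /=.
- exact: opX_comm.
- apply/ffunP => w; rewrite !ffunE /conj_ten aw_ten_linear mulrDr mulrDl mulrDl.
  by congr (_ + _); rewrite !mulrA -[_ * C z]aw_cstC.
- by apply/ffunP => w; rewrite !ffunE /conj_ten aw_ten1 mulr1 aw_permVl aw_cst1.
- apply/ffunP => w; rewrite !ffunE /conj_ten !mulrA -[_ * P w * P _]mulrA aw_permV mulr1.
  by rewrite -[_ * T f * T f']mulrA (aw_tenM hf hf') !mulrA -[_ * C _]aw_cstC.
- by apply/ffunP => w; rewrite !ffunE invg1 mulg1 aw_cst1 mul1r.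
- by apply/ffunP => w; rewrite !ffunE invMg mulgA.
- exact: opT_X.
- rewrite (opP_X _ _ e) /op_skein (negbTE n1) (negbTE n2) addr0; congr (opX _ _).
  by case: tpermP n1 n2 => [->|->|//]; rewrite eqxx.
- rewrite (opP_X _ _ e) /op_skein eqxx tpermL act_et; congr (_ + _).
  by apply/ffunP => w; rewrite !ffunE aw_cstN1 mulN1r.
- apply/ffunP => w; rewrite !ffunE !mulrA; congr (_ * _).
  rewrite /conj_ten invMg invgK -!aw_permM !mulrA.
  rewrite -[P w^-1%g * P s * T f]mulrA (aw_perm_ten s hf) !mulrA -[_ * C _]aw_cstC.
  by rewrite -(mulrA _ (P s) (P s^-1%g)) aw_permV mulr1.
Qed.

Lemma act_alg_eq (x y : expr k (aw_gen F n)) :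
  alg_eq (@aw_rel k F n) x y -> forall g, act x g = act y g.
Proof.
elim=> {x y} [x y|x|x y _ IH|y x z _ IH _ IH'|x x' y y' _ IH _ IH'|x x' y y' _ IH _ IH'|
  x y z|x y|x|x|x y z|x|x|x y z|x y z|c d|c d|c x] g //=.
- exact: act_rel.
- by rewrite IH IH'.
- by rewrite IH IH'.
- by rewrite IH IH'.
- by rewrite addrA.
- by rewrite addrC.
- by apply/ffunP => w; rewrite !ffunE aw_cst0 mul0r add0r.
- by apply/ffunP => w; rewrite !ffunE aw_cst0 aw_cstN1 mul0r mulN1r addNr.
- by apply/ffunP => w; rewrite !ffunE aw_cst1 mul1r.
- by congr (act x _); apply/ffunP => w; rewrite !ffunE aw_cst1 mul1r.
- by rewrite actD.
- by apply/ffunP => w; rewrite !ffunE aw_cstD mulrDl.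
- by apply/ffunP => w; rewrite !ffunE aw_cstM mulrA.
- by rewrite !opCE act_rmul.
Qed.

(** A acts on the functions from S_n to A: this models the free right module
  with basis S_n. *)
Definition aw_act (a : A) : W -> W := act (palg_repr a).

Lemma aw_act_class (x : expr k (aw_gen F n)) : aw_act (expr_class x) =1 act x.
Proof. by move=> g; apply: act_alg_eq; apply: palg_repr_eq. Qed.

Lemma aw_act_mul (a b : A) g : aw_act (a * b) g = aw_act a (aw_act b g).
Proof.
rewrite -[in LHS](palg_reprK a) -[in LHS](palg_reprK b) -[_ * _]to_palgM.
exact: aw_act_class.
Qed.

Lemma aw_act_add (a b : A) g : aw_act (a + b) g = aw_act a g + aw_act b g.
Proof.
rewrite -[in LHS](palg_reprK a) -[in LHS](palg_reprK b) -[_ + _]to_palgD.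
exact: aw_act_class.
Qed.

Lemma aw_act_cst x : aw_act (C x) =1 opC x. Proof. exact: aw_act_class. Qed.
Lemma aw_act_x i : aw_act (X i) =1 opX i. Proof. exact: aw_act_class. Qed.
Lemma aw_act_ten f : aw_act (T f) =1 opT f. Proof. exact: aw_act_class. Qed.
Lemma aw_act_perm s : aw_act (P s) =1 opP s. Proof. exact: aw_act_class. Qed.

End Action.

(** * The basis theorem and coefficients along cosets *)

Section Coefficients.
Variables (k : comNzRingType) (F : frobData k) (n : nat).
Hypothesis HF : is_frobenius F.
Implicit Types (x y z : k) (i j : 'I_n) (u v w s : 'S_n) (f : {ffun 'I_n -> F}).
Notation A := (aw F n).
Notation X := (@aw_x k F n).
Notation T := (@aw_ten k F n).
Notation P := (@aw_perm k F n).
Notation C := (aw_cst F n).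
Notation W := {ffun 'S_n -> A}.
Implicit Types (g : W) (a b c : A).
Notation Pol := (@aw_sub_pred k F n [set 1%g]).

Lemma aw_sub_cst (K : {set 'S_n}) x : C x \in aw_sub_pred K.
Proof. by apply/aw_subP/ps_cst. Qed.
Lemma aw_sub_x (K : {set 'S_n}) i : X i \in aw_sub_pred K.
Proof. by apply/aw_subP/ps_gen/sg_x. Qed.
Lemma aw_sub_ten (K : {set 'S_n}) f : T f \in aw_sub_pred K.
Proof. by apply/aw_subP/ps_gen/sg_ten. Qed.
Lemma aw_sub_perm (K : {set 'S_n}) s : s \in K -> P s \in aw_sub_pred (F := F) K.
Proof. by move=> sK; apply/aw_subP/ps_gen/sg_perm. Qed.
Lemma aw_sub_t (K : {set 'S_n}) i j : aw_t F i j \in aw_sub_pred K.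
Proof. by apply: rpred_sum => b _; apply: rpredM; apply: aw_sub_ten. Qed.
Lemma aw_sub_conj (K : {set 'S_n}) w f : conj_ten w f \in aw_sub_pred K.
Proof. by rewrite (conj_tenE HF); apply: rpred_prod => i _; apply: aw_sub_ten. Qed.

Lemma aw_sub_ind (K : {set 'S_n}) (Q : A -> Prop) :
  (forall f, Q (T f)) -> (forall i, Q (X i)) -> (forall s, s \in K -> Q (P s)) ->
  (forall x, Q (C x)) -> (forall a b, Q a -> Q b -> Q (a - b)) ->
  (forall a b, a \in aw_sub_pred K -> b \in aw_sub_pred K ->
     Q a -> Q b -> Q (a * b)) ->
  forall a, a \in aw_sub_pred K -> Q a.
Proof.
move=> QT QX QP QC QB QM a /aw_subP; elim=> {a} [a []|x|a b _ Qa _ Qb|a b Ka Qa Kb Qb] //.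
- exact: QC.
- exact: QB.
- by apply: QM => //; apply/aw_subP.
Qed.

Lemma pol_sub (K : {group 'S_n}) a : a \in Pol -> a \in aw_sub_pred K.
Proof. by apply: aw_sub_mono; rewrite sub1set group1. Qed.

Definition point v a : W := [ffun w => if w == v then a else 0].

Lemma point_sum g : g = \sum_v point v (g v).
Proof.
apply/ffunP => w; rewrite sum_ffunE (bigD1 w) //= !ffunE eqxx big1 ?addr0 // => v vw.
by rewrite ffunE eq_sym (negbTE vw).
Qed.

(** Reading a function as a combination of permutations gives an A-linear
  map to A. Together with the action it provides existence and uniqueness of
  the expansion along permutations. *)
Definition assemble g : A := \sum_w P w * g w.

Lemma assembleD : {morph assemble : g h / g + h}.
Proof.
by move=> g h; rewrite /assemble -big_split; apply: eq_bigr => w _; rewrite ffunE mulrDr.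
Qed.
Lemma assemble0 : assemble 0 = 0.
Proof. by rewrite /assemble big1 // => w _; rewrite ffunE mulr0. Qed.
Lemma assembleN g : assemble (- g) = - assemble g.
Proof. by apply: (addIr (assemble g)); rewrite -assembleD !addNr assemble0. Qed.

Lemma assemble_point v a : assemble (point v a) = P v * a.
Proof.
rewrite /assemble (bigD1 v) //= ffunE eqxx big1 ?addr0 // => w wv.
by rewrite ffunE (negbTE wv) mulr0.
Qed.

Lemma assemble_opP s g : assemble (opP s g) = P s * assemble g.
Proof.
rewrite /assemble (reindex_inj (mulIg s)) mulr_sumr; apply: eq_bigr => w _.
by rewrite ffunE mulgK mulrA aw_permM.
Qed.

Lemma assemble_opT f g : assemble (opT f g) = T f * assemble g.
Proof.
rewrite /assemble mulr_sumr; apply: eq_bigr => w _.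
by rewrite ffunE /conj_ten !mulrA aw_permV mul1r.
Qed.

Lemma assemble_op_t i j g : assemble (op_t i j g) = aw_t F i j * assemble g.
Proof.
rewrite /assemble mulr_sumr; apply: eq_bigr => w _.
by rewrite ffunE mulrA (aw_perm_t HF) !permKV mulrA.
Qed.

Lemma opP_point s v a : opP s (point v a) = point (v * s)%g a.
Proof.
by apply/ffunP => w; rewrite !ffunE (can2_eq (mulgKV s) (mulgK s)).
Qed.

Lemma noninverted_tperm1 i j : noninverted (tperm i j) i j = false.
Proof.
apply/negP => /andP [ji]; rewrite tpermV tpermL tpermR.
have := ord_neq ji; case: ltngtP => //.
Qed.

Lemma opX_point1 i a : opX i (point 1%g a) = point 1%g (X i * a).
Proof.
apply/ffunP => w; rewrite !ffunE big1 ?addr0 => [|j nij].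
  by case: eqP => [->|]; rewrite ?invg1 ?perm1 ?mulr0.
rewrite ffunE; case: eqP => [e|]; last by rewrite !mulr0.
have ew : w = tperm i j by rewrite -[w](mulgK (tperm i j)) e mul1g tpermV.
by move: nij; rewrite ew noninverted_tperm1.
Qed.

(** This is the straightening formula for x_i w in A. It is proved by
  induction on w, from the matching exchange relations with simple
  transpositions on both sides. *)
Lemma assemble_opX i g : assemble (opX i g) = X i * assemble g.
Proof.
rewrite (point_sum g) (big_morph _ (@opXD k F n i) (@opX0 k F n i)).
rewrite !(big_morph _ assembleD assemble0) mulr_sumr; apply: eq_bigr => v _.
move: (g v) => a {g}; have vT : v \in [set: 'S_n]%G by rewrite inE.
move: i a; move: v vT; apply: parabolic_ind_r => [s p q _ _ _|i a|].
- by rewrite inE.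
- by rewrite opX_point1 !assemble_point aw_perm1 !mul1r.
move=> s v /simpleP [l [l' [e ->]]] _ _ IH i a.
set r := tperm l l'; rewrite -opP_point; set g := point v a.
have := opP_X (r i) g e; rewrite -/r /r tpermK -/r => H.
have := congr1 assemble H; rewrite assembleD !assemble_opP IH => H'.
have := aw_skein HF (r i) e; rewrite /r tpermK -/r => sk.
have -> : assemble (opX i (opP r g)) =
    P r * (X (r i) * assemble g) - assemble (op_skein l l' (r i) g).
  by rewrite H' addrK.
rewrite mulrA sk mulrDl mulrA -addrA -[RHS]addr0; congr (_ + _).
rewrite /op_skein /skein_term; case: ifP => _.
  by rewrite assembleN assemble_op_t mulNr addrN.
by case: ifP => _; rewrite ?assemble_op_t ?assemble0 ?mul0r subrr.
Qed.

Lemma assemble_act a g : assemble (aw_act a g) = a * assemble g.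
Proof.
rewrite /aw_act -[in RHS](palg_reprK a); move: (palg_repr a) => x.
elim: x g => [z|[i|f|s]|x IHx y IHy|x IHx y IHy] g /=.
- rewrite /assemble mulr_sumr; apply: eq_bigr => w _.
  by rewrite ffunE mulrA -aw_cstC -mulrA.
- exact: assemble_opX.
- exact: assemble_opT.
- exact: assemble_opP.
- by rewrite assembleD IHx IHy to_palgD mulrDl.
- by rewrite IHx IHy to_palgM mulrA.
Qed.

(** Applying a to the function concentrated at 1 with value 1 reads off the
  coefficients of a in the decomposition of A as the direct sum of the w P,
  with P the subalgebra generated by the tensors and the x_i. *)
Definition aw_coef a : W := aw_act a (point 1%g 1).

Lemma aw_act0 g : aw_act (0 : A) g = 0.
Proof. by apply: (addIr (aw_act (0 : A) g)); rewrite -(aw_act_add HF) !add0r. Qed.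
Lemma aw_actN a g : aw_act (- a) g = - aw_act a g.
Proof. by apply: (addIr (aw_act a g)); rewrite -(aw_act_add HF) !addNr aw_act0. Qed.
Lemma aw_act1 g : aw_act (1 : A) g = g.
Proof.
rewrite -(aw_cst1 F n) (aw_act_cst HF); apply/ffunP => w.
by rewrite ffunE aw_cst1 mul1r.
Qed.

Lemma aw_coefD : {morph aw_coef : a b / a + b}.
Proof. by move=> a b; apply: aw_act_add. Qed.
Lemma aw_coef0 : aw_coef 0 = 0. Proof. exact: aw_act0. Qed.

Lemma aw_coef1 : aw_coef 1 = point 1%g 1. Proof. exact: aw_act1. Qed.

(** Apply the A-linear map [assemble] to the definition of the coefficients. *)
Lemma aw_coef_expand a : a = \sum_w P w * aw_coef a w.
Proof.
by rewrite -[LHS]mulr1 -(aw_perm1 F n) -[P 1%g]mulr1 -assemble_point -assemble_act.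
Qed.

Lemma aw_coefM a b : aw_coef (a * b) = aw_act a (aw_coef b).
Proof. exact: aw_act_mul. Qed.

Lemma aw_coef_permM v a w : aw_coef (P v * a) w = aw_coef a (w * v^-1)%g.
Proof. by rewrite aw_coefM (aw_act_perm HF) ffunE. Qed.

Lemma aw_coef_pol a w : aw_coef a w \in Pol.
Proof.
rewrite /aw_coef /aw_act; move: (palg_repr a) => x; move: w.
have : forall w, point 1%g 1 w \in Pol.
  by move=> w; rewrite ffunE; case: ifP => _; [exact: rpred1|exact: rpred0].
move: (point _ _); elim: x => [z|[i|f|s]|x IHx y IHy|x IHx y IHy] g Hg w /=.
- by rewrite ffunE rpredM // aw_sub_cst.
- rewrite ffunE rpredD // ?rpredM ?aw_sub_x // rpred_sum // => j _.
  by rewrite rpredM ?rpredM ?rpredX ?rpredN ?rpred1 // aw_sub_t.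
- by rewrite ffunE rpredM // aw_sub_conj.
- by rewrite ffunE.
- by rewrite ffunE rpredD // ?IHx // IHy.
- by apply: IHx => w'; apply: IHy.
Qed.

(** Stability under the straightening of x_i w. *)
Definition lower_closed (Z : {set 'S_n}) := forall w i j, w \in Z ->
  (perm_length (w * tperm i j)%g < perm_length w)%N -> (w * tperm i j)%g \in Z.

Definition supported (Z : {set 'S_n}) a := forall w, w \notin Z -> aw_coef a w = 0.

Lemma inversion_closed_lower (K : {group 'S_n}) : inversion_closed K -> lower_closed K.
Proof.
move=> Kinv w i j wK lt; apply: groupM => //.
wlog ij : i j lt / (i < j)%N.
  move=> H; case: (ltngtP i j) => [|ji|/val_inj ->].
  - exact: H.
  - by rewrite tpermC; apply: H => //; rewrite tpermC.
  - by rewrite tperm1 group1.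
apply: (Kinv w^-1%g) => //; first by rewrite groupV.
have := length_mul_tperm w ij; rewrite ltnNge (ltnW lt) /= ltnNge => /esym /negbFE.
rewrite leq_eqVlt => /orP [/eqP /val_inj /perm_inj e|//].
by move: ij; rewrite e ltnn.
Qed.

Lemma noninverted_length w i j : noninverted w i j ->
  (perm_length w < perm_length (w * tperm i j)%g)%N.
Proof.
case/andP=> ji /eqP; have := ord_neq ji; rewrite neq_ltn => /orP [lt|lt] nij.
  rewrite tpermC length_mul_tperm //; move: nij.
  have -> : (i < j)%N = false by apply/negbTE; rewrite -leqNgt ltnW.
  move/esym/negbT; rewrite -leqNgt leq_eqVlt => /orP [/eqP /val_inj /perm_inj e|//].
  by move: lt; rewrite e ltnn.
by rewrite length_mul_tperm // -nij.
Qed.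

(** Each generator of the subalgebra moves the support inside Z: the tensors
  preserve it, the x_i only add shorter elements obtained by removing an
  inversion, and permutations in K act by translation. *)
Lemma aw_act_supp (K Z : {set 'S_n}) a g : lower_closed Z ->
  (forall w h, w \in Z -> h \in K -> (w * h)%g \in Z) ->
  a \in aw_sub_pred K ->
  (forall w, w \notin Z -> g w = 0) -> forall w, w \notin Z -> aw_act a g w = 0.
Proof.
move=> Zlow ZK aK; move: a aK g.
apply: aw_sub_ind => [f|i|s sK|x|a a' IH IH'|a a' _ _ IH IH'] g Hg w wZ.
- by rewrite (aw_act_ten HF) ffunE Hg // mulr0.
- rewrite (aw_act_x HF) ffunE Hg // mulr0 add0r big1 // => j nij.
  rewrite Hg ?mulr0 //; apply: contra wZ => wZ.
  have := Zlow _ i j wZ; rewrite -mulgA tperm2 mulg1; apply; exact: noninverted_length.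
- rewrite (aw_act_perm HF) ffunE Hg //; apply: contra wZ => wZ.
  by have := ZK _ s wZ sK; rewrite mulgKV.
- by rewrite (aw_act_cst HF) ffunE Hg // mulr0.
- by rewrite (aw_act_add HF) aw_actN !ffunE IH // IH' // subr0.
- by rewrite (aw_act_mul HF); apply: IH => // w'; apply: IH'.
Qed.

Lemma supported_left (K Z : {set 'S_n}) a b : lower_closed Z ->
  (forall w h, w \in Z -> h \in K -> (w * h)%g \in Z) ->
  a \in aw_sub_pred K -> supported Z b -> supported Z (a * b).
Proof. by move=> Zl ZK aK bZ w wZ; rewrite aw_coefM; exact: (aw_act_supp Zl ZK aK bZ wZ). Qed.

Lemma supportedB (Z : {set 'S_n}) a b :
  supported Z a -> supported Z b -> supported Z (a - b).
Proof.
move=> aZ bZ w wZ; rewrite /aw_coef (aw_act_add HF) aw_actN !ffunE.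
by rewrite [_ w]aZ // [aw_act b _ w]bZ // subr0.
Qed.

Lemma supported_perm (Z : {set 'S_n}) v : v \in Z -> supported Z (P v).
Proof.
move=> vZ w wZ; rewrite -[P v]mulr1 aw_coef_permM aw_coef1 ffunE.
case: eqP => // e; move: wZ; have -> : w = v by rewrite -[w](mulgKV v) e mul1g.
by rewrite vZ.
Qed.

(** The leading term of x_i v is v x_{v^{-1}(i)}. *)
Lemma supported_x_perm (Z : {set 'S_n}) v i :
  (forall j, (perm_length (v * tperm i j)%g < perm_length v)%N ->
     (v * tperm i j)%g \in Z) ->
  supported Z (X i * P v - P v * X ((v^-1)%g i)).
Proof.
move=> vZ w wZ; rewrite aw_coefD.
have -> : aw_coef (- (P v * X ((v^-1)%g i))) = - aw_coef (P v * X ((v^-1)%g i)).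
  exact: aw_actN.
have -> : aw_coef (P v * X ((v^-1)%g i)) = point v (X ((v^-1)%g i)).
  rewrite aw_coefM -[X _]mulr1 aw_coefM aw_coef1 (aw_act_x HF) opX_point1.
  by rewrite (aw_act_perm HF) opP_point mul1g mulr1.
rewrite aw_coefM.
have -> : aw_coef (P v) = point v 1.
  by rewrite -[P v]mulr1 aw_coefM aw_coef1 (aw_act_perm HF) opP_point mul1g.
rewrite (aw_act_x HF) !ffunE big1.
  by rewrite addr0; case: eqP => [->|_]; rewrite ?mulr1 ?mulr0 subrr.
move=> j nij; rewrite ffunE; case: eqP => [e|_]; last by rewrite !mulr0.
have wE : w = (v * tperm i j)%g by rewrite -e -mulgA tperm2 mulg1.
by move: wZ; rewrite wE vZ // -wE -e; apply: noninverted_length.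
Qed.

Lemma sub_supported (K : {group 'S_n}) a : inversion_closed K ->
  a \in aw_sub_pred K -> supported K a.
Proof.
move=> Kinv aK; rewrite -[a]mulr1 -(aw_perm1 F n).
apply: (supported_left (K := K)) => //.
- exact: inversion_closed_lower.
- by move=> w h wK hK; apply: groupM.
- exact/supported_perm/group1.
Qed.

Lemma supported_right (K : {group 'S_n}) (Z : {set 'S_n}) a b : inversion_closed K ->
  (forall w h, w \in Z -> h \in K -> (h * w)%g \in Z) ->
  b \in aw_sub_pred K -> supported Z a -> supported Z (a * b).
Proof.
move=> Kinv ZK bK aZ w wZ; rewrite {1}(aw_coef_expand a) mulr_suml.
rewrite (big_morph _ aw_coefD aw_coef0) sum_ffunE big1 // => v _.
have [vZ|vZ] := boolP (v \in Z); last by rewrite aZ // mulr0 mul0r aw_coef0 ffunE.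
rewrite -mulrA aw_coef_permM (sub_supported Kinv) //.
  by rewrite rpredM // pol_sub // aw_coef_pol.
by apply: contra wZ => wv; have := ZK _ _ vZ wv; rewrite mulgKV.
Qed.

(** The coefficient a_w in A_K for the decomposition a = sum of the w a_w
  over the left cosets of K. The formula makes sense for every w, so that no
  choice of coset representatives enters. *)
Definition coset_coef (K : {group 'S_n}) w a : A :=
  \sum_(v | (v * w^-1)%g \in K) P (v * w^-1)%g * aw_coef a v.

Section CosetCoef.
Variable K : {group 'S_n}.
Hypothesis Kinv : inversion_closed K.

Lemma coset_coef_sub w a : coset_coef K w a \in aw_sub_pred K.
Proof.
by apply: rpred_sum => v vw; rewrite rpredM ?aw_sub_perm // pol_sub // aw_coef_pol.
Qed.

Lemma coset_coefD w : {morph coset_coef K w : a b / a + b}.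
Proof.
move=> a b; rewrite /coset_coef -big_split; apply: eq_bigr => v _ /=.
by rewrite aw_coefD ffunE mulrDr.
Qed.
Lemma coset_coef0 w : coset_coef K w 0 = 0.
Proof. by apply: (addIr (coset_coef K w 0)); rewrite -coset_coefD !add0r. Qed.

Lemma coset_coef_permM w v c : c \in aw_sub_pred K ->
  coset_coef K w (P v * c) =
  if (v * w^-1)%g \in K then P (v * w^-1)%g * c else 0.
Proof.
move=> cK; have supp := sub_supported Kinv cK.
rewrite /coset_coef; case: ifPn => [vwK|nvwK]; last first.
  rewrite big1 // => u uwK; rewrite aw_coef_permM supp ?mulr0 //.
  apply: contra nvwK => uvK; have := groupM (groupVr uvK) uwK.
  by rewrite invMg invgK -mulgA mulKg.
rewrite {2}(aw_coef_expand c) mulr_sumr (reindex_inj (mulIg v)) big_mkcond /=.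
apply: eq_bigr => h _; rewrite aw_coef_permM mulgK -mulgA groupMr // mulrA aw_permM.
by case: ifPn => // hK; rewrite supp ?mulr0.
Qed.

(** Right linearity over A_K is what makes the coefficients descend to
  induced modules. *)
Lemma coset_coefM w a b : b \in aw_sub_pred K ->
  coset_coef K w (a * b) = coset_coef K w a * b.
Proof.
move=> bK; rewrite {1}(aw_coef_expand a) mulr_suml.
rewrite (big_morph _ (coset_coefD w) (coset_coef0 w)) {2}/coset_coef mulr_suml.
rewrite [RHS]big_mkcond; apply: eq_bigr => v _.
rewrite -mulrA coset_coef_permM; last by rewrite rpredM // pol_sub // aw_coef_pol.
by case: ifP => // _; rewrite mulrA.
Qed.

Lemma coset_coef_supported (Z : {set 'S_n}) w a :
  (forall w h, w \in Z -> h \in K -> (h * w)%g \in Z) ->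
  supported Z a -> w \notin Z -> coset_coef K w a = 0.
Proof.
move=> ZK aZ wZ; rewrite /coset_coef big1 // => v vwK; rewrite aZ ?mulr0 //.
apply: contra wZ => vZ; have := ZK _ _ vZ (groupVr vwK).
by rewrite invMg invgK mulgKV.
Qed.

End CosetCoef.

Lemma aw_homN d p a : aw_hom d p a -> aw_hom d p (- a).
Proof. by move=> ha; rewrite -sub0r; apply: ah_sub => //; apply: ah_zero. Qed.
Lemma aw_homD d p a b : aw_hom d p a -> aw_hom d p b -> aw_hom d p (a + b).
Proof. by move=> ha hb; rewrite -[b]opprK; apply: ah_sub => //; apply: aw_homN. Qed.
Lemma aw_hom_sum d p (I : finType) (Q : pred I) (G : I -> A) :
  (forall t, Q t -> aw_hom d p (G t)) -> aw_hom d p (\sum_(i | Q i) G i).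
Proof.
by move=> H; elim/big_ind: _ => //; [exact: ah_zero|move=> ? ?; exact: aw_homD].
Qed.
Lemma aw_hom1 : aw_hom 0 false (1 : A).
Proof. by rewrite -(aw_cst1 F n); apply: ah_cst. Qed.

Lemma aw_hom_t i j : aw_hom (fdeg F)%:Z false (aw_t F i j).
Proof.
apply: aw_hom_sum => b _.
have := ah_mul (ah_ten i (fb_hom HF b)) (ah_ten j (fbv_hom HF b)).
by rewrite addrC subrK addbb.
Qed.

(** The generators act homogeneously; for x_i this uses that t_{i,j} has
  degree delta and even parity. *)
Lemma aw_hom_act d p a e q g : aw_hom d p a -> (forall w, aw_hom e q (g w)) ->
  forall w, aw_hom (d + e) (p (+) q) (aw_act a g w).
Proof.
move=> ha; elim: ha e q g => {d p a} [d p|d p a b _ IHa _ IHb|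
  d p d' p' a b _ IHa _ IHb|x|i|d p i f hf|s] e q g Hg w.
- by rewrite aw_act0 ffunE; apply: ah_zero.
- by rewrite (aw_act_add HF) aw_actN !ffunE; apply: ah_sub; [apply: IHa|apply: IHb].
- by rewrite (aw_act_mul HF) -addrA -addbA; apply: IHa => w'; apply: IHb.
- by rewrite (aw_act_cst HF) ffunE; apply: ah_mul (Hg w); apply: ah_cst.
- rewrite (aw_act_x HF) ffunE; apply: aw_homD; first by apply: ah_mul (Hg w); apply: ah_x.
  apply: aw_hom_sum => j _; rewrite mulr_sign.
  have H := ah_mul (aw_hom_t (w^-1%g j) (w^-1%g i)) (Hg (w * tperm i j)%g).
  by case: ifP => // _; apply: aw_homN.
- rewrite (aw_act_ten HF) ffunE (conj_slot HF); apply: ah_mul (Hg w).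
  exact: ah_ten.
- by rewrite (aw_act_perm HF) ffunE add0r addFb.
Qed.

Lemma aw_hom_coef d p a w : aw_hom d p a -> aw_hom d p (aw_coef a w).
Proof.
move=> ha; rewrite -[d]addr0 -[p]addbF; apply: (aw_hom_act ha) => v.
by rewrite ffunE; case: ifP => _; [exact: aw_hom1|exact: ah_zero].
Qed.

Lemma aw_hom_coset_coef (K : {group 'S_n}) d p a w :
  aw_hom d p a -> aw_hom d p (coset_coef K w a).
Proof.
move=> ha; apply: aw_hom_sum => v _; rewrite -[d]add0r -[p]addFb.
by apply: ah_mul; [exact: ah_perm|exact: aw_hom_coef].
Qed.

End Coefficients.

(** * Induced modules *)

Section Pure.
Variables (R S : pzRingType) (phi : {rmorphism R -> S}) (V : lmodType R).
Implicit Types (a b s : S) (r : R) (v w : V).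

Lemma pureDl a b v : pure phi (a + b) v = pure phi a v + pure phi b v.
Proof. by rewrite ind_addE -to_indD; apply/to_indP; apply: te_Dl. Qed.
Lemma pureDr a v w : pure phi a (v + w) = pure phi a v + pure phi a w.
Proof. by rewrite ind_addE -to_indD; apply/to_indP; apply: te_Dr. Qed.
Lemma pure0l v : pure phi 0 v = 0.
Proof. by apply: (addIr (pure phi 0 v)); rewrite -pureDl !add0r. Qed.
Lemma pure0r a : pure phi a (0 : V) = 0.
Proof. by apply: (addIr (pure phi a 0)); rewrite -pureDr !add0r. Qed.
Lemma pureNl a v : pure phi (- a) v = - pure phi a v.
Proof. by apply: (addIr (pure phi a v)); rewrite -pureDl !addNr pure0l. Qed.
Lemma pure_bal a r v : pure phi (a * phi r) v = pure phi a (r *: v).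
Proof. by apply/to_indP; apply: te_bal. Qed.
Lemma pureZ s a v : s *: pure phi a v = pure phi (s * a) v.
Proof. by rewrite /pure -[LHS]to_indZ. Qed.
Lemma pure_suml (I : Type) (t : seq I) (Q : pred I) (G : I -> S) v :
  pure phi (\sum_(i <- t | Q i) G i) v = \sum_(i <- t | Q i) pure phi (G i) v.
Proof. exact: (big_morph (pure phi ^~ v) (fun a b => pureDl a b v) (pure0l v)). Qed.

Lemma ind_elim (Q : ind_type phi V -> Prop) : (forall a v, Q (pure phi a v)) ->
  (forall x y, Q x -> Q y -> Q (x + y)) -> forall x, Q x.
Proof.
move=> Qp QD; elim/ind_typeP; elim=> [|[a v] x IH].
  by have := Qp 0 0; rewrite pure0r.
by rewrite -cat1s to_indD; apply: QD => //; apply: Qp.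
Qed.

Section Lift.
Variables (Z : zmodType) (f : S -> V -> Z).
Hypothesis fDl : forall a b v, f (a + b) v = f a v + f b v.
Hypothesis fDr : forall a v w, f a (v + w) = f a v + f a w.
Hypothesis fbal : forall a r v, f (a * phi r) v = f a (r *: v).

(** The universal property of the tensor product: a balanced biadditive map
  extends additively. The value is computed on a chosen representative. *)
Definition ind_lift (x : ind_type phi V) : Z :=
  \sum_(av <- ind_repr x) f av.1 av.2.

Let lift_eq x y : tens_eq phi x y ->
  \sum_(av <- x) f av.1 av.2 = \sum_(av <- y) f av.1 av.2.
Proof.
have f0 v : f 0 v = 0 by apply: (addIr (f 0 v)); rewrite -fDl !add0r.
elim=> {x y} [x|x y _ ->|y x z _ -> _ ->|x x' y y' _ E1 _ E2|x y|v|a b v|a v w|a r v] //.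
- by rewrite !big_cat E1 E2.
- by rewrite !big_cat /= addrC.
- by rewrite big_seq1 big_nil f0.
- by rewrite !big_cons !big_nil /= !addr0 fDl.
- by rewrite !big_cons !big_nil /= !addr0 fDr.
- by rewrite !big_seq1 /= fbal.
Qed.

Lemma ind_lift_pure a v : ind_lift (pure phi a v) = f a v.
Proof. by rewrite /ind_lift (lift_eq (ind_repr_eq _ _)) big_seq1. Qed.

Lemma ind_liftD : {morph ind_lift : x y / x + y}.
Proof.
elim/ind_typeP => x; elim/ind_typeP => y; rewrite ind_addE -to_indD.
by rewrite /ind_lift !(lift_eq (ind_repr_eq _ _)) big_cat.
Qed.

Lemma ind_lift0 : ind_lift 0 = 0.
Proof. by apply: (addIr (ind_lift 0)); rewrite -ind_liftD !add0r. Qed.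
Lemma ind_liftN x : ind_lift (- x) = - ind_lift x.
Proof. by apply: (addIr (ind_lift x)); rewrite -ind_liftD !addNr ind_lift0. Qed.

End Lift.

Lemma ind_lift_linear (Z : lmodType S) (f : S -> V -> Z)
    (fDl : forall a b v, f (a + b) v = f a v + f b v)
    (fDr : forall a v w, f a (v + w) = f a v + f a w)
    (fbal : forall a r v, f (a * phi r) v = f a (r *: v)) :
  (forall s a v, f (s * a) v = s *: f a v) -> linear (ind_lift f).
Proof.
move=> fZ s x y; rewrite ind_liftD //; congr (_ + _).
elim/ind_elim: x => [a v|x x' IH IH']; first by rewrite pureZ !ind_lift_pure.
by rewrite scalerDr !ind_liftD // IH IH' scalerDr.
Qed.

(** An element of K is a representative times an element of L, and the
  latter can be moved to the other side of the tensor sign. *)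
Lemma ind_span (gT : finGroupType) (L K : {group gT}) (g : gT -> S) (h : gT -> R) :
  L \subset K ->
  (forall a, exists p : gT -> R, a = \sum_(v in (K : {set gT})) g v * phi (p v)) ->
  (forall l (v : gT), l \in L -> v \in K -> g (l * v)%g = g v * phi (h l)) ->
  forall x : ind_type phi V, exists m : gT -> V,
    x = \sum_(v : gT | (v \in K) && (repr (L :* v)%g == v)) pure phi (g v) (m v).
Proof.
move=> sLK span gL.
pose Q x := exists m : gT -> V,
  x = \sum_(v : gT | (v \in K) && (repr (L :* v)%g == v)) pure phi (g v) (m v).
have QD x y : Q x -> Q y -> Q (x + y).
  move=> [m ->] [m' ->]; exists (fun v : gT => m v + m' v).
  by rewrite -big_split; apply: eq_bigr => v _; rewrite pureDr.
have Q0 : Q 0 by exists (fun=> 0); rewrite big1 // => v _; rewrite pure0r.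
apply: (ind_elim (Q := Q)) => // a m; have [p ->] := span a.
rewrite pure_suml; elim/big_ind: _ => // v vK.
rewrite pure_bal; move: (p v *: m) => {}m.
have := mem_repr_rcoset L v; set r := repr _ => /rcosetP [l lL er].
have rK : r \in K by rewrite er groupM // (subsetP sLK).
have vE : v = (l^-1 * r)%g by rewrite er mulKg.
have rr : repr (L :* r)%g = r by rewrite /r rcoset_repr.
(* A single summand: v is replaced by the representative r of its coset. *)
exists (fun w : gT => if w == r then h l^-1%g *: m else 0).
rewrite (bigD1 r) /=; last by rewrite rK rr eqxx.
rewrite eqxx big1 ?addr0 => [|w /andP [_ /negbTE ->]]; last exact: pure0r.
by rewrite {1}vE gL ?groupV // pure_bal.
Qed.

End Pure.

Section Coordinates.
Variables (k : comNzRingType) (F : frobData k) (n : nat).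
Hypothesis HF : is_frobenius F.
Variable K : {group 'S_n}.
Hypothesis Kinv : inversion_closed K.
Variable M : hmod (AWsub F K).
Implicit Types (u v w : 'S_n) (m : M) (a : aw F n).
Notation P := (@aw_perm k F n).
Notation val := (aw_val (H := K)).

Definition sub_elt (a : aw F n) (aK : a \in aw_sub_pred K) : AWsub F K := Sub a aK.

Lemma sub_eltK a (aK : a \in aw_sub_pred K) : aw_val (sub_elt aK) = a.
Proof. exact: SubK. Qed.

Lemma aw_val_inj : injective (val : AWsub F K -> aw F n).
Proof. exact: val_inj. Qed.

Lemma aw_val_sub (b : AWsub F K) : aw_val b \in aw_sub_pred K.
Proof. exact: valP. Qed.

Definition perm_elt w : AWsub F K := insubd (1 : aw_sub F K) (P w).

Lemma perm_eltK w : w \in K -> aw_val (perm_elt w) = P w.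
Proof. by move=> wK; exact: (insubdK (1 : aw_sub F K) (aw_sub_perm F wK)). Qed.

Definition coset_comp w a m : M := sub_elt (coset_coef_sub HF K w a) *: m.

Lemma coset_compDl w a b m : coset_comp w (a + b) m = coset_comp w a m + coset_comp w b m.
Proof.
rewrite /coset_comp -scalerDl; congr (_ *: _); apply: aw_val_inj.
by rewrite rmorphD !sub_eltK coset_coefD.
Qed.
Lemma coset_compDr w a m m' : coset_comp w a (m + m') = coset_comp w a m + coset_comp w a m'.
Proof. by rewrite /coset_comp scalerDr. Qed.
Lemma coset_comp_bal w a (r : AWsub F K) m :
  coset_comp w (a * aw_val r) m = coset_comp w a (r *: m).
Proof.
rewrite /coset_comp scalerA; congr (_ *: _); apply: aw_val_inj.
by rewrite rmorphM !sub_eltK coset_coefM // aw_val_sub.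
Qed.

(** The coordinate m_w in the expansion of an element of the induced module
  as a sum of w (x) m_w over left cosets; like the coefficients, it is
  defined for every w. *)
Definition ind_coord w : ind_type val M -> M := ind_lift (coset_comp w).

Lemma ind_coordD w : {morph ind_coord w : x y / x + y}.
Proof. exact: (ind_liftD (coset_compDl w) (coset_compDr w) (coset_comp_bal w)). Qed.
Lemma ind_coord0 w : ind_coord w 0 = 0.
Proof. by apply: (addIr (ind_coord w 0)); rewrite -ind_coordD !add0r. Qed.
Lemma ind_coordN w x : ind_coord w (- x) = - ind_coord w x.
Proof. by apply: (addIr (ind_coord w x)); rewrite -ind_coordD !addNr ind_coord0. Qed.
Lemma ind_coord_sum w (I : Type) (t : seq I) (Q : pred I) (G : I -> ind_type val M) :
  ind_coord w (\sum_(i <- t | Q i) G i) = \sum_(i <- t | Q i) ind_coord w (G i).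
Proof. exact: (big_morph _ (ind_coordD w) (ind_coord0 w)). Qed.

Lemma ind_coord_pure w a m : ind_coord w (pure val a m) = coset_comp w a m.
Proof. exact: (ind_lift_pure (coset_compDl w) (coset_compDr w) (coset_comp_bal w)). Qed.

Lemma coset_comp0 w a m : coset_coef K w a = 0 -> coset_comp w a m = 0.
Proof.
move=> e; rewrite /coset_comp (_ : sub_elt _ = 0) ?scale0r //; apply: aw_val_inj.
by rewrite sub_eltK e rmorph0.
Qed.

Lemma ind_coord_perm w m : ind_coord w (pure val (P w) m) = m.
Proof.
rewrite ind_coord_pure /coset_comp (_ : sub_elt _ = 1) ?scale1r //; apply: aw_val_inj.
rewrite sub_eltK rmorph1 -[P w]mulr1 (coset_coef_permM HF Kinv) ?rpred1 //.
by rewrite mulgV group1 aw_perm1 mul1r.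
Qed.

Lemma ind_coord_perm_off w v m : (v * w^-1)%g \notin K ->
  ind_coord w (pure val (P v) m) = 0.
Proof.
move=> vw; rewrite ind_coord_pure coset_comp0 //.
by rewrite -[P v]mulr1 (coset_coef_permM HF Kinv) ?rpred1 // (negbTE vw).
Qed.

Lemma ind_coord_supported (Z : {set 'S_n}) w a m :
  (forall w h, w \in Z -> h \in K -> (h * w)%g \in Z) ->
  supported Z a -> w \notin Z -> ind_coord w (pure val a m) = 0.
Proof.
by move=> ZK aZ wZ; rewrite ind_coord_pure coset_comp0 // (coset_coef_supported ZK).
Qed.

Lemma ind_coord_hom w d p x : graded_module M ->
  ind_hom d p x -> mhom d p (ind_coord w x).
Proof.
move=> [grM actM]; elim=> {d p x} [d p|d p x y _ Hx _ Hy|d p e q a m ha hm].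
- by rewrite ind_coord0; apply: gr_zero.
- by rewrite ind_coordD ind_coordN; apply: gr_sub.
rewrite ind_coord_pure; apply: actM => //.
exact: (@aw_hom_coset_coef k F n HF K d p a w ha).
Qed.

Lemma ind_perm_span (x : ind_type val M) : exists m : 'S_n -> M,
  x = \sum_(v | repr (K :* v)%g == v) pure val (P v) (m v).
Proof.
have [|||m ->] := @ind_span _ _ val M _ K [set: 'S_n]%G P
  perm_elt _ _ _ x.
- exact: subsetT.
- move=> a; exists (fun w => sub_elt (pol_sub K (aw_coef_pol HF a w))).
  rewrite {1}(aw_coef_expand HF a); apply: eq_big => [v|v _]; first by rewrite inE.
  by congr (_ * _); exact: esym (sub_eltK _).
- move=> l v lK _; rewrite -aw_permM; congr (_ * _).
  exact: esym (perm_eltK lK).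
by exists m; apply: eq_bigl => v; rewrite inE.
Qed.

Lemma ind_coord_reps (m : 'S_n -> M) w : repr (K :* w)%g = w ->
  ind_coord w (\sum_(v | repr (K :* v)%g == v) pure val (P v) (m v)) = m w.
Proof.
move=> rw; rewrite ind_coord_sum (bigD1 w) /=; last by rewrite rw.
rewrite ind_coord_perm big1 ?addr0 // => v /andP [/eqP rv vw].
rewrite ind_coord_perm_off //; apply: contra vw => vwK.
by apply/eqP; rewrite -rv -rw; congr repr; apply: rcoset_eqP; rewrite mem_rcoset.
Qed.

Lemma ind_coord_expand (x : ind_type val M) :
  x = \sum_(v | repr (K :* v)%g == v) pure val (P v) (ind_coord v x).
Proof.
have [m e] := ind_perm_span x; rewrite {1}e; apply: eq_bigr => v /eqP rv.
by rewrite e ind_coord_reps.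
Qed.

End Coordinates.

Section SubalgebraSpan.
Variables (k : comNzRingType) (F : frobData k) (n : nat).
Hypothesis HF : is_frobenius F.
Variables (L H : {group 'S_n}) (sLH : L \subset H).
Hypothesis Hinv : inversion_closed H.
Variable V : lmodType (AWsub F L).

(** Induction from a subalgebra to the subalgebra of a parabolic subgroup H:
  the elements of A_H only involve permutations in H. *)
Lemma sub_ind_span (x : ind_type (aw_incl F sLH) V) : exists m : 'S_n -> V,
  x = \sum_(v | (v \in H) && (repr (L :* v)%g == v))
        pure (aw_incl F sLH) (perm_elt F H v) (m v).
Proof.
have key l : l \in L -> aw_incl F sLH (perm_elt F L l) = perm_elt F H l.
  move=> lL; apply: val_inj; transitivity (aw_perm F l); first exact: perm_eltK.
  by apply/esym/perm_eltK/(subsetP sLH).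
apply: (@ind_span _ _ _ V _ L H (perm_elt F H) (perm_elt F L)) => //.
- move=> a; exists (fun w => sub_elt (pol_sub L (aw_coef_pol HF (aw_val a) w))).
  apply: aw_val_inj; rewrite rmorph_sum {1}(aw_coef_expand HF (aw_val a)).
  rewrite [RHS]big_mkcond; apply: eq_bigr => v _; case: ifPn => vH; last first.
    by rewrite (sub_supported HF Hinv) ?mulr0 //; exact: aw_val_sub.
  by rewrite rmorphM (perm_eltK F vH).
- move=> l v lL vH; rewrite key //; apply: aw_val_inj.
  have lH := subsetP sLH _ lL; rewrite rmorphM !perm_eltK ?groupM //.
  by rewrite aw_permM.
Qed.

End SubalgebraSpan.

Definition mk_linear (R : pzRingType) (U V : lmodType R) (f : U -> V)
    (fL : linear f) : {linear U -> V} :=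
  HB.pack f (GRing.isLinear.Build R U V *:%R f fL).

Lemma evenly_iso_inverse (R : pzRingType) (M N : hmod R) (g : {linear M -> N}) :
  bijective g -> (forall d p v, mhom d p v <-> mhom d p (g v)) -> evenly_iso N M.
Proof.
case=> f fK gK gh.
have fL : linear f.
  by move=> a u v; apply: (can_inj fK); rewrite gK linearP !gK.
exists (mk_linear fL); split; first by exists g.
by move=> d p v; rewrite gh /= gK.
Qed.

(** * The twisting isomorphism *)

Section Twist.
Variables (k : comNzRingType) (F : frobData k) (n : nat) (mu nu : seq nat).
Hypothesis HF : is_frobenius F.
Implicit Types (u v w s h : 'S_n).
Notation A := (aw F n).
Notation P := (@aw_perm k F n).
Notation H := (young n mu).
Notation K := (young n nu).
Notation rep := (@dcoset_rep n mu nu).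

Definition dcosets (q : pred 'S_n) : {set 'S_n} := [set w | q (rep w)].

Definition bruhat_ideal (q : pred 'S_n) := forall u w,
  u \in min_dcoset n mu nu -> w \in min_dcoset n mu nu ->
  bruhat u w -> q w -> q u.

Lemma dcosets_lower q : bruhat_ideal q -> lower_closed (dcosets q).
Proof.
move=> qI w i j; rewrite !inE => qw /(dcoset_rep_tperm mu nu) le.
by apply: qI le qw; apply: dcoset_rep_min.
Qed.

Lemma dcosets_mulr q w h : w \in dcosets q -> h \in H -> (w * h)%g \in dcosets q.
Proof.
rewrite ![_ \in dcosets _]inE => qw hH.
by rewrite -[(w * h)%g]mul1g mulgA dcoset_rep_mul // (group1 (young_group n nu)).
Qed.

Lemma dcosets_mull q w h : w \in dcosets q -> h \in K -> (h * w)%g \in dcosets q.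
Proof.
rewrite ![_ \in dcosets _]inE => qw hK.
by rewrite -[(h * w)%g]mulg1 dcoset_rep_mul // (group1 (young_group n mu)).
Qed.

Variable pi : 'S_n.
Hypothesis piD : pi \in min_dcoset n mu nu.

(** The double cosets strictly below that of pi: they carry the error terms
  when an element is moved past pi. *)
Definition below : pred 'S_n := fun u => bruhat u pi && (u != pi).

Lemma below_ideal : bruhat_ideal below.
Proof.
move=> u w _ _ uw /andP [wpi npi]; apply/andP; split; first exact: bruhat_trans uw wpi.
by apply: contra npi => /eqP e; rewrite (bruhat_anti wpi) // -{1}e.
Qed.

Notation HK := (young_capl mu nu pi).
Notation KH := (young_capr mu nu pi).

Lemma young_capl_sub : HK \subset H. Proof. exact: subsetIl. Qed.
Lemma young_capr_sub : KH \subset K. Proof. exact: subsetIr. Qed.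

Lemma young_capl_conj s : s \in HK -> (pi * s * pi^-1)%g \in KH.
Proof.
case/setIP=> sH sK; apply/setIP; split.
  by rewrite mem_conjgV conjgE !mulgA mulVg mul1g mulgKV.
by move: sK; rewrite mem_conjg conjgE invgK mulgA.
Qed.

(** The relation of which the twisting isomorphism is the graph; it is
  stable under the ring operations and can be checked on generators. *)
Definition twisted (a b : A) := supported (dcosets below) (a * P pi - P pi * b).

Lemma twistedB a a' b b' : twisted a b -> twisted a' b' -> twisted (a - a') (b - b').
Proof.
move=> ab ab'; have := supportedB HF ab ab'; rewrite /twisted; congr supported.
by rewrite mulrBl mulrBr !opprB addrACA [RHS]addrACA [X in _ + X]addrC.
Qed.

Lemma twisted_eq a b : a * P pi = P pi * b -> twisted a b.
Proof. by move=> e w _; rewrite e subrr aw_coef0 // ffunE. Qed.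

(** The error terms form a bimodule for the two subalgebras of the Young
  subgroups. *)
Lemma twisted_mul a a' b b' : a \in aw_sub_pred H -> b' \in aw_sub_pred K ->
  twisted a b -> twisted a' b' -> twisted (a * a') (b * b').
Proof.
move=> aH bK ab ab'.
have H1 : supported (dcosets below) (a * (a' * P pi - P pi * b')).
  apply: (supported_left HF (K := H)) ab' => //.
  - exact/dcosets_lower/below_ideal.
  - by move=> w h; apply: dcosets_mulr.
have H2 : supported (dcosets below) ((a * P pi - P pi * b) * b').
  apply: (supported_right HF (K := young_group n nu)) ab => //.
    exact: young_inversion_closed.
  by move=> w h; apply: dcosets_mull.
have := supportedB HF H1 (supportedB HF (supportedB HF H2 H2) H2).
rewrite subrr sub0r opprK; rewrite /twisted; congr supported.
by rewrite mulrBr mulrBl !mulrA addrA subrK.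
Qed.

(** The error terms involve permutations obtained from pi by removing an
  inversion. They are shorter than pi, while every element of the double
  coset of pi is above pi. *)
Lemma twisted_x i : twisted (aw_x F i) (aw_x F ((pi^-1)%g i)).
Proof.
apply: (supported_x_perm HF) => j lt; rewrite inE; apply/andP; split.
  by have := dcoset_rep_tperm mu nu lt; rewrite (dcoset_rep_id piD).
apply/eqP => e; have := bruhat_length (dcoset_rep_le mu nu (pi * tperm i j)%g).
by rewrite e => -[e'|lt']; move: lt; rewrite -?e' ?ltnn // ltnNge ltnW.
Qed.

Lemma twisted_ten f : twisted (aw_ten f) (conj_ten pi f).
Proof. by apply: twisted_eq; rewrite /conj_ten !mulrA aw_permV mul1r. Qed.

Lemma twisted_perm s : twisted (P s) (P (pi * s * pi^-1)%g).
Proof. by apply: twisted_eq; rewrite !aw_permM mulgKV. Qed.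

Lemma twisted_cst c : twisted (aw_cst F n c) (aw_cst F n c).
Proof. by apply: twisted_eq; rewrite aw_cstC. Qed.

Lemma twisted_exists a : a \in aw_sub_pred HK ->
  exists b, b \in aw_sub_pred KH /\ twisted a b.
Proof.
move: a; apply: aw_sub_ind => [f|i|s sHK|c|a a' [b [bK ab]] [b' [bK' ab']]|
  a a' aH aH' [b [bK ab]] [b' [bK' ab']]].
- by exists (conj_ten pi f); split; [exact: aw_sub_conj|exact: twisted_ten].
- by exists (aw_x F ((pi^-1)%g i)); split; [exact: aw_sub_x|exact: twisted_x].
- exists (P (pi * s * pi^-1)%g); split; last exact: twisted_perm.
  exact/aw_sub_perm/young_capl_conj.
- by exists (aw_cst F n c); split; [exact: aw_sub_cst|exact: twisted_cst].
- by exists (b - b'); split; [rewrite rpredB|exact: twistedB].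
- exists (b * b'); split; first by rewrite rpredM.
  apply: twisted_mul => //; first exact: (aw_sub_mono young_capl_sub).
  exact: (aw_sub_mono young_capr_sub).
Qed.

(** The permutations pi h occurring in pi b lie in the double coset of pi,
  so they do not meet the error terms. *)
Lemma twisted0 b : b \in aw_sub_pred K -> twisted 0 b -> b = 0.
Proof.
move=> bK b0; rewrite (aw_coef_expand HF b) big1 // => h _.
have [hK|hK] := boolP (h \in K); last first.
  have Kinv := @young_inversion_closed n nu.
  by rewrite (@sub_supported _ _ _ HF (young_group n nu) b Kinv bK) ?mulr0.
have hZ : (h * pi)%g \notin dcosets below.
  rewrite inE -[(h * pi)%g]mulg1 (dcoset_repE piD hK (group1 _)).
  by rewrite /below eqxx andbF.
have : aw_coef (P pi * b) (h * pi)%g = 0.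
  apply: oppr_inj; rewrite oppr0 -(b0 _ hZ) mul0r sub0r.
  by rewrite /aw_coef [in RHS]aw_actN // ffunE.
by rewrite aw_coef_permM // mulgK => ->; rewrite mulr0.
Qed.

Lemma twisted_unique a b b' : b \in aw_sub_pred KH -> b' \in aw_sub_pred KH ->
  twisted a b -> twisted a b' -> b = b'.
Proof.
move=> bK bK' ab ab'; apply/eqP; rewrite -subr_eq0; apply/eqP/twisted0.
  by rewrite (aw_sub_mono young_capr_sub) // rpredB.
by rewrite -(subrr a); apply: twistedB.
Qed.

(** The isomorphism phi_{pi^{-1}}: the value at a is the unique b for which
  a pi and pi b have the same leading term. *)
Definition twist (a : AWsub F HK) : AWsub F KH :=
  Sub (sval (cid (twisted_exists (aw_val_sub a))))
    (proj1 (svalP (cid (twisted_exists (aw_val_sub a))))).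

Lemma twistP a : twisted (aw_val a) (aw_val (twist a)).
Proof. exact: (proj2 (svalP (cid (twisted_exists (aw_val_sub a))))). Qed.

Lemma twistE a b : b \in aw_sub_pred KH -> twisted (aw_val a) b -> aw_val (twist a) = b.
Proof. by move=> bK ab; apply: twisted_unique ab => //; [exact: valP|exact: twistP]. Qed.

Fact twist_is_zmod_morphism : zmod_morphism twist.
Proof.
move=> a b; apply: aw_val_inj; rewrite rmorphB; apply: twistE.
  by rewrite rpredB // aw_val_sub.
by rewrite rmorphB; apply: twistedB; apply: twistP.
Qed.
Fact twist_is_monoid_morphism : monoid_morphism twist.
Proof.
split=> [|a b]; apply: aw_val_inj.
  by rewrite rmorph1; apply: twistE; rewrite ?rpred1 // rmorph1 -(aw_cst1 F n); apply: twisted_cst.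
rewrite rmorphM; apply: twistE; first by rewrite rpredM // aw_val_sub.
rewrite rmorphM; apply: twisted_mul; try exact: twistP.
  by rewrite (aw_sub_mono young_capl_sub) // aw_val_sub.
by rewrite (aw_sub_mono young_capr_sub) // aw_val_sub.
Qed.
HB.instance Definition _ := GRing.isZmodMorphism.Build _ _ twist twist_is_zmod_morphism.
HB.instance Definition _ := GRing.isMonoidMorphism.Build _ _ twist twist_is_monoid_morphism.
Definition twist_morphism : {rmorphism AWsub F HK -> AWsub F KH} := twist.

Lemma twist_is_twist : @is_twist k F n mu nu pi twist_morphism.
Proof.
move=> a; split=> [c e|s sHK e|i f e|i e]; apply: twistE; rewrite ?e.
- exact: aw_sub_cst.
- exact: twisted_cst.
- exact/aw_sub_perm/young_capl_conj.
- exact: twisted_perm.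
- exact: aw_sub_ten.
- rewrite -[aw_ten (slot ((pi^-1)%g i) f)](conj_slot HF pi i f); exact: twisted_ten.
- exact: aw_sub_x.
- exact: twisted_x.
Qed.

End Twist.

(** * Submodules and subquotients attached to double cosets *)

Section Mackey.
Variables (k : comNzRingType) (F : frobData k) (n : nat) (mu nu : seq nat).
Hypothesis HF : is_frobenius F.
Variable M : hmod (AWsub F (young n nu)).
Hypothesis gM : graded_module M.
Implicit Types (u v w s h : 'S_n) (m : M).
Notation A := (aw F n).
Notation P := (@aw_perm k F n).
Notation H := (young n mu).
Notation K := (young n nu).
Notation rep := (@dcoset_rep n mu nu).
Notation dcs := (dcosets mu nu).
Notation ind := (ind_type (aw_val (H := K)) M).
Notation pureM := (pure (aw_val (H := K)) (V := M)).
Notation coord := (@ind_coord k F n HF (young_group n nu) M).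

Notation Kinv := (@young_inversion_closed n nu).
Notation Hinv := (@young_inversion_closed n mu).

Definition in_dcosets (q : pred 'S_n) (x : ind) := forall w, w \notin dcs q -> coord w x = 0.

Lemma in_dcosets_pure q a m : supported (dcs q) a -> in_dcosets q (pureM a m).
Proof.
move=> aq w wq; apply: (@ind_coord_supported _ _ _ HF (young_group n nu) Kinv M (dcs q)) => // w' h.
exact: dcosets_mull.
Qed.

Lemma in_dcosetsD q x y : in_dcosets q x -> in_dcosets q y -> in_dcosets q (x + y).
Proof. by move=> Hx Hy w wq; rewrite (ind_coordD HF Kinv) Hx // Hy // addr0. Qed.

Lemma in_dcosets0 q : in_dcosets q 0.
Proof. by move=> w _; rewrite (ind_coord0 HF Kinv). Qed.

Lemma in_dcosets_expand q x : in_dcosets q x ->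
  x = \sum_(v | (repr (young_group n nu :* v)%g == v) && (v \in dcs q))
        pureM (P v) (coord v x).
Proof.
move=> xq; rewrite [LHS](ind_coord_expand HF Kinv x) [RHS]big_mkcondr /=.
by apply: eq_bigr => v _; case: ifPn => // vq; rewrite xq // pure0r.
Qed.

Lemma in_dcosets_sum q (I : Type) (t : seq I) (Q : pred I) (G : I -> ind) :
  (forall i, Q i -> in_dcosets q (G i)) -> in_dcosets q (\sum_(i <- t | Q i) G i).
Proof. by move=> HG; elim/big_ind: _ => //; [exact: in_dcosets0|exact: in_dcosetsD]. Qed.

Lemma in_dcosets_scale q a x : bruhat_ideal mu nu q -> a \in aw_sub_pred H ->
  in_dcosets q x -> in_dcosets q (a *: x).
Proof.
move=> qI aH xq; rewrite (in_dcosets_expand xq) scaler_sumr.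
apply: in_dcosets_sum => v /andP [_ vq]; rewrite pureZ; apply: in_dcosets_pure.
apply: (supported_left HF (K := H)) => //; first exact: dcosets_lower.
  by move=> w h; apply: dcosets_mulr.
exact: supported_perm.
Qed.

Lemma pure_perm_hom d p v m : mhom d p m -> ind_hom d p (pureM (P v) m).
Proof. by move=> hm; rewrite -[d]add0r -[p]addFb; apply: ih_pure => //; apply: ah_perm. Qed.

Lemma ind_hom_sum d p (R S : hring) (phi : {rmorphism R -> S}) (N : hmod R)
    (I : Type) (t : seq I) (Q : pred I) (G : I -> ind_type phi N) :
  (forall i, Q i -> ind_hom d p (G i)) -> ind_hom d p (\sum_(i <- t | Q i) G i).
Proof.
move=> HG; elim/big_ind: _ => // [|x y hx hy]; first exact: ih_zero.
by rewrite -[y]opprK; apply: ih_sub => //; rewrite -sub0r; apply: ih_sub => //; exact: ih_zero.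
Qed.

Section Submodule.
Variables (q : pred 'S_n) (qI : bruhat_ideal mu nu q).

Fact dcosets_sub0 : in_dcosets q (0 : Res_Ind mu M). Proof. exact: in_dcosets0. Qed.

Fact dcosets_sub_lin (a : AWsub F H) (x y : Res_Ind mu M) :
  in_dcosets q x -> in_dcosets q y -> in_dcosets q (a *: x + y).
Proof.
move=> Hx Hy; apply: in_dcosetsD => //.
exact: (in_dcosets_scale qI (aw_val_sub a) Hx).
Qed.

(** The expansion along permutations is compatible with the grading, so it
  suffices to decompose the coordinates. *)
Fact dcosets_sub_homog (x : Res_Ind mu M) : in_dcosets q x ->
  exists s : seq (Res_Ind mu M), x = \sum_(y <- s) y /\
    forall y, y \in s -> in_dcosets q y /\ exists d p, mhom d p y.
Proof.
pose Q (x : Res_Ind mu M) := exists s : seq (Res_Ind mu M), x = \sum_(y <- s) y /\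
    forall y, y \in s -> in_dcosets q y /\ exists d p, mhom d p y.
have Q0 : Q 0 by exists [::]; rewrite big_nil.
have QD y z : Q y -> Q z -> Q (y + z).
  move=> [s [-> Hs]] [t [-> Ht]]; exists (s ++ t); rewrite big_cat; split=> // w.
  by rewrite mem_cat => /orP [/Hs|/Ht].
move=> /in_dcosets_expand e.
have : Q (\sum_(v | (repr (young_group n nu :* v)%g == v) && (v \in dcs q))
        pureM (P v) (coord v x)).
  elim/big_ind: _ => // v /andP [_ vq].
  elim/(grading_ind (proj1 gM)): (coord v x) => [d p m hm|m m' IH IH'].
    exists [:: pureM (P v) m]; rewrite big_seq1; split=> // y /[!inE] /eqP ->.
    split; last by exists d, p; apply: pure_perm_hom.
    exact/in_dcosets_pure/supported_perm.
  by rewrite pureDr; apply: QD.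
by rewrite -e.
Qed.

Definition dcosets_submod : gsubmod (Res_Ind mu M) :=
  GSubmod dcosets_sub0 dcosets_sub_lin dcosets_sub_homog.

End Submodule.

(** The representatives lie in distinct cosets, so only the summand of w
  contributes to the coordinate at w pi. *)
Lemma coord_translate pi (Q : pred 'S_n) (m : 'S_n -> M) w :
  (forall u v, Q u -> Q v -> (pi * u * (pi * v)^-1)%g \in K -> u = v) -> Q w ->
  coord (pi * w)%g (\sum_(v | Q v) pureM (P (pi * v)%g) (m v)) = m w.
Proof.
move=> Qsep Qw; rewrite (ind_coord_sum HF Kinv) (bigD1 w) //= (ind_coord_perm HF Kinv).
rewrite big1 ?addr0 // => v /andP [Qv vw]; apply: (ind_coord_perm_off HF Kinv).
by apply: contra vw => vwK; apply/eqP/Qsep.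
Qed.

Section Piece.
Variables (pi : 'S_n) (q q' : pred 'S_n).
Hypotheses (piD : pi \in min_dcoset n mu nu).
Hypotheses (qI : bruhat_ideal mu nu q) (qI' : bruhat_ideal mu nu q').
Hypothesis q'E : forall u, u \in min_dcoset n mu nu -> q' u = q u || (u == pi).
Hypothesis npi : ~~ q pi.

Notation N' := (dcosets_submod qI').
Notation N := (dcosets_submod qI).
Notation L := (young_group n mu :&: young_group n nu :^ pi)%G.
Notation phi := (twist_morphism HF piD).
Notation iota := (@incl_capl k F n mu nu pi).
Notation Npi := (Res phi (Res (@incl_capr k F n mu nu pi) M)).

Notation pureL := (@pure _ _ iota Npi).

Lemma qpi : q' pi. Proof. by rewrite q'E // eqxx orbT. Qed.

Lemma supportedS (Z Z' : {set 'S_n}) (a : A) : Z \subset Z' -> supported Z a -> supported Z' a.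
Proof. by move=> /subsetP ZZ aZ w wZ; apply: aZ; apply: contra wZ => /ZZ. Qed.

Lemma below_sub : dcs (below pi) \subset dcs q.
Proof.
apply/subsetP => w; rewrite !inE => /andP [le ne].
have : q' (rep w) by apply: (qI' _ piD le qpi); apply: dcoset_rep_min.
by rewrite q'E ?dcoset_rep_min // (negbTE ne) orbF.
Qed.

Lemma piece_mem (a : AWsub F H) m : in_dcosets q' (pureM (aw_val a * P pi) m).
Proof.
apply/in_dcosets_pure/(supported_left HF (K := H)).
- exact: dcosets_lower.
- by move=> w h; apply: dcosets_mulr.
- exact: aw_val_sub.
- by apply: (supported_perm HF); rewrite inE (dcoset_rep_id piD) qpi.
Qed.

Definition piece_fun (a : AWsub F H) (m : Npi) : Subquot N' N :=
  to_sq N (@in_sub _ _ N' _ (piece_mem a m)).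

Lemma piece_funDl a b m : piece_fun (a + b) m = piece_fun a m + piece_fun b m.
Proof.
rewrite sq_addE -to_sqD; congr (to_sq N _); apply: val_inj.
have : pureM (aw_val (a + b) * P pi) m =
  pureM (aw_val a * P pi) m + pureM (aw_val b * P pi) m; last by [].
by rewrite rmorphD mulrDl pureDl.
Qed.
Lemma piece_funDr a m m' : piece_fun a (m + m') = piece_fun a m + piece_fun a m'.
Proof.
rewrite sq_addE -to_sqD; congr (to_sq N _); apply: val_inj.
exact: (pureDr _ (aw_val a * P pi)).
Qed.
Lemma piece_funZ (b a : AWsub F H) m : piece_fun (b * a) m = b *: piece_fun a m.
Proof.
rewrite -[RHS]to_sqZ; congr (to_sq N _); apply: val_inj.
have : pureM (aw_val (b * a) * P pi) m = aw_val b *: pureM (aw_val a * P pi) m; last by [].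
by rewrite rmorphM -mulrA -pureZ.
Qed.
(** Moving r past pi yields the twist of r up to lower double cosets, and
  these vanish in the quotient. *)
Lemma piece_fun_bal a r (m : Npi) : piece_fun (a * iota r) m = piece_fun a (r *: m).
Proof.
apply/to_sqP => /=.
pose r' := @incl_capr k F n mu nu pi (phi r).
have -> : pureM (aw_val (a * iota r) * P pi) m - pureM (aw_val a * P pi) (r' *: (m : M)) =
    pureM (aw_val a * (aw_val r * P pi - P pi * aw_val (phi r))) m.
  rewrite mulrBr pureDl pureNl rmorphM !mulrA; congr (_ - _).
  by rewrite -(pure_bal _ (aw_val a * P pi) r').
apply/in_dcosets_pure/(supportedS below_sub)/(supported_left HF (K := H)).
- exact/dcosets_lower/below_ideal.
- by move=> w h; apply: dcosets_mulr.
- exact: aw_val_sub.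
- exact: twistP.
Qed.

Definition piece_map : ind_type iota Npi -> Subquot N' N :=
  @ind_lift _ _ iota Npi _ piece_fun.
Lemma piece_map_linear : linear piece_map.
Proof.
exact: (@ind_lift_linear _ _ iota Npi _ _ piece_funDl piece_funDr piece_fun_bal
  piece_funZ).
Qed.
Lemma piece_map_pure a m : piece_map (pureL a m) = piece_fun a m.
Proof. exact: (@ind_lift_pure _ _ iota Npi _ _ piece_funDl piece_funDr piece_fun_bal). Qed.
Lemma piece_mapD : {morph piece_map : x y / x + y}.
Proof. exact: (@ind_liftD _ _ iota Npi _ _ piece_funDl piece_funDr piece_fun_bal). Qed.
Lemma piece_map0 : piece_map 0 = 0.
Proof. exact: (@ind_lift0 _ _ iota Npi _ _ piece_funDl piece_funDr piece_fun_bal). Qed.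

Lemma piece_mapB x y : piece_map (x - y) = piece_map x - piece_map y.
Proof.
rewrite piece_mapD; congr (_ + _).
exact: (@ind_liftN _ _ iota Npi _ _ piece_funDl piece_funDr piece_fun_bal).
Qed.

(** The element x of the larger submodule represents the image of y. This
  avoids carrying membership proofs through sums. *)
Definition piece_rel (y : ind_type iota Npi) (x : ind) :=
  exists Hx : N' x, piece_map y = to_sq N (@in_sub _ _ N' _ Hx).

Lemma piece_relD y y' x x' : piece_rel y x -> piece_rel y' x' -> piece_rel (y + y') (x + x').
Proof.
move=> [Hx e] [Hx' e']; exists (in_dcosetsD Hx Hx').
rewrite piece_mapD e e' sq_addE -to_sqD; congr (to_sq N _); exact: val_inj.
Qed.
Lemma piece_rel0 : piece_rel 0 0.
Proof.
exists (@in_dcosets0 q'); rewrite piece_map0; apply/to_sqP => /=.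
by rewrite subrr; apply: in_dcosets0.
Qed.
Lemma piece_rel_pure a m : piece_rel (pureL a m) (pureM (aw_val a * P pi) m).
Proof. by exists (piece_mem a m); rewrite piece_map_pure. Qed.

(** Representatives v of the cosets of the intersection L in H have products
  v pi in distinct cosets of K: if the conjugate by pi of v^{-1} u, for u
  and v in H, lies in K, then v^{-1} u lies in L. So the coefficients of y
  can be read off as coordinates. *)
Lemma piece_coords y : exists m : 'S_n -> M,
  let Q := fun v => (v \in H) && (repr (L :* v)%g == v) in
  [/\ y = \sum_(v | Q v) pureL (perm_elt F (young_group n mu) v) (m v),
      piece_rel y (\sum_(v | Q v) pureM (P (pi * v)%g) (m v)) &
      forall w, Q w -> coord (pi * w)%g (\sum_(v | Q v) pureM (P (pi * v)%g) (m v)) = m w].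
Proof.
have [m e] := @sub_ind_span k F n HF L (young_group n mu) (subsetIl _ _) Hinv Npi y.
exists m; split => //.
  rewrite {1}e; apply: (big_ind2 piece_rel); first exact: piece_rel0.
    by move=> *; apply: piece_relD.
  move=> v /andP [vH _]; rewrite -aw_permM.
  have := piece_rel_pure (perm_elt F (young_group n mu) v) (m v).
  by rewrite (@perm_eltK _ _ _ (young_group n mu)).
move=> w Qw; apply: coord_translate => // u v /andP [uH /eqP ru] /andP [vH /eqP rv] uvK.
rewrite -ru -rv; congr repr; apply: rcoset_eqP; rewrite mem_rcoset.
apply/setIP; split.
  by rewrite (groupM (G := young_group n mu)) ?(groupVr (G := young_group n mu)).
by rewrite mem_conjg conjgE invgK; move: uvK; rewrite invMg !mulgA.
Qed.

Lemma coord_sub w x : w \in H -> N x -> coord (pi * w)%g x = 0.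
Proof.
move=> wH; apply; rewrite inE -[(pi * w)%g]mul1g mulgA.
by rewrite (dcoset_repE piD (group1 (young_group n nu)) wH).
Qed.

(** If y maps to 0, it is represented by an element of the smaller
  submodule, whose coordinates in the double coset of pi vanish. *)
Lemma piece_map_inj : injective piece_map.
Proof.
suff inj0 y : piece_map y = 0 -> y = 0.
  move=> y y' e; apply/eqP; rewrite -subr_eq0; apply/eqP/inj0.
  by rewrite piece_mapB e subrr.
have [m [ey [Hx ex] em]] := piece_coords y; rewrite ex => e0.
rewrite ey big1 // => v Qv; rewrite -(em v Qv).
have [/(_ e0) /= + _] := to_sqP N (@in_sub _ _ N' _ Hx) (sub_zero N').
rewrite subr0; case/andP: Qv => vH _ /(coord_sub vH) ->; exact: pure0r.
Qed.

(** An element of the double coset of pi is a product h pi k, and h pi k (x)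
  m is the image of h (x) k m. *)
Lemma piece_map_surj : forall z, exists y, piece_map y = z.
Proof.
elim/subquotP => -[x xP]; have Hx : N' x by apply/asboolP.
suff [y [Hx' e]] : exists y, piece_rel y x.
  by exists y; rewrite e; congr (to_sq N _); apply: val_inj.
rewrite (in_dcosets_expand Hx); elim/big_ind: _ => [|x1 x2 [y1 R1] [y2 R2]|v /andP [_ vq]].
- by exists 0; apply: piece_rel0.
- by exists (y1 + y2); apply: piece_relD.
move: (coord v x) => m.
have Hv : in_dcosets q' (pureM (P v) m) by apply/in_dcosets_pure/supported_perm.
have [vqq|vnq] := boolP (v \in dcs q).
  exists 0, Hv; rewrite piece_map0; apply/to_sqP => /=.
  have Nv : N (pureM (P v) m) by apply/in_dcosets_pure/supported_perm.
  rewrite sub0r; exact: (sm_N Nv).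
(* v is in the larger set but not in the smaller one: its representative is pi. *)
have [k1 [h [kK hH e]]] := dcoset_repP mu nu v.
have rv : rep v = pi.
  by move: vq vnq; rewrite !inE q'E ?dcoset_rep_min // => /orP [->|/eqP].
have := piece_rel_pure (perm_elt F (young_group n mu) h)
  (perm_elt F (young_group n nu) k1 *: m).
rewrite (@perm_eltK _ _ _ (young_group n mu)) // -pure_bal.
rewrite (@perm_eltK _ _ _ (young_group n nu)) // !aw_permM.
have -> : (k1 * (pi * h))%g = v by rewrite mulgA -rv -e.
move=> R.
by eexists; exact: R.
Qed.

(** A homogeneous representative has homogeneous coordinates, and these are
  the coefficients of y. *)
Lemma piece_map_hom d p y : mhom d p (y : Ind iota Npi) <-> mhom d p (piece_map y).
Proof.
split=> [|[x hx e]].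
  rewrite /=; elim=> {d p y} [d p|d p x y _ [x' hx ex] _ [y' hy ey]|d p e r a m ha hm].
  - exists (sub_zero N'); first exact: ih_zero.
    by rewrite piece_map0.
  - exists (sub_add x' (sub_opp y')); first exact: ih_sub.
    by rewrite piece_mapB ex ey to_sqD to_sqN.
  - exists (@in_sub _ _ N' _ (piece_mem a m)); last exact: piece_map_pure.
    rewrite -[d]addr0 -[p]addbF; apply: ih_pure => //.
    by apply: ah_mul => //; apply: ah_perm.
have [m [ey [Hx ex] em]] := piece_coords y; rewrite ey.
apply: ind_hom_sum => v Qv; rewrite -[d]add0r -[p]addFb; apply: ih_pure.
  have [vH _] := andP Qv.
  change (aw_hom 0 false (aw_val (perm_elt F (young_group n mu) v))).
  by rewrite (@perm_eltK _ _ _ (young_group n mu)) //; apply: ah_perm.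
rewrite -(em v Qv).
have /to_sqP /= Nd : to_sq N (@in_sub _ _ N' _ Hx) = to_sq N x by rewrite -ex.
have -> : coord (pi * v)%g (\sum_(v | (v \in H) && (repr (L :* v)%g == v))
    pureM (P (pi * v)%g) (m v)) = coord (pi * v)%g (val x).
  apply/eqP; rewrite -subr_eq0 -(ind_coordN HF Kinv) -(ind_coordD HF Kinv).
  by apply/eqP/coord_sub => //; case/andP: Qv.
exact: (ind_coord_hom HF Kinv).
Qed.

Lemma piece_iso : evenly_iso (Subquot N' N) (mackey_piece M phi).
Proof.
apply: (@evenly_iso_inverse _ (mackey_piece M phi) _ (mk_linear piece_map_linear)).
  have surj z : {y | piece_map y = z} := cid (piece_map_surj z).
  exists (fun z => sval (surj z)) => x /=; last exact: (svalP (surj x)).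
  by apply: piece_map_inj; exact: (svalP (surj _)).
exact: piece_map_hom.
Qed.

End Piece.

End Mackey.

(** * The Mackey filtration *)

Section Filtration.
Variables (k : comNzRingType) (F : frobData k) (n : nat) (mu nu : seq nat).
Hypothesis HF : is_frobenius F.
Variable M : hmod (AWsub F (young n nu)).
Hypothesis gM : graded_module M.
Implicit Types (u v w : 'S_n) (m : M).

Notation H := (young n mu).
Notation K := (young n nu).
Notation dcs := (dcosets mu nu).
Notation coord := (@ind_coord k F n HF (young_group n nu) M).
Notation Kinv := (@young_inversion_closed n nu).
Notation Hinv := (@young_inversion_closed n mu).

Section Order.
Variable s : seq 'S_n.
Hypotheses (senum : enumerates_dcosets mu nu s) (sref : refines_bruhat s).

Definition first_dcosets (i : nat) : pred 'S_n := fun u => (index u s < i)%N.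

Lemma first_dcosets_ideal i : bruhat_ideal mu nu (first_dcosets i).
Proof.
have [_ sD] := senum; move=> u w; rewrite -!sD => us ws uw.
exact/leq_ltn_trans/sref.
Qed.

Lemma mackey_filtration_of_order : mackey_filtration mu M s.
Proof.
have [us sD] := senum; have repD := dcoset_rep_min mu nu.
exists (fun i => dcosets_submod HF gM (@first_dcosets_ideal i)); split.
- move=> v; split=> [v0|->]; last exact: in_dcosets0.
  rewrite (in_dcosets_expand v0) big1 // => w /andP [_].
  by rewrite inE.
- move=> v; change (in_dcosets mu HF (first_dcosets (size s)) v) => w.
  by rewrite inE /first_dcosets index_mem => /negP []; rewrite sD repD.
- move=> i v _ vi w; rewrite inE => wi; apply: vi; rewrite inE.
  by apply: contra wi; apply: ltnW.
move=> i si; have piD : nth 1%g s i \in min_dcoset n mu nu by rewrite -sD mem_nth.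
exists (twist_morphism HF piD); first exact: twist_is_twist.
apply: piece_iso => [u uD|].
  rewrite /first_dcosets ltnS leq_eqVlt orbC; congr (_ || _).
  apply/eqP/eqP => [<-|->]; last by rewrite index_uniq.
  by rewrite nth_index // sD.
by rewrite /first_dcosets index_uniq // ltnn.
Qed.

End Order.

(** Sorting by length refines the Bruhat order. *)
Lemma bruhat_order_exists : exists2 s : seq 'S_n, enumerates_dcosets mu nu s & refines_bruhat s.
Proof.
pose le u w := (perm_length u <= perm_length w)%N.
exists (sort le (enum (min_dcoset n mu nu))).
  split; first by rewrite sort_uniq enum_uniq.
  by move=> u; rewrite mem_sort mem_enum.
move=> u w us ws /bruhat_length [->//|lt]; rewrite leqNgt; apply/negP => iw.
have tr : transitive le by move=> x y z; apply: leq_trans.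
have tot : total le by move=> x y; apply: leq_total.
have := sorted_ltn_index tr (sort_sorted tot _) w u ws us iw.
by rewrite /le leqNgt lt.
Qed.

Notation L := (young_group n mu :&: young_group n nu)%G.
Notation iota := (aw_incl F (subsetIl H K)).
Notation Nres := (Res (aw_incl F (subsetIr H K)) M).
Notation pureM := (pure (aw_val (H := K)) (V := M)).
Notation pureL := (@pure _ _ iota Nres).

Definition embed_fun (a : AWsub F H) (m : Nres) : Res_Ind mu M := pureM (aw_val a) m.

Lemma embed_funDl a b m : embed_fun (a + b) m = embed_fun a m + embed_fun b m.
Proof. by rewrite /embed_fun rmorphD pureDl. Qed.
Lemma embed_funDr a m m' : embed_fun a (m + m') = embed_fun a m + embed_fun a m'.
Proof. exact: pureDr. Qed.
Lemma embed_fun_bal a r (m : Nres) : embed_fun (a * iota r) m = embed_fun a (r *: m).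
Proof.
rewrite /embed_fun rmorphM.
exact: (pure_bal (aw_val (H := K)) (aw_val a) (aw_incl F (subsetIr H K) r) (m : M)).
Qed.
Lemma embed_funZ b a m : embed_fun (b * a) m = b *: embed_fun a m.
Proof. by rewrite /embed_fun rmorphM -pureZ. Qed.

Definition embed : ind_type iota Nres -> Res_Ind mu M :=
  @ind_lift _ _ iota Nres _ embed_fun.
Lemma embed_linear : linear embed.
Proof.
exact: (@ind_lift_linear _ _ iota Nres _ _ embed_funDl embed_funDr embed_fun_bal embed_funZ).
Qed.
Lemma embed_pure a m : embed (pureL a m) = pureM (aw_val a) m.
Proof. exact: (@ind_lift_pure _ _ iota Nres _ _ embed_funDl embed_funDr embed_fun_bal). Qed.
Lemma embedD : {morph embed : x y / x + y}.
Proof. exact: (@ind_liftD _ _ iota Nres _ _ embed_funDl embed_funDr embed_fun_bal). Qed.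
Lemma embedN x : embed (- x) = - embed x.
Proof. exact: (@ind_liftN _ _ iota Nres _ _ embed_funDl embed_funDr embed_fun_bal). Qed.
Lemma embed0 : embed 0 = 0.
Proof. exact: (@ind_lift0 _ _ iota Nres _ _ embed_funDl embed_funDr embed_fun_bal). Qed.

(** The same reading of coefficients as coordinates, for the trivial
  permutation, in the induced module itself. *)
Lemma embed_coords (y : ind_type iota Nres) :
  y = \sum_(v | (v \in H) && (repr (L :* v)%g == v))
    pureL (perm_elt F (young_group n mu) v) (coord v (embed y)).
Proof.
have [m e] := @sub_ind_span k F n HF L (young_group n mu) (subsetIl _ _) Hinv Nres y.
rewrite {1}e; apply: eq_bigr => w Qw; congr (pureL _ _).
have -> : embed y = \sum_(v | (v \in H) && (repr (L :* v)%g == v))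
    pureM (aw_perm F (1 * v)%g) (m v).
  rewrite {1}e (big_morph _ embedD embed0); apply: eq_bigr => v /andP [vH _].
  by rewrite embed_pure (@perm_eltK _ _ _ (young_group n mu)) // mul1g.
rewrite -{2}[w]mul1g (coord_translate HF) // => u v.
move=> /andP [uH /eqP ru] /andP [vH /eqP rv]; rewrite !mul1g => uvK.
rewrite -ru -rv; congr repr; apply: rcoset_eqP; rewrite mem_rcoset.
apply/setIP; split=> //.
by rewrite (groupM (G := young_group n mu)) ?(groupVr (G := young_group n mu)).
Qed.

Lemma embeds_identity_piece : evenly_embeds (Ind iota Nres) (Res_Ind mu M).
Proof.
exists (mk_linear embed_linear); split.
  by move=> x y /= e; rewrite (embed_coords x) e -embed_coords.
move=> d p y; split; rewrite /=.
  elim=> {d p y} [d p|d p x y _ hx _ hy|d p e r a m ha hm].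
  - by rewrite embed0; apply: ih_zero.
  - by rewrite embedD embedN; apply: ih_sub.
  - by rewrite embed_pure; apply: ih_pure.
move=> hy; rewrite (embed_coords y); apply: ind_hom_sum => v /andP [vH _].
rewrite -[d]add0r -[p]addFb; apply: ih_pure; last exact: (ind_coord_hom HF Kinv).
change (aw_hom 0 false (aw_val (perm_elt F (young_group n mu) v))).
by rewrite (@perm_eltK _ _ _ (young_group n mu)) //; apply: ah_perm.
Qed.

End Filtration.

Theorem theorem4p22 (k : comNzRingType) (F : frobData k) (theta n : nat)
    (mu nu : seq nat) (M : hmod (AWsub F (young n nu))) :
  (forall c, has_char k c -> c <> 2%N) ->
  is_frobenius F ->
  has_order (fnak F) theta ->
  (forall c, has_char k c -> ~~ (c %| theta)%N) ->
  has_eigenbasis (fnak F) ->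
  composition n mu ->
  composition n nu ->
  graded_module M ->
  [/\ exists2 s, enumerates_dcosets mu nu s & mackey_filtration mu M s,
      forall s : seq 'S_n, enumerates_dcosets mu nu s -> refines_bruhat s ->
        mackey_filtration mu M s
    & evenly_embeds
        (Ind (aw_incl F (subsetIl (young n mu) (young n nu)))
           (Res (aw_incl F (subsetIr (young n mu) (young n nu))) M))
        (Res_Ind mu M)].
Proof.
move=> _ HF _ _ _ _ _ gM; split.
- have [s senum sref] := bruhat_order_exists n mu nu.
  by exists s => //; apply: mackey_filtration_of_order.
- by move=> s; apply: mackey_filtration_of_order.
- exact: embeds_identity_piece.
Qed.
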